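(* A finite digraph $G$ is diagonal if and only if it satisfies property $(\mathcal{V}_2)$ (any two shortest paths connecting the same vertices are $2$-shortly congruent, and any long path is $2$-quasi-reducible) and, for any field $\mathbb{K}$, the complex $\mathsf{K}^G_\bullet$ is a resolution of $S$.
   Context: A digraph $G$ consists of a set of vertices and a set of arrows, which are ordered pairs of distinct vertices. A path of length $n\ge 0$ is a tuple of vertices $p=(p_0,\dots,p_n)$ such that each $(p_i,p_{i+1})$ is an arrow; $d(x,y)$ is the infimum of lengths of paths from $x$ to $y$ ($\infty$ if there are none). A path is shortest if $d(p_0,p_n)=n$, and long otherwise. A subpath of $p$ is a path $(p_i,\dots,p_j)$. Paths connect the same vertices if they have the same initial and terminal vertices. Magnitude homology: put $|x_0,\dots,x_n|=\sum_{i=0}^{n-1}d(x_i,x_{i+1})$. $\mathrm{MC}_{n,\ell}(G,\mathbb{Z})$ is the free abelian group on tuples of vertices with $x_i\neq x_{i+1}$ and $|x_0,\dots,x_n|=\ell$; the differential is $\sum_i(-1)^i\partial_{n,i}$, where $\partial_{n,i}$ deletes $x_i$ if the resulting tuple still has norm $\ell$ and is $0$ otherwise. $\mathrm{MH}_{n,\ell}(G,\mathbb{Z})=H_n(\mathrm{MC}_{\bullet,\ell}(G,\mathbb{Z}))$. $G$ is diagonal if $\mathrm{MH}_{n,\ell}(G,\mathbb{Z})=0$ for all $\ell\neq n$. An equivalence relation $\sim$ on paths is a congruence if $p\sim\tilde p$ implies that $p,\tilde p$ connect the same vertices and $qpq'\sim q\tilde pq'$ whenever the concatenations are defined. The $2$-short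 congruence is the minimal congruence such that any two shortest paths connecting the same two vertices at distance at most $2$ are equivalent. A long path is $2$-reducible if it contains a long subpath of length at most $2$, and $2$-quasi-reducible if it is $2$-shortly congruent to a $2$-reducible path. $\mathbb{K}G$ is the path algebra (free on all paths, including the length-zero paths $e_x=(x)$; product = concatenation, first path followed by the second, or zero; graded by length), and $S=(\mathbb{K}G)_0=\bigoplus_x\mathbb{K}e_x$. The path cochain algebra $\Omega^\bullet(G)$ is isomorphic as a graded algebra to $\mathbb{K}G/T$, where $T$ is the ideal generated by the elements $t_{x,y}=\sum_v(x,v,y)$ for all pairs with $d(x,y)=2$, the sum running over all vertices $v$ such that $(x,v,y)$ is a path; here this may be taken as its definition. $\mathsf{K}^G_\bullet$ is the chain complex of graded left $\Omega^\bullet(G)$-modules with $\mathsf{K}^G_n=\bigoplus_{d(x,y)=n}\Omega^\bullet(G)\cdot e_x$ (sum over all pairs $(x,y)$ with $d(x,y)=n$). The element $\kappa_{x,y}$ is $e_x$ in the summand indexed by $(x,y)$, with $|\kappa_{x,y}|=d(x,y)$, and the differential is $\partial(\kappa_{x,y})=\sum_{v}(x,v)\cdot\kappa_{v,y}$, the sum over vertices $v$ with $d(x,v)=1$ and $d(v,y)=n-1$. It is augmented to $S$ by the module homomorphism $\mathsf{K}^G_0\to S$, $\kappa_{x,x}\mapsto e_x$, where $S$ is regarded as a left $\Omega^\bullet(G)$-module on which elements of positive degree act by zero. *)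

(* Defs.v *)
From HB Require Import structures.
From mathcomp Require Import all_boot all_order all_algebra.
From mathcomp Require Import finmap monalg.
From mathcomp Require Import boolp.

Set Implicit Arguments.
Unset Strict Implicit.
Unset Printing Implicit Defensive.

Import GRing.Theory.

Local Open Scope quotient_scope.
Local Open Scope ring_scope.

(* ker g / im f, as the quotient of ker g by the cycles lying in im f. *)
Section Homology.
Variables (A B C : zmodType) (f : {additive A -> B}) (g : {additive B -> C}).

Definition is_cycle : {pred B} := fun b => g b == 0.

Lemma is_cycle_closed : zmod_closed is_cycle.
Proof.
split=> [|a b]; rewrite !unfold_in ?raddf0 // => /eqP ga /eqP gb.
by rewrite raddfB ga gb subrr.
Qed.
HB.instance Definition _ := GRing.isZmodClosed.Build B is_cycle is_cycle_closed.

Record cycle := Cycle { cycle_val : B; _ : cycle_val \in is_cycle }.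
HB.instance Definition _ := [isSub for cycle_val].
HB.instance Definition _ := [Choice of cycle by <:].
HB.instance Definition _ := [SubChoice_isSubZmodule of cycle by <:].

Definition is_boundary : {pred cycle} :=
  fun z => `[< exists a : A, f a = cycle_val z >].

Lemma is_boundary_closed : zmod_closed is_boundary.
Proof.
split=> [|a b]; rewrite !unfold_in.
  by apply/asboolP; exists 0; rewrite raddf0.
move=> /asboolP[a' fa] /asboolP[b' fb]; apply/asboolP; exists (a' - b').
by rewrite raddfB fa fb.
Qed.
HB.instance Definition _ :=
  GRing.isZmodClosed.Build cycle is_boundary is_boundary_closed.

Definition homology : zmodType := Quotient.quot is_boundary.

End Homology.

Definition exact_at (A B C : zmodType) (f : A -> B) (g : B -> C) : Prop :=
  forall b : B, g b = 0 <-> exists a : A, f a = b.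

Section QuotientRing.
Variable R : pzRingType.

Definition two_sided_ideal (I : R -> Prop) : Prop :=
  [/\ I 0, forall a b, I a -> I b -> I (a - b),
      forall a b, I b -> I (a * b) & forall a b, I a -> I (a * b)].

Definition ideal_gen (X : R -> Prop) : {pred R} := fun a =>
  `[< forall I, two_sided_ideal I -> (forall x, X x -> I x) -> I a >].

Variable X : R -> Prop.

Lemma ideal_genP a : reflect
  (forall I, two_sided_ideal I -> (forall x, X x -> I x) -> I a)
  (a \in ideal_gen X).
Proof. exact: (iffP (asboolP _)). Qed.

Lemma ideal_gen_zmod_closed : zmod_closed (ideal_gen X).
Proof.
split=> [|a b aT bT]; apply/ideal_genP => I idI XI;
  case: (idI) => I0 IB _ _ //.
by apply: IB; [move/ideal_genP: aT | move/ideal_genP: bT]; apply.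
Qed.
HB.instance Definition _ :=
  GRing.isZmodClosed.Build R (ideal_gen X) ideal_gen_zmod_closed.

Lemma ideal_genMl a b : b \in ideal_gen X -> a * b \in ideal_gen X.
Proof.
move/ideal_genP=> bT; apply/ideal_genP => I idI XI.
by case: (idI) => _ _ IMl _; apply: IMl; apply: bT.
Qed.

Lemma ideal_genMr a b : a \in ideal_gen X -> a * b \in ideal_gen X.
Proof.
move/ideal_genP=> aT; apply/ideal_genP => I idI XI.
by case: (idI) => _ _ _ IMr; apply: IMr; apply: aT.
Qed.

Definition quot_ring : Type := Quotient.quot (ideal_gen X).
HB.instance Definition _ := GRing.Zmodule.on quot_ring.
HB.instance Definition _ := EqQuotient.on quot_ring.

Definition quot_pi (a : R) : quot_ring := \pi_quot_ring a.

Lemma quot_pi_eq a b : quot_pi a = quot_pi b <-> a - b \in ideal_gen X.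
Proof.
rewrite /quot_pi (@Quotient.idealrBE R (ideal_gen X)).
by split=> [->|/eqP].
Qed.

Lemma quot_piK (u : quot_ring) : quot_pi (repr u) = u.
Proof. exact: reprK. Qed.

Lemma quot_pi_additive : zmod_morphism quot_pi.
Proof. by move=> a b; rewrite /quot_pi !piE. Qed.
HB.instance Definition _ :=
  GRing.isZmodMorphism.Build R quot_ring quot_pi quot_pi_additive.

Definition quot_one : quot_ring := quot_pi 1.
Definition quot_mul (u v : quot_ring) : quot_ring := quot_pi (repr u * repr v).

Lemma quot_piM a b : quot_pi (a * b) = quot_mul (quot_pi a) (quot_pi b).
Proof.
apply/quot_pi_eq; set a' := repr _; set b' := repr _.
have aa' : a - a' \in ideal_gen X by apply/quot_pi_eq; rewrite quot_piK.
have bb' : b - b' \in ideal_gen X by apply/quot_pi_eq; rewrite quot_piK.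
have -> : a * b - a' * b' = (a - a') * b + a' * (b - b').
  by rewrite mulrBl mulrBr addrA subrK.
by apply: rpredD; [apply: ideal_genMr | apply: ideal_genMl].
Qed.

Lemma quot_mulA : associative quot_mul.
Proof.
by move=> u v w; rewrite -[u]quot_piK -[v]quot_piK -[w]quot_piK -!quot_piM mulrA.
Qed.
Lemma quot_mul1r : left_id quot_one quot_mul.
Proof. by move=> u; rewrite -[u]quot_piK -quot_piM mul1r. Qed.
Lemma quot_mulr1 : right_id quot_one quot_mul.
Proof. by move=> u; rewrite -[u]quot_piK -quot_piM mulr1. Qed.
Lemma quot_mulDl : left_distributive quot_mul +%R.
Proof.
move=> u v w; rewrite -[u]quot_piK -[v]quot_piK -[w]quot_piK.
by rewrite -raddfD -!quot_piM -raddfD -mulrDl.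
Qed.
Lemma quot_mulDr : right_distributive quot_mul +%R.
Proof.
move=> u v w; rewrite -[u]quot_piK -[v]quot_piK -[w]quot_piK.
by rewrite -raddfD -!quot_piM -raddfD -mulrDr.
Qed.
HB.instance Definition _ := GRing.Zmodule_isPzRing.Build quot_ring
  quot_mulA quot_mul1r quot_mulr1 quot_mulDl quot_mulDr.

Lemma quot_pi_monoid : monoid_morphism quot_pi.
Proof. by split=> // a b; rewrite quot_piM. Qed.
HB.instance Definition _ :=
  GRing.isMonoidMorphism.Build R quot_ring quot_pi quot_pi_monoid.

End QuotientRing.

Record digraph := Digraph {
  vertex :> finType;
  arrow : rel vertex;
  arrow_irr : irreflexive arrow
}.

Section Paths.
Variable G : digraph.

(* (p_0, ..., p_n) is stored as p_0 and [:: p_1; ...; p_n]. *)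
Definition qpath := {p : G * seq G | path (@arrow G) p.1 p.2}.
HB.instance Definition _ := SubChoice.on qpath.

Definition init (p : qpath) : G := (val p).1.
Definition term (p : qpath) : G := last (val p).1 (val p).2.
Definition plen (p : qpath) : nat := size (val p).2.
Definition vseq (p : qpath) : seq G := (val p).1 :: (val p).2.

Definition connect_same (p q : qpath) : Prop :=
  init p = init q /\ term p = term q.

(* [None] when the paths are not composable. *)
Definition pconcat (p q : qpath) : option qpath :=
  if term p == init q then insub (init p, (val p).2 ++ (val q).2) else None.

Definition pconcat3 (p q r : qpath) : option qpath :=
  obind (fun pq => pconcat pq r) (pconcat p q).

Definition has_walk (x y : G) (n : nat) : bool :=
  [exists s : n.-tuple G, path (@arrow G) x s && (last x s == y)].

(* [None] stands for an infinite distance. *)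
Definition dist (x y : G) : option nat :=
  match pselect (exists n, has_walk x y n) with
  | left ex => Some (ex_minn ex)
  | right _ => None
  end.

Definition shortest (p : qpath) : Prop := dist (init p) (term p) = Some (plen p).
Definition long (p : qpath) : Prop := ~ shortest p.
Definition subpath (q p : qpath) : bool := infix (vseq q) (vseq p).

Definition equivalence (R : qpath -> qpath -> Prop) : Prop :=
  [/\ forall p, R p p, forall p q, R p q -> R q p
    & forall p q r, R p q -> R q r -> R p r].

Definition congruence (R : qpath -> qpath -> Prop) : Prop :=
  [/\ equivalence R,
      forall p p', R p p' -> connect_same p p'
    & forall p p' q q' r r', R p p' ->
        pconcat3 q p q' = Some r -> pconcat3 q p' q' = Some r' -> R r r'].

Definition two_short_congr (p p' : qpath) : Prop :=
  forall R, congruence R ->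
    (forall q q', shortest q -> shortest q' -> connect_same q q' ->
       (plen q <= 2)%N -> R q q') ->
    R p p'.

Definition two_reducible (p : qpath) : Prop :=
  long p /\ exists q, [/\ subpath q p, long q & (plen q <= 2)%N].

Definition two_quasi_reducible (p : qpath) : Prop :=
  long p /\ exists p', two_short_congr p p' /\ two_reducible p'.

Definition property_V2 : Prop :=
  (forall p p', shortest p -> shortest p' -> connect_same p p' ->
     two_short_congr p p') /\
  (forall p, long p -> two_quasi_reducible p).

End Paths.

Section Magnitude.
Variable G : digraph.

Definition oaddn (a b : option nat) : option nat :=
  if (a, b) is (Some m, Some n) then Some (m + n)%N else None.

Definition norm (s : seq G) : option nat :=
  if s is x :: s' then foldr oaddn (Some 0%N) (pairmap (@dist G) x s')
  else Some 0%N.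

Definition mag_gen (n l : nat) :=
  {t : n.+1.-tuple G | sorted [rel x y | x != y] t && (norm t == Some l)}.
HB.instance Definition _ n l := SubFinite.on (mag_gen n l).

(* Free abelian group on a finite set: [G] being finite, so is [mag_gen n l]. *)
Definition MC (n l : nat) : zmodType := {ffun mag_gen n l -> int}.

Definition MC_gen n l (t : mag_gen n l) : MC n l := [ffun s => (s == t)%:R].

Definition delete n (i : 'I_n.+2) (t : n.+2.-tuple G) : n.+1.-tuple G :=
  [tuple tnth t (lift i j) | j < n.+1].

(* [insub] also requires consecutive entries of the shortened tuple to be
   distinct, which holds automatically when the norm is unchanged. *)
Definition mag_face n l (i : 'I_n.+2) (t : mag_gen n.+1 l) : MC n l :=
  if insub (delete i (val t)) is Some s then MC_gen s else 0.

Definition mag_diffS n l (c : MC n.+1 l) : MC n l :=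
  \sum_t (\sum_(i < n.+2) mag_face i t *~ (-1) ^+ i) *~ c t.

Definition mag_diff n l : MC n l -> MC n.-1 l :=
  if n is n'.+1 then @mag_diffS n' l else fun _ => 0.

Lemma mag_diff_additive n l : zmod_morphism (@mag_diff n l).
Proof.
case: n => [|n] c c' /=; first by rewrite subr0.
rewrite /mag_diffS -sumrB; apply: eq_bigr => t _.
by rewrite !ffunE mulrzBr.
Qed.
HB.instance Definition _ n l := GRing.isZmodMorphism.Build
  (MC n l) (MC n.-1 l) (@mag_diff n l) (@mag_diff_additive n l).

Definition MH (n l : nat) : zmodType :=
  homology (@mag_diff n.+1 l) (@mag_diff n l).

Definition diagonal : Prop :=
  forall n l : nat, l <> n -> forall h : MH n l, h = 0.

End Magnitude.

Section PathAlgebra.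
Variables (K : fieldType) (G : digraph).

Definition path_alg : Type := {malg K[qpath G]}.
HB.instance Definition _ := GRing.Lmodule.on path_alg.

Definition pprod (p q : qpath G) : path_alg :=
  if pconcat p q is Some r then << r >> else 0.

Definition path_mul (f g : path_alg) : path_alg :=
  \sum_(p <- msupp f) \sum_(q <- msupp g) (f@_p * g@_q) *: pprod p q.

(* The basis element of the path (x, s_1, ..., s_n), or 0 if it is no path. *)
Definition path_elt (x : G) (s : seq G) : path_alg :=
  if insub (x, s) is Some p then << (p : qpath G) >> else 0.

Definition path_one : path_alg := \sum_(x : G) path_elt x [::].

Definition lin_ext (h : qpath G -> path_alg) (f : path_alg) : path_alg :=
  locked (\sum_(p <- msupp f) f@_p *: h p).

Lemma lin_extE h f : lin_ext h f = \sum_(p <- msupp f) f@_p *: h p.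
Proof. by rewrite /lin_ext -lock. Qed.

Lemma lin_extw h f (d : {fset qpath G}) : (msupp f `<=` d)%fset ->
  lin_ext h f = \sum_(p <- d) f@_p *: h p.
Proof.
move=> fd; rewrite lin_extE; apply: big_fset_incl => // p _ /mcoeff_outdom ->.
by rewrite scale0r.
Qed.

Lemma lin_ext_linear h : linear (lin_ext h).
Proof.
move=> a f g; pose d := (msupp f `|` msupp g `|` msupp (a *: f + g))%fset.
have fd : (msupp f `<=` d)%fset by rewrite /d -fsetUA fsubsetUl.
have gd : (msupp g `<=` d)%fset by rewrite /d fsetUAC fsubsetUr.
have hd : (msupp (a *: f + g) `<=` d)%fset by rewrite /d fsubsetUr.
rewrite (lin_extw _ fd) (lin_extw _ gd) (lin_extw _ hd).
rewrite scaler_sumr -big_split; apply: eq_bigr => p _ /=.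
by rewrite mcoeffD mcoeffZ scalerDl scalerA.
Qed.
HB.instance Definition _ h :=
  GRing.isLinear.Build K path_alg path_alg _ (lin_ext h) (lin_ext_linear h).

Lemma lin_extU h p : lin_ext h << p >> = h p.
Proof.
by rewrite (@lin_extw h _ [fset p]%fset) ?msuppU_le // big_seq_fset1 mcoeffUU
           scale1r.
Qed.

Lemma eq_lin_ext h h' f : h =1 h' -> lin_ext h f = lin_ext h' f.
Proof. by move=> hh'; rewrite !lin_extE; apply: eq_bigr => p _; rewrite hh'. Qed.

Lemma lin_ext_comp h h' f :
  lin_ext h (lin_ext h' f) = lin_ext (fun p => lin_ext h (h' p)) f.
Proof.
rewrite [lin_ext h' f]lin_extE linear_sum [RHS]lin_extE; apply: eq_bigr => p _.
by rewrite linearZ.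
Qed.

Lemma lin_ext_id f : lin_ext (fun p => << p >>) f = f.
Proof.
rewrite [RHS]monalgE lin_extE; apply: eq_bigr => p _.
apply/malgP => q; rewrite [in RHS]mcoeffU mcoeffZ mcoeffU.
by rewrite mulrnAr mulr1.
Qed.

Lemma lin_ext0 f : lin_ext (fun=> 0) f = 0.
Proof. by rewrite lin_extE; apply: big1 => p _; rewrite scaler0. Qed.

Lemma lin_extD h h' f :
  lin_ext (fun p => h p + h' p) f = lin_ext h f + lin_ext h' f.
Proof.
by rewrite !lin_extE -big_split; apply: eq_bigr => p _; rewrite scalerDr.
Qed.

Lemma lin_ext_sum (h : G -> qpath G -> path_alg) f :
  lin_ext (fun p => \sum_x h x p) f = \sum_x lin_ext (h x) f.
Proof.
under [RHS]eq_bigr do rewrite lin_extE.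
by rewrite lin_extE exchange_big; apply: eq_bigr => p _; rewrite scaler_sumr.
Qed.

Lemma path_mulE f g :
  path_mul f g = lin_ext (fun p => lin_ext (pprod p) g) f.
Proof.
rewrite lin_extE; apply: eq_bigr => p _.
rewrite lin_extE scaler_sumr; apply: eq_bigr => q _.
by rewrite scalerA.
Qed.

Lemma pconcat_val (p q r : qpath G) : pconcat p q = Some r <->
  term p = init q /\ val r = (init p, (val p).2 ++ (val q).2).
Proof.
rewrite /pconcat; case: eqP => [pq|pq]; last by split=> [|[]].
case: insubP => [r' _ r'E|]; last first.
  rewrite /= cat_path (valP p) /= => /negP[].
  by case: q pq => -[y s] /= ys; rewrite /init /term /= => ->.
rewrite -r'E; split=> [[<-]//|[_ rE]]; congr Some; exact/val_inj.
Qed.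

Lemma term_cat (p q r : qpath G) : pconcat p q = Some r -> term r = term q.
Proof.
move/pconcat_val=> [pq rE]; rewrite /term rE /= last_cat.
by rewrite -/(term p) pq.
Qed.

Lemma init_cat (p q r : qpath G) : pconcat p q = Some r -> init r = init p.
Proof. by move/pconcat_val=> [pq rE]; rewrite /init rE. Qed.

Lemma pconcat_None (p q : qpath G) : term p <> init q -> pconcat p q = None.
Proof. by move/eqP/negbTE; rewrite /pconcat => ->. Qed.

Lemma pconcat_ex (p q : qpath G) :
  term p = init q -> exists r, pconcat p q = Some r.
Proof.
move=> pq; have H : path (@arrow G) (init p) ((val p).2 ++ (val q).2).
  rewrite cat_path (valP p) /=.
  by case: q pq => -[y s] /= ys; rewrite /init /term /= => ->.
exists (Sub (init p, (val p).2 ++ (val q).2) H).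
by apply/pconcat_val; rewrite SubK.
Qed.

Lemma pconcatA (p q r : qpath G) :
  obind (fun s => pconcat s r) (pconcat p q) =
  obind (fun s => pconcat p s) (pconcat q r).
Proof.
have [pq|npq] := eqVneq (term p) (init q); last first.
  rewrite pconcat_None /=; last exact/eqP.
  case qrE: (pconcat q r) => [s|//] /=.
  by rewrite pconcat_None // (init_cat qrE); apply/eqP.
have [s sE] := pconcat_ex pq; rewrite sE /=.
have [qr|nqr] := eqVneq (term q) (init r); last first.
  rewrite pconcat_None; first by rewrite pconcat_None //; apply/eqP.
  by rewrite (term_cat sE); apply/eqP.
have [t tE] := pconcat_ex qr; rewrite tE /=.
have [u uE] : exists u, pconcat s r = Some u.
  by apply: pconcat_ex; rewrite (term_cat sE).
have [v vE] : exists v, pconcat p t = Some v.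
  by apply: pconcat_ex; rewrite (init_cat tE).
rewrite uE vE; congr Some; apply: val_inj.
have [_ ->] := (pconcat_val _ _ _).1 uE.
have [_ ->] := (pconcat_val _ _ _).1 vE.
have [_ sE'] := (pconcat_val _ _ _).1 sE.
have [_ tE'] := (pconcat_val _ _ _).1 tE.
by rewrite (init_cat sE) sE' tE' /= catA.
Qed.

Lemma path_mulA : associative path_mul.
Proof.
move=> f g k; apply/esym; rewrite (path_mulE f (path_mul g k)) (path_mulE g k).
rewrite (path_mulE (path_mul f g)) (path_mulE f g) [LHS]lin_ext_comp.
apply: eq_lin_ext => p; rewrite [LHS]lin_ext_comp [RHS]lin_ext_comp; apply: eq_lin_ext => q.
rewrite [RHS]lin_ext_comp; have pqr := pconcatA p q.
case pqE: (pconcat p q) pqr => [s|] /= pqr.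
  have -> : pprod p q = << s >> by rewrite /pprod pqE.
  rewrite [LHS]lin_extU; apply: eq_lin_ext => r.
  rewrite /pprod; case: (pconcat q r) (pqr r) => [t|] /= ->.
    by rewrite [RHS]lin_extU.
  by rewrite linear0.
have -> : pprod p q = 0 by rewrite /pprod pqE.
rewrite [LHS]linear0; apply: etrans (esym (lin_ext0 k)) _; apply: eq_lin_ext => r.
rewrite /pprod; case: (pconcat q r) (pqr r) => [t|] /= ptE.
  by rewrite [RHS]lin_extU -ptE.
by rewrite linear0.
Qed.

Definition trivial_path (x : G) : qpath G := Sub (x, [::]) isT.

Lemma path_elt_nil x : path_elt x [::] = << trivial_path x >>.
Proof. by rewrite /path_elt insubT. Qed.

Lemma pconcat1p x p :
  pconcat (trivial_path x) p = if x == init p then Some p else None.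
Proof.
have [->|/eqP xp] := eqVneq x (init p); last exact: pconcat_None.
by apply/pconcat_val; split=> //=; case: p => -[].
Qed.

Lemma pconcatp1 x p :
  pconcat p (trivial_path x) = if x == term p then Some p else None.
Proof.
have [->|/eqP xp] := eqVneq x (term p); last exact/pconcat_None/nesym.
by apply/pconcat_val; split=> //=; rewrite cats0; case: p => -[].
Qed.

Lemma path_mul1f : left_id path_one path_mul.
Proof.
move=> f; rewrite path_mulE /path_one linear_sum /=.
under eq_bigr do rewrite path_elt_nil lin_extU.
rewrite -lin_ext_sum -[RHS]lin_ext_id; apply: eq_lin_ext => p.
rewrite (bigD1 (init p)) //= /pprod pconcat1p eqxx big1 ?addr0 // => x xp.
by rewrite pconcat1p (negbTE xp).
Qed.

Lemma path_mulf1 : right_id path_one path_mul.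
Proof.
move=> f; rewrite path_mulE -[RHS]lin_ext_id; apply: eq_lin_ext => p.
rewrite /path_one linear_sum /=.
under eq_bigr do rewrite path_elt_nil lin_extU.
rewrite (bigD1 (term p)) //= /pprod pconcatp1 eqxx big1 ?addr0 // => x xp.
by rewrite pconcatp1 (negbTE xp).
Qed.

Lemma path_mulDl : left_distributive path_mul +%R.
Proof. by move=> f g k; rewrite !path_mulE linearD. Qed.

Lemma path_mulDr : right_distributive path_mul +%R.
Proof.
move=> f g k; rewrite !path_mulE -lin_extD; apply: eq_lin_ext => p.
by rewrite linearD.
Qed.

(* Possibly zero, as [G] may have no vertices. *)
HB.instance Definition _ := GRing.Zmodule_isPzRing.Build path_alg
  path_mulA path_mul1f path_mulf1 path_mulDl path_mulDr.

Lemma path_alg_scalerAl (a : K) (f g : path_alg) : a *: (f * g) = (a *: f) * g.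
Proof. by rewrite /GRing.mul /= !path_mulE linearZ. Qed.

Lemma path_alg_scalerAr (a : K) (f g : path_alg) : a *: (f * g) = f * (a *: g).
Proof.
rewrite /GRing.mul /= !path_mulE.
rewrite [X in _ *: X]lin_extE [RHS]lin_extE scaler_sumr.
apply: eq_bigr => p _; rewrite [X in _ = _ *: X]linearZ !scalerA.
by rewrite mulrC.
Qed.

(* Since K is central, the two-sided ring ideals of KG are its algebra
   ideals. *)
Definition t_elt (x y : G) : path_alg :=
  \sum_(v | path (@arrow G) x [:: v; y]) path_elt x [:: v; y].

Definition T_gen (a : path_alg) : Prop :=
  exists x y, dist x y = Some 2 /\ a = t_elt x y.

Definition Omega : pzRingType := quot_ring T_gen.

Definition Omega_pi : {rmorphism path_alg -> Omega} := @quot_pi _ T_gen.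

Definition Omega_e (x : G) : Omega := Omega_pi (path_elt x [::]).
Definition Omega_arrow (x y : G) : Omega := Omega_pi (path_elt x [:: y]).

End PathAlgebra.

Section AugmentationModule.
Variables (K : fieldType) (G : digraph).
Local Notation KG := (path_alg K G).

(* The degree-zero component of an element of KG, in S = (KG)_0. *)
Definition deg0 (a : KG) : {ffun G -> K} := [ffun x => a@_(trivial_path x)].

Lemma mcoeff_lin_ext (h : qpath G -> KG) (f : KG) t (c : K) :
  (forall p, (h p)@_t = (p == t)%:R * c) -> (lin_ext h f)@_t = f@_t * c.
Proof.
move=> hE; rewrite lin_extE raddf_sum /=.
under eq_bigr do rewrite mcoeffZ hE.
have [tf|tf] := boolP (t \in msupp f).
  rewrite (big_fsetD1 t) //= eqxx mul1r big1_fset ?addr0 // => p.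
  by rewrite !inE => /andP[/negbTE-> _] _; rewrite mul0r mulr0.
rewrite (mcoeff_outdom tf) mul0r big1_fset // => p pf _.
have [pt|_] := eqVneq p t; last by rewrite mul0r mulr0.
by rewrite -pt pf in tf.
Qed.

Lemma mcoeff_pprod (p q : qpath G) x :
  (pprod K p q)@_(trivial_path x) =
  (q == trivial_path x)%:R * (p == trivial_path x)%:R.
Proof.
rewrite /pprod; case pqE: (pconcat p q) => [r|]; last first.
  rewrite mcoeff0; have [qx|_] := eqVneq q; last by rewrite mul0r.
  have [px|_] := eqVneq p; last by rewrite mulr0.
  by move: pqE; rewrite px qx pconcat1p eqxx.
rewrite mcoeffU -natrM mulnb; congr (_ *+ nat_of_bool _).
move/pconcat_val: pqE => [pq rE].
move: pq; rewrite -!val_eqE rE /term /init /=.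
case: (sval p) (sval q) => y s [z u] /=; rewrite !xpair_eqE.
case: s u => [|s0 s] [|u0 u] /=; rewrite ?andbF //= ?eqxx ?andbT //.
by move=> ->; rewrite andbb.
Qed.

Lemma deg0_additive : zmod_morphism deg0.
Proof. by move=> a b; apply/ffunP => x; rewrite !ffunE mcoeffB. Qed.
HB.instance Definition _ :=
  GRing.isZmodMorphism.Build KG {ffun G -> K} deg0 deg0_additive.

Lemma deg0M (a b : KG) x : deg0 (a * b) x = deg0 a x * deg0 b x.
Proof.
rewrite !ffunE {1}/GRing.mul /= path_mulE.
apply: mcoeff_lin_ext => p; rewrite [RHS]mulrC.
by apply: mcoeff_lin_ext => q; apply: mcoeff_pprod.
Qed.

Lemma mcoeff_path_elt x s (p : qpath G) :
  (path_elt K x s)@_p = ((x, s) == val p)%:R.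
Proof.
rewrite /path_elt; case: insubP => [q _ qE|xs].
  by rewrite mcoeffU -qE (inj_eq val_inj).
rewrite mcoeff0; case: eqP => // xsE.
by case/negP: xs; rewrite xsE; apply: (valP p).
Qed.

Lemma deg0_T (a : KG) : a \in ideal_gen (@T_gen K G) -> deg0 a = 0.
Proof.
move/ideal_genP/(_ (fun b => deg0 b = 0)); apply.
  split=> [|b c b0 c0|b c c0|b c b0]; first exact: raddf0.
  - by rewrite raddfB /= b0 c0 subrr.
  - by apply/ffunP => x; rewrite deg0M c0 !ffunE mulr0.
  - by apply/ffunP => x; rewrite deg0M b0 !ffunE mul0r.
move=> _ [x [y [_ ->]]]; rewrite /t_elt raddf_sum big1 // => v _.
by apply/ffunP => z; rewrite !ffunE mcoeff_path_elt xpair_eqE andbF.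
Qed.

Definition Omega_deg0 (w : Omega K G) : {ffun G -> K} := deg0 (repr w).

Lemma Omega_deg0_pi (a : KG) : Omega_deg0 (Omega_pi K G a) = deg0 a.
Proof.
apply/eqP; rewrite -subr_eq0 -raddfB; apply/eqP/deg0_T/quot_pi_eq.
exact: quot_piK.
Qed.

Lemma Omega_piK (w : Omega K G) : Omega_pi K G (repr w) = w.
Proof. exact: quot_piK. Qed.

(* S = (+)_x K e_x as a left Omega-module, elements of positive degree acting
   by zero: w acts as multiplication by its degree-zero component in S. *)
Definition S_mod : Type := {ffun G -> K}.
HB.instance Definition _ := GRing.Zmodule.on S_mod.

Definition S_act (w : Omega K G) (s : S_mod) : S_mod :=
  [ffun x => Omega_deg0 w x * s x].

Lemma S_act_pi a s x : S_act (Omega_pi K G a) s x = a@_(trivial_path x) * s x.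
Proof. by rewrite ffunE Omega_deg0_pi ffunE. Qed.

Lemma S_actA v w s : S_act v (S_act w s) = S_act (v * w) s.
Proof.
apply/ffunP => x; rewrite -[v]Omega_piK -[w]Omega_piK -rmorphM !S_act_pi mulrA.
by congr (_ * _); have := deg0M (repr v) (repr w) x; rewrite !ffunE => ->.
Qed.
Lemma S_act1 : left_id 1 S_act.
Proof.
move=> s; apply/ffunP => x; rewrite -(rmorph1 (Omega_pi K G)) S_act_pi.
have -> : (1 : KG) = \sum_(y : G) path_elt K y [::] by [].
rewrite raddf_sum (bigD1 x) //= mcoeff_path_elt eqxx big1 => [|y yx].
  by rewrite addr0 mul1r.
by rewrite mcoeff_path_elt xpair_eqE (negbTE yx).
Qed.
Lemma S_actDr : right_distributive S_act +%R.
Proof. by move=> w s t; apply/ffunP => x; rewrite !ffunE mulrDr. Qed.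
Lemma S_actDl s : {morph S_act^~ s : v w / v + w}.
Proof.
move=> v w; apply/ffunP => x; rewrite -[v]Omega_piK -[w]Omega_piK.
by rewrite -raddfD [RHS]ffunE !S_act_pi mcoeffD mulrDl.
Qed.
HB.instance Definition _ := GRing.Zmodule_isLmodule.Build (Omega K G) S_mod
  S_actA S_act1 S_actDr S_actDl.

Definition S_e (x : G) : S_mod := [ffun y => (y == x)%:R].

End AugmentationModule.

Section Koszul.
Variables (K : fieldType) (G : digraph).
Local Notation Om := (Omega K G).

Definition dist_pair (n : nat) := {xy : G * G | dist xy.1 xy.2 == Some n}.
HB.instance Definition _ n := SubFinite.on (dist_pair n).

Definition Kfree (n : nat) : lmodType Om := {ffun dist_pair n -> Om^o}.

Definition in_summands n : {pred Kfree n} :=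
  fun c => `[< forall i, exists w : Om, c i = w * Omega_e K (val i).1 >].

Lemma in_summandsP n (c : Kfree n) : reflect
  (forall i, exists w : Om, c i = w * Omega_e K (val i).1)
  (c \in @in_summands n).
Proof. exact: (iffP (asboolP _)). Qed.

Lemma in_summands_submod n : submod_closed (@in_summands n).
Proof.
split=> [|a c c' /in_summandsP cS /in_summandsP c'S]; apply/in_summandsP => i.
  by exists 0; rewrite ffunE mul0r.
have [w wE] := cS i; have [w' w'E] := c'S i.
by exists (a * w + w'); rewrite !ffunE wE w'E mulrDl -mulrA.
Qed.
HB.instance Definition _ n := GRing.isSubmodClosed.Build Om (Kfree n)
  (@in_summands n) (@in_summands_submod n).

(* The left module (+)_(d(x,y) = n) Omega e_x; [K_val c (x, y)] is the component
   of c in the summand indexed by (x, y). *)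
Record Kmod n := KMod { K_val : Kfree n; _ : K_val \in @in_summands n }.
HB.instance Definition _ n := [isSub for @K_val n].
HB.instance Definition _ n := [Choice of Kmod n by <:].
HB.instance Definition _ n := [SubChoice_isSubLmodule of Kmod n by <:].

(* e_x in the summand indexed by (x, y); it is 0 when d(x, y) <> n. *)
Definition kappa_val n (x y : G) : Kfree n :=
  [ffun i => if val i == (x, y) then Omega_e K x else 0].

Lemma kappa_subproof n x y : kappa_val n x y \in @in_summands n.
Proof.
apply/in_summandsP => i; rewrite ffunE; case: eqP => [->|_].
  by exists 1; rewrite mul1r.
by exists 0; rewrite mul0r.
Qed.

Definition kappa n (x y : G) : Kmod n := KMod (kappa_subproof n x y).

Definition diff_kappa n (x y : G) : Kmod n :=
  \sum_(v | (dist x v == Some 1) && (dist v y == Some n))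
    Omega_arrow K x v *: kappa n v y.

Definition Kdiff n (c : Kmod n.+1) : Kmod n :=
  \sum_i K_val c i *: diff_kappa n (val i).1 (val i).2.

Definition Kaug (c : Kmod 0) : S_mod K G :=
  \sum_i (K_val c i : Om) *: S_e K (val i).1.

Lemma K_val_linear n : linear (@K_val n).
Proof. by []. Qed.
HB.instance Definition _ n :=
  GRing.isLinear.Build Om (Kmod n) (Kfree n) _ (@K_val n) (@K_val_linear n).

Lemma Kdiff_linear n : linear (@Kdiff n).
Proof.
move=> a c c'; rewrite /Kdiff scaler_sumr -big_split; apply: eq_bigr => i _.
by rewrite linearP !ffunE scalerDl scalerA.
Qed.
HB.instance Definition _ n :=
  GRing.isLinear.Build Om (Kmod n.+1) (Kmod n) _ (@Kdiff n) (@Kdiff_linear n).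

Lemma Kaug_linear : linear Kaug.
Proof.
move=> a c c'; rewrite /Kaug scaler_sumr -big_split; apply: eq_bigr => i _.
by rewrite linearP !ffunE scalerDl scalerA.
Qed.
HB.instance Definition _ :=
  GRing.isLinear.Build Om (Kmod 0) (S_mod K G) _ Kaug Kaug_linear.

Lemma Omega_eM (x v : G) : Omega_e K x * Omega_arrow K x v = Omega_arrow K x v.
Proof.
rewrite -rmorphM; congr (Omega_pi K G _).
rewrite {1}/GRing.mul /= path_mulE path_elt_nil lin_extU /path_elt.
case: insubP => [p _ pE|_]; last by rewrite linear0.
by rewrite lin_extU /pprod pconcat1p /init pE eqxx.
Qed.

Lemma Kdiff_kappa n (x y : G) : dist x y = Some n.+1 ->
  Kdiff (kappa n.+1 x y) = diff_kappa n x y.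
Proof.
move/eqP=> xy; pose i0 : dist_pair n.+1 := Sub (x, y) xy.
rewrite /Kdiff (bigD1 i0) //= ffunE eqxx big1 ?addr0 => [|i ii0].
  rewrite scaler_sumr; apply: eq_bigr => v _.
  by rewrite scalerA Omega_eM.
rewrite ffunE -[(x, y)]/(val i0) (inj_eq val_inj) (negbTE ii0).
by rewrite scale0r.
Qed.

Lemma dist_xx (x : G) : dist x x = Some 0%N.
Proof.
have xx : has_walk x x 0 by apply/existsP; exists [tuple]; rewrite /= eqxx.
rewrite /dist; case: pselect => [ex|[]]; last by exists 0%N.
by case: ex_minnP => m _ /(_ _ xx); rewrite leqn0 => /eqP->.
Qed.

Lemma Kaug_kappa (x : G) : Kaug (kappa 0 x x) = S_e K x.
Proof.
have /eqP xx := dist_xx x; pose i0 : dist_pair 0 := Sub (x, x) xx.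
rewrite /Kaug (bigD1 i0) //= ffunE eqxx big1 ?addr0 => [|i ii0].
  apply/ffunP => z; rewrite S_act_pi mcoeff_path_elt !ffunE.
  by rewrite /= xpair_eqE andbT eq_sym -natrM mulnb andbb.
rewrite ffunE -[(x, x)]/(val i0) (inj_eq val_inj) (negbTE ii0).
by rewrite scale0r.
Qed.

(* Exactness of ... -> Kmod 1 -> Kmod 0 -> S -> 0. *)
Definition is_resolution : Prop :=
  [/\ forall s : S_mod K G, exists c, Kaug c = s,
      exact_at (@Kdiff 0) Kaug
    & forall n, exact_at (@Kdiff n.+1) (@Kdiff n)].

End Koszul.

(* Main.v *)
Require Import Defs.
From HB Require Import structures.
From mathcomp Require Import all_boot all_order all_algebra.
From mathcomp Require Import finmap monalg boolp zify.

Set Implicit Arguments.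
Unset Strict Implicit.
Unset Printing Implicit Defensive.

Import GRing.Theory Num.Theory.

(** Tuples (x_0, ..., x_n) of vertices are stored last vertex first. On the
    vector space E of formal sums of tuples, over a field K, consider the
    transpose [codiff] of the magnitude differential, which inserts a vertex
    strictly between two consecutive ones without changing the norm. Sending a
    path to its class and all other tuples to 0 maps E onto Omega; inserting
    into the one gap of length 2 of a tuple that is otherwise a path gives a
    multiple of some t_{x,y}, and this accounts for the whole ideal T
    ([path_part_codiff_T], [path_part_kernel]). So Omega is the diagonal part of
    magnitude cohomology.

    Fix a target y. The summands of K^G with target y form the part of Omega
    that reaches y, and the differential is right multiplication by the sum a_y
    of the arrows that lead one step closer to y ([Kdiff_of]). It lifts to E as
    [cone_diff y], which also inserts between the last vertex and y, with y
    allowed. The lifted complex is contractible ([contraction]), since one may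
    append and delete y. The kernel of its projection onto the Koszul complex is
    filtered by the distance from the last vertex to y; the graded pieces are
    magnitude cochains, cut down to coboundaries on the diagonal. If these are
    exact, so is the kernel, hence the Koszul complex. Conversely, if the Koszul
    complex is exact, so is the kernel, and exactness of the cochains of norm m
    follows from that of the cochains of smaller norm. This is [target_exactP]
    and [resolutionP].

    Over the integers, exactness of the magnitude chains below the diagonal
    gives a contracting homotopy, which can be transposed and mapped to any
    field ([homotopy_row_exact]). In the other direction, exactness over the
    rationals and over all prime fields gives exactness over the integers
    ([row_exact_col_exact]).

    Property V2 comes from the vanishing of MH_{2,l} for l > 2, by induction on
    the length l of paths. For a path that is not quasi-reducible, the indicator
    of its congruence class defines a functional on MC_{2,l} ([Phi]) that
    vanishes on boundaries ([Phi_sum_boundary]). Evaluating it on the cycles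
    (x, v, y) - (x, v', y) shows that geodesics are congruent, and evaluating it
    on a cycle (x, v, y) with d(x, y) < l shows that long paths are
    quasi-reducible. *)

(** * Distances and geodesic intervals *)
Section Distance.
Variable G : digraph.
Implicit Types x y z v u : G.

Definition reach x y : bool := isSome (dist x y).
(** Unreachable pairs get the default value 0; [reach] tells them apart. *)
Definition ndist x y : nat := odflt 0 (dist x y).

Lemma distE x y n : dist x y = Some n <-> reach x y /\ ndist x y = n.
Proof. by rewrite /reach /ndist; case: (dist x y) => [m|] /=; split=> [[]|[]]// _ ->. Qed.

Lemma has_walkP x y n : reflect
  (exists s, [/\ size s = n, path (@arrow G) x s & last x s = y])
  (has_walk x y n).
Proof.
apply: (iffP existsP) => [[t /andP[pt /eqP lt]]|[s [sn ps ls]]].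
  by exists t; rewrite size_tuple.
have sE : size s == n by rewrite sn.
by exists (Tuple sE); rewrite /= ps ls eqxx.
Qed.

Lemma path_ndist x s : path (@arrow G) x s ->
  reach x (last x s) /\ ndist x (last x s) <= size s.
Proof.
move=> ps; have w : has_walk x (last x s) (size s).
  by apply/has_walkP; exists s.
rewrite /reach /ndist /dist; case: pselect => [ex|[]]; last by exists (size s).
by case: ex_minnP => m _ /(_ _ w).
Qed.

Lemma geodesic x y : reach x y ->
  exists s, [/\ path (@arrow G) x s, last x s = y & size s = ndist x y].
Proof.
rewrite /reach /ndist /dist; case: pselect => // ex _ /=.
by case: ex_minnP => m /has_walkP[s [sm ps ls]] _; exists s.
Qed.

Lemma ndist_xx x : ndist x x = 0.
Proof. by rewrite /ndist dist_xx. Qed.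

Lemma reach_xx x : reach x x.
Proof. by rewrite /reach dist_xx. Qed.

Lemma reach_trans x y z : reach x y -> reach y z -> reach x z.
Proof.
move=> /geodesic[s [ps <- _]] /geodesic[t [pt <- _]].
have pst : path (@arrow G) x (s ++ t) by rewrite cat_path ps.
by have [] := path_ndist pst; rewrite last_cat.
Qed.

Lemma ndist_triangle x y z : reach x y -> reach y z -> ndist x z <= ndist x y + ndist y z.
Proof.
move=> /geodesic[s [ps ls sn]] /geodesic[t [pt lt tn]].
have pst : path (@arrow G) x (s ++ t) by rewrite cat_path ps ls.
by have [_] := path_ndist pst; rewrite last_cat ls lt size_cat sn tn.
Qed.

Lemma ndist_eq0 x y : reach x y -> (ndist x y == 0) = (x == y).
Proof.
move=> xy; apply/eqP/eqP=> [d0|->]; last exact: ndist_xx.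
by have [s [_ ls]] := geodesic xy; rewrite d0 => /size0nil s0; rewrite s0 in ls.
Qed.

Lemma ndist_gt0 x y : reach x y -> (0 < ndist x y) = (x != y).
Proof. by move=> xy; rewrite lt0n ndist_eq0. Qed.

Lemma arrowE x y : arrow x y = reach x y && (ndist x y == 1).
Proof.
apply/idP/andP=> [xy|[rxy /eqP d1]].
  have pxy : path (@arrow G) x [:: y] by rewrite /= xy.
  have [r le1] := path_ndist pxy; split=> //; rewrite eqn_leq le1 ndist_gt0 //.
  by apply/eqP => xyE; rewrite xyE /= arrow_irr in xy.
have [s [ps ls]] := geodesic rxy; rewrite d1.
by case: s ps ls => [|v []] //=; rewrite andbT => + <-.
Qed.

(** The geodesic intervals (z, x] and (z, x). The end x comes first because a
    partial application to it is the rule by which vertices are inserted. *)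
Definition between x z v := [&& v != z, reach z v, reach v x & ndist z v + ndist v x == ndist z x].
Definition sbetween x z v := (v != x) && between x z v.

Lemma between_reach x z v : between x z v -> reach z x.
Proof. by case/and4P=> _ zv vx _; apply: reach_trans zv vx. Qed.

(** Both sides say that z, v, u, y lie in this order on a geodesic. This is why
    the squares of the differentials below vanish. *)
Lemma between_assoc y z v u :
  between y z v && between y v u = between y z u && sbetween u z v.
Proof.
apply/idP/idP.
  case/andP=> /and4P[vz rzv rvy /eqP e1] /and4P[uv rvu ruy /eqP e2].
  have rzu := reach_trans rzv rvu.
  have t1 := ndist_triangle rzv rvu; have t2 := ndist_triangle rzu ruy.
  have := ndist_gt0 rzv; rewrite eq_sym vz => p1.
  have : u != z by rewrite eq_sym -(ndist_gt0 rzu); lia.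
  by rewrite /sbetween /between rzu ruy rzv rvu vz (eq_sym v u) uv => -> /=; lia.
case/andP=> /and4P[uz rzu ruy /eqP e1] /andP[vu /and4P[vz rzv rvu /eqP e2]].
have rvy := reach_trans rvu ruy.
have t1 := ndist_triangle rzv rvy; have t2 := ndist_triangle rvu ruy.
by rewrite /between vz rzv rvy rvu ruy (eq_sym u v) vu /=; lia.
Qed.

Lemma sbetween_assoc y z v u :
  sbetween y z v && sbetween y v u = sbetween y z u && sbetween u z v.
Proof.
rewrite {1 2 3}/sbetween andbACA between_assoc -andbA andbA [(v != y) && _]andbC -andbA.
have [->|uy] /= := eqVneq u y; first by [].
have [vy|//] := eqVneq v y; rewrite vy /=; apply/esym/negbTE/negP.
case/andP=> /and4P[_ rzu ruy /eqP e1] /andP[_ /and4P[_ rzy ryu /eqP e2]].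
by have := ndist_gt0 ruy; rewrite uy; lia.
Qed.

Lemma arrow_sbetween z x v : arrow z x -> sbetween x z v = false.
Proof.
rewrite arrowE => /andP[_ /eqP d1]; apply/negP.
rewrite /sbetween /between d1 => /and5P[vx vz rzv rvx /eqP e].
by have := ndist_gt0 rzv; have := ndist_gt0 rvx; rewrite vx eq_sym vz; lia.
Qed.

(** Filling a gap of length 2 gives the summands of t_{z,x}. *)
Lemma sbetween_dist2 z x v : dist z x = Some 2 ->
  sbetween x z v = arrow z v && arrow v x.
Proof.
case/distE=> rzx d2; rewrite !arrowE /sbetween /between d2.
case rzv: (reach z v); case rvx: (reach v x); rewrite ?andbF //=.
rewrite (eq_sym v z) -(ndist_gt0 rzv) -(ndist_gt0 rvx); lia.
Qed.

Lemma sbetween_arrows z x v : sbetween x z v -> arrow z v -> arrow v x -> dist z x = Some 2.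
Proof.
move=> /andP[_ h]; rewrite !arrowE => /andP[_ /eqP e1] /andP[_ /eqP e2].
apply/distE; split; first exact: between_reach h.
by case/and4P: h => _ _ _; rewrite e1 e2 => /eqP.
Qed.

End Distance.

Local Open Scope quotient_scope.
Local Open Scope ring_scope.

(** * Linear extension from a basis *)
HB.lock Definition linear_ext (K : fieldType) (T : choiceType) (V : lmodType K)
  (h : T -> V) (f : {malg K[T]}) : V := \sum_(p <- msupp f) f@_p *: h p.
Canonical linear_ext_unlockable := Unlockable linear_ext.unlock.

Section LinearExtension.
Variables (K : fieldType) (T : choiceType).
Local Notation E := {malg K[T]}.

Definition supported (P : T -> Prop) (f : E) := forall p, f@_p != 0 -> P p.

Lemma supported0 P : supported P 0.
Proof. by move=> p; rewrite mcoeff0 eqxx. Qed.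

Lemma supportedU P p : P p -> supported P << p >>.
Proof. by move=> Pp q; rewrite mcoeffU; case: (p =P q) => [<-|_] /=; rewrite ?eqxx. Qed.

Lemma supportedD P f g : supported P f -> supported P g -> supported P (f + g).
Proof.
move=> fP gP p; rewrite mcoeffD; have [f0|/fP//] := eqVneq f@_p 0.
by rewrite f0 add0r => /gP.
Qed.

Lemma supportedN P f : supported P f -> supported P (- f).
Proof. by move=> fP p; rewrite mcoeffN oppr_eq0 => /fP. Qed.

Lemma supportedB P f g : supported P f -> supported P g -> supported P (f - g).
Proof. by move=> fP /supportedN; apply: supportedD. Qed.

Lemma supportedZ P c f : supported P f -> supported P (c *: f).
Proof.
by move=> fP p; rewrite mcoeffZ mulf_eq0 negb_or => /andP[_ /fP].
Qed.

Lemma supported_sum P (I : Type) (r : seq I) (Q : pred I) (F : I -> E) :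
  (forall i, Q i -> supported P (F i)) -> supported P (\sum_(i <- r | Q i) F i).
Proof.
move=> FP; apply: (big_ind (supported P)) => //; first exact: supported0.
exact: supportedD.
Qed.

Lemma supportedW (P Q : T -> Prop) f :
  (forall p, P p -> Q p) -> supported P f -> supported Q f.
Proof. by move=> PQ fP p /fP/PQ. Qed.

Lemma supported_eq0 (P : T -> Prop) f :
  supported P f -> (forall p, ~ P p) -> f = 0.
Proof.
move=> fP nP; apply/malgP => p; rewrite mcoeff0; apply/eqP.
by apply/negPn/negP => /fP/nP.
Qed.

Section Ext.
Variable V : lmodType K.
Implicit Types (f g : E) (h : T -> V).

Lemma linear_extE h f : linear_ext h f = \sum_(p <- msupp f) f@_p *: h p.
Proof. by rewrite unlock. Qed.

Lemma linear_extw h f (d : {fset T}) : (msupp f `<=` d)%fset ->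
  linear_ext h f = \sum_(p <- d) f@_p *: h p.
Proof.
move=> fd; rewrite linear_extE; apply: big_fset_incl => // p _ /mcoeff_outdom ->.
by rewrite scale0r.
Qed.

Lemma linear_ext_linear h : linear (linear_ext h).
Proof.
move=> a f g; pose d := (msupp f `|` msupp g `|` msupp (a *: f + g))%fset.
have fd : (msupp f `<=` d)%fset by rewrite /d -fsetUA fsubsetUl.
have gd : (msupp g `<=` d)%fset by rewrite /d fsetUAC fsubsetUr.
have hd : (msupp (a *: f + g) `<=` d)%fset by rewrite /d fsubsetUr.
rewrite (linear_extw _ fd) (linear_extw _ gd) (linear_extw _ hd).
rewrite scaler_sumr -big_split; apply: eq_bigr => p _ /=.
by rewrite mcoeffD mcoeffZ scalerDl scalerA.
Qed.
HB.instance Definition _ h :=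
  GRing.isLinear.Build K E V _ (linear_ext h) (linear_ext_linear h).

Lemma linear_extU h p : linear_ext h << p >> = h p.
Proof.
by rewrite (@linear_extw h _ [fset p]%fset) ?msuppU_le // big_seq_fset1 mcoeffUU
           scale1r.
Qed.

End Ext.

Lemma malg_basis (f : E) : f = \sum_(p <- msupp f) f@_p *: << p >>.
Proof.
rewrite {1}[f]monalgE; apply: eq_bigr => p _; apply/malgP => q.
by rewrite mcoeffU mcoeffZ mcoeffU mulrnAr mulr1.
Qed.

Lemma malg_ind_on (Q : T -> Prop) (P : E -> Prop) : P 0 ->
  (forall c p f, Q p -> P f -> P (c *: << p >> + f)) ->
  forall f, supported Q f -> P f.
Proof.
move=> P0 PD f fQ; rewrite [f]malg_basis big_seq.
apply: (big_rec P) => // p g; rewrite -mcoeff_neq0 => /fQ; exact: PD.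
Qed.

Lemma malg_ind (P : E -> Prop) : P 0 ->
  (forall c p f, P f -> P (c *: << p >> + f)) -> forall f, P f.
Proof.
move=> P0 PD f; apply: (@malg_ind_on (fun=> True)) => // c p g _; exact: PD.
Qed.

End LinearExtension.

Lemma supported_linear_ext (K : fieldType) (T T' : choiceType) (P : T -> Prop)
    (Q : T' -> Prop) (h : T -> {malg K[T']}) (f : {malg K[T]}) :
  supported P f -> (forall p, P p -> supported Q (h p)) ->
  supported Q (linear_ext h f).
Proof.
move=> fP hQ; elim/malg_ind_on: {f} fP => [|c p f Pp IH].
  rewrite linear0; exact: supported0.
rewrite linearP /= linear_extU; apply: supportedD IH; apply: supportedZ; exact: hQ.
Qed.

(** * The magnitude codifferential on tuples *)
Section Insertion.
Variables (K : fieldType) (G : digraph).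
Local Notation E := {malg K[seq G]}.
Implicit Types (f g : E) (r s : seq G) (x y z u v : G).

(** The head of a list is the last vertex of the tuple. Extending a path by an
    arrow and inserting next to the target then both act at the head. *)
Definition prepend x : E -> E := linear_ext (fun r => << x :: r >>).

Definition ins (P : G -> G -> bool) r : E :=
  if r is z :: _ then \sum_(v | P z v) << v :: r >> else 0.

(** Insertion at the position just below the head, minus the codifferential of
    the tail: signs alternate from the last gap on. *)
Fixpoint codiff_seq r : E :=
  if r is x :: r' then prepend x (ins (sbetween x) r' - codiff_seq r') else 0.

Definition Ins P : E -> E := linear_ext (ins P).
Definition codiff : E -> E := linear_ext codiff_seq.
(** The codifferential of the tuple extended by y, with y left out afterwards
    and with y itself allowed as last insertion. *)
Definition cone_diff y f : E := Ins (between y) f - codiff f.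

HB.instance Definition _ x := GRing.Linear.on (prepend x).
HB.instance Definition _ P := GRing.Linear.on (Ins P).
HB.instance Definition _ := GRing.Linear.on codiff.

Lemma cone_diff_linear y : linear (cone_diff y).
Proof. by move=> a f g; rewrite /cone_diff !linearP /= scalerDr addrACA. Qed.
HB.instance Definition _ y := GRing.isLinear.Build K E E _ (cone_diff y) (cone_diff_linear y).

Definition headb (P : pred G) r := if r is z :: _ then P z else false.

(** One insertion. Gradings of E are treated as properties of tuples that do
    not change, or change in a known way, under it. *)
Fixpoint ins1 r s : Prop :=
  match r, s with
  | x :: r', x' :: s' => x = x' /\
     (ins1 r' s' \/ exists v, s' = v :: r' /\ headb (fun z => sbetween x z v) r')
  | _, _ => False
  end.

Lemma supp_ins (P : G -> G -> bool) r : supported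
  (fun s => exists v, s = v :: r /\ headb (fun z => P z v) r) (ins P r).
Proof.
case: r => [|z r] /=; first exact: supported0.
by apply: supported_sum => v Pzv; apply: supportedU; exists v.
Qed.

Lemma supp_codiff_seq r : supported (ins1 r) (codiff_seq r).
Proof.
elim: r => [|x r IH] /=; first exact: supported0.
apply: (@supported_linear_ext _ _ _
  (fun s => ins1 r s \/ exists v, s = v :: r /\ headb (fun z => sbetween x z v) r)).
  apply: supportedB.
    by apply: supportedW (@supp_ins _ _) => s H; right.
  by apply: supportedW IH => s H; left.
by move=> s H; apply: supportedU.
Qed.

Lemma supp_codiff (P Q : seq G -> Prop) f :
  (forall r s, ins1 r s -> P r -> Q s) -> supported P f -> supported Q (codiff f).
Proof.
move=> PQ fP; apply: (supported_linear_ext fP) => r Pr.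
by apply: supportedW (@supp_codiff_seq r) => s rs; apply: PQ rs Pr.
Qed.

Lemma supp_Ins (T : G -> G -> bool) (P Q : seq G -> Prop) f :
  (forall z r v, T z v -> P (z :: r) -> Q [:: v, z & r]) -> supported P f ->
  supported Q (Ins T f).
Proof.
move=> PQ fP; apply: (supported_linear_ext fP) => -[|z r] Pr; first exact: supported0.
by apply: supported_sum => v zv; apply: supportedU; exact: PQ.
Qed.

Lemma ins1_headb (P : pred G) r s : ins1 r s -> headb P s = headb P r.
Proof. by case: r s => [|x r] [|x' s] //= [-> _]. Qed.

Lemma ins1_size r s : ins1 r s -> size s = (size r).+1.
Proof.
elim: r s => [|x r IH] [|x' s] //= [_ [/IH->//|[v [-> _]]]] //.
Qed.

Definition proj (Q : pred (seq G)) : E -> E :=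
  linear_ext (fun r => if Q r then << r >> else 0).
HB.instance Definition _ Q := GRing.Linear.on (proj Q).

Lemma projU (Q : pred (seq G)) r : proj Q << r >> = if Q r then << r >> else 0.
Proof. exact: linear_extU. Qed.
Lemma prependU x r : prepend x << r >> = << x :: r >>.
Proof. exact: linear_extU. Qed.
Lemma codiffU r : codiff << r >> = codiff_seq r.
Proof. exact: linear_extU. Qed.
Lemma InsU P r : Ins P << r >> = ins P r.
Proof. exact: linear_extU. Qed.

Lemma prependP x c f g : prepend x (c *: f + g) = c *: prepend x f + prepend x g.
Proof. exact: linearP. Qed.
Lemma InsP P c f g : Ins P (c *: f + g) = c *: Ins P f + Ins P g.
Proof. exact: linearP. Qed.
Lemma codiffP c f g : codiff (c *: f + g) = c *: codiff f + codiff g.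
Proof. exact: linearP. Qed.
Lemma projP Q c f g : proj Q (c *: f + g) = c *: proj Q f + proj Q g.
Proof. exact: linearP. Qed.

Lemma projB Q f g : proj Q (f - g) = proj Q f - proj Q g.
Proof. exact: linearB. Qed.
Lemma projZ Q c f : proj Q (c *: f) = c *: proj Q f.
Proof. exact: linearZ. Qed.

Lemma prependL x c r f : prepend x (c *: << r >> + f) = c *: << x :: r >> + prepend x f.
Proof. by rewrite linearP /= prependU. Qed.
Lemma InsL P c r f : Ins P (c *: << r >> + f) = c *: ins P r + Ins P f.
Proof. by rewrite linearP /= InsU. Qed.
Lemma codiffL c r f : codiff (c *: << r >> + f) = c *: codiff_seq r + codiff f.
Proof. by rewrite linearP /= codiffU. Qed.
Definition basisL := (prependL, InsL, codiffL).

Lemma proj_id (Q : pred (seq G)) f : supported Q f -> proj Q f = f.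
Proof.
move=> fQ; elim/malg_ind_on: {f} fQ => [|c p f Qp IH]; first exact: linear0.
by rewrite linearP /= IH projU Qp.
Qed.

Lemma proj0 (Q : pred (seq G)) f : supported (fun r => ~~ Q r) f -> proj Q f = 0.
Proof.
move=> fQ; elim/malg_ind_on: {f} fQ => [|c p f Qp IH]; first exact: linear0.
by rewrite linearP /= IH projU (negbTE Qp) scaler0 addr0.
Qed.

Lemma mcoeff_proj (Q : pred (seq G)) f r :
  (proj Q f)@_r = if Q r then f@_r else 0.
Proof.
elim/malg_ind: f => [|c p f IH]; first by rewrite linear0 !mcoeff0 if_same.
rewrite linearP /= projU !mcoeffD !mcoeffZ IH.
case Qp: (Q p); rewrite ?mcoeff0 mcoeffU; case: (p =P r) => [<-|_];
  rewrite ?Qp /= ?mulr0 ?add0r //; by case: ifP; rewrite ?addr0.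
Qed.

Lemma projC (Q : pred (seq G)) f : f = proj Q f + proj (predC Q) f.
Proof.
by apply/malgP => r; rewrite mcoeffD !mcoeff_proj /=; case: ifP; rewrite /= ?addr0 ?add0r.
Qed.

Lemma codiff_proj (Q Q' : pred (seq G)) f :
  (forall r s, ins1 r s -> Q' s = Q r) -> codiff (proj Q f) = proj Q' (codiff f).
Proof.
move=> QQ'; elim/malg_ind: f => [|c r f IH]; first by rewrite !linear0.
rewrite !linearP /= IH projU [codiff << r >>]codiffU.
suff -> : codiff (if Q r then << r >> else 0) = proj Q' (codiff_seq r) by [].
case: ifP => Qr.
  rewrite codiffU proj_id //; apply: supportedW (@supp_codiff_seq r) => s rs.
  by rewrite (QQ' _ _ rs).
rewrite linear0 proj0 //; apply: supportedW (@supp_codiff_seq r) => s rs.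
by rewrite (QQ' _ _ rs) Qr.
Qed.

Lemma codiff_prepend x f : codiff (prepend x f) = prepend x (Ins (sbetween x) f - codiff f).
Proof.
elim/malg_ind: f => [|c r f IH]; first by rewrite !linear0 addr0 linear0.
by rewrite !basisL IH -[LHS]linearP scalerBr addrACA -opprD.
Qed.

Lemma Ins_prepend (P : G -> G -> bool) z f :
  Ins P (prepend z f) = \sum_(v | P z v) prepend v (prepend z f).
Proof.
elim/malg_ind: f => [|a s g IHg].
  by rewrite !linear0 big1 // => v _; rewrite linear0.
rewrite !basisL IHg /= scaler_sumr -big_split /=.
by apply: eq_bigr => v _; rewrite basisL.
Qed.

(** Inserting twice at the head gives the same tuples as inserting once at the
    head and once just below: this is the associativity of the rule P. The
    remaining terms of the right-hand side cancel. *)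
Lemma Ins_Ins (P : G -> G -> bool) f :
  (forall z v u, P z v && P v u = P z u && sbetween u z v) ->
  Ins P (Ins P f) = codiff (Ins P f) + Ins P (codiff f).
Proof.
move=> PA; elim/malg_ind: f => [|c r f IH]; first by rewrite !linear0 addr0.
rewrite !basisL.
rewrite [Ins P (_ + _)]linearP [codiff (_ + _)]linearP [Ins P (_ + _)]linearP.
rewrite /= IH addrACA -scalerDr.
suff -> : Ins P (ins P r) = codiff (ins P r) + Ins P (codiff_seq r) by [].
case: r => [|z r]; first by rewrite /= !linear0 addr0.
rewrite [codiff_seq _]/= Ins_prepend [ins _ _]/= !linear_sum /= -big_split /=.
under [RHS]eq_bigr => v _.
  rewrite codiffU /= -linearD /=.
  rewrite subrK linear_sum.
  over.
under eq_bigr do rewrite InsU /=.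
(* u is the last inserted vertex on the left, the one at the head on the
   right. *)
rewrite (exchange_big_dep xpredT) //= [RHS]big_mkcond /=.
apply: eq_bigr => u _; rewrite (eq_bigl (fun v => P z u && sbetween u z v)) //.
case: (P z u) => /=; last exact: big_pred0_eq.
by apply: eq_bigr => v _; rewrite prependU.
Qed.

Lemma codiff_codiff f : codiff (codiff f) = 0.
Proof.
have main r : codiff (codiff_seq r) = 0.
  elim: r => [|x r IH] /=; first by rewrite linear0.
  rewrite codiff_prepend; set h := (X in prepend x X).
  suff -> : h = 0 by rewrite linear0.
  rewrite /h [Ins _ _]linearB [codiff _]linearB /= IH subr0 -InsU -[in Ins _ (codiff_seq r)]codiffU.
  by rewrite Ins_Ins; [rewrite addrK subrr|exact: sbetween_assoc].
elim/malg_ind: f => [|c r f IH]; first by rewrite !linear0.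
by rewrite basisL linearP /= IH main scaler0 addr0.
Qed.

Lemma cone_diff_sq y f : cone_diff y (cone_diff y f) = 0.
Proof.
rewrite /cone_diff [Ins _ (_ - _)]linearB [codiff (_ - _)]linearB /= Ins_Ins; last exact: between_assoc.
by rewrite codiff_codiff subr0 addrK subrr.
Qed.

End Insertion.

(** * Norms of tuples *)
Section Tuples.
Variable G : digraph.
Implicit Types (r s : seq G) (x y z u v : G).

Definition gap x z := (z != x) && reach z x.
Definition valid r := (r != [::]) && sorted gap r.
Fixpoint rnorm r : nat :=
  if r is x :: r' then (if r' is z :: _ then ndist z x else 0) + rnorm r' else 0.
Definition ispath r := (r != [::]) && sorted (fun x z => arrow z x) r.

Lemma valid_cons2 x z r : valid [:: x, z & r] = gap x z && valid (z :: r).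
Proof. by []. Qed.

Lemma ispath_cons2 x z r : ispath [:: x, z & r] = arrow z x && ispath (z :: r).
Proof. by []. Qed.

Lemma rnorm_cons2 x z r : rnorm [:: x, z & r] = (ndist z x + rnorm (z :: r))%N.
Proof. by []. Qed.

Lemma gap_ndist x z : gap x z = reach z x && (0 < ndist z x)%N.
Proof. by rewrite /gap andbC; case rzx: (reach z x) => //=; rewrite ndist_gt0. Qed.

Lemma sbetween_gap x z v : sbetween x z v -> [/\ gap x z, gap x v & gap v z].
Proof.
case/andP=> vx h; have rzx := between_reach h; case/and4P: h => vz rzv rvx /eqP e.
rewrite /gap vx (eq_sym z v) vz rzx rzv rvx -ndist_gt0 //; split=> //.
by have := ndist_gt0 rzv; rewrite eq_sym vz; lia.
Qed.

Lemma between_gap y z v : between y z v -> gap v z.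
Proof. by case/and4P=> vz rzv _ _; rewrite /gap eq_sym vz. Qed.

Lemma between_ndist y z v : between y z v -> (ndist z v + ndist v y)%N = ndist z y.
Proof. by case/and4P=> _ _ _ /eqP. Qed.

Lemma ins1_valid r s : ins1 r s -> valid s = valid r.
Proof.
elim: r s => [|x r IH] [|x' s] //= [-> [rs|]].
  have vE := IH _ rs; case: r s rs vE {IH} => [|z r] [|z' s] //= [-> _] vE.
  by rewrite !valid_cons2 vE.
case=> v [-> h]; case: r h {IH} => // z r /= /sbetween_gap[g1 g2 g3].
by rewrite !valid_cons2 g1 g2 g3.
Qed.

Lemma ins1_rnorm r s : ins1 r s -> rnorm s = rnorm r.
Proof.
elim: r s => [|x r IH] [|x' s] // [-> [rs|]].
  have vE := IH _ rs; case: r s rs vE {IH} => [|z r] [|z' s] // [-> _] vE.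
  by rewrite !rnorm_cons2 vE.
case=> v [-> h]; case: r h {IH} => // z r /andP[_ /between_ndist e].
by rewrite !rnorm_cons2 -e; lia.
Qed.

Lemma ins1_nonpath r s : ins1 r s -> ispath r = false.
Proof.
elim: r s => [|x r IH] [|x' s] // [-> [rs|]].
  have vE := IH _ rs; case: r s rs vE {IH} => [|z r] [|z' s] // [-> _] vE.
  by rewrite ispath_cons2 vE andbF.
case=> v [_ h]; case: r h {IH} => // z r /= h.
by rewrite ispath_cons2; apply/negP => /andP[a _]; rewrite (arrow_sbetween v a) in h.
Qed.

Lemma arrow_gap x z : arrow z x -> gap x z /\ ndist z x = 1%N.
Proof. by rewrite gap_ndist arrowE => /andP[-> /eqP->]. Qed.

Lemma ispath_valid r : ispath r -> valid r /\ size r = (rnorm r).+1.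
Proof.
elim: r => // x [|z r] IH //; rewrite ispath_cons2 => /andP[/arrow_gap[g d1] /IH].
by rewrite valid_cons2 rnorm_cons2 g d1 => -[-> /= ->].
Qed.

(** Each gap has length at least 1; the tuples with equality are the paths, by
    the next lemma. *)
Lemma valid_size r : valid r -> (size r <= (rnorm r).+1)%N.
Proof.
elim: r => // x [|z r] IH //; rewrite valid_cons2 gap_ndist => /andP[/andP[_ g] /IH].
by rewrite rnorm_cons2 /=; lia.
Qed.

Lemma valid_ispath r : valid r -> size r = (rnorm r).+1 -> ispath r.
Proof.
elim: r => // x [|z r] IH //; rewrite valid_cons2 gap_ndist ispath_cons2 arrowE.
case/andP=> /andP[rzx g] v; have := valid_size v; rewrite rnorm_cons2 /= => le1 e.
rewrite rzx (IH v) ?andbT /=; last by rewrite /=; lia.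
by apply/eqP; lia.
Qed.

End Tuples.

(** * The cone over a target vertex *)
Section Contraction.
Variables (K : fieldType) (G : digraph) (y : G).
Local Notation E := {malg K[seq G]}.
Implicit Types (f g : E) (r s : seq G) (x z u v : G).

(** The norm of the tuple closed up by y, which [cone_diff y] preserves. *)
Definition total r := if r is z :: _ then (rnorm r + ndist z y)%N else 0%N.
Definition aimed r := valid r && headb (fun z => reach z y) r.

Lemma ins1_aimed r s : ins1 r s -> aimed s = aimed r.
Proof. by move=> rs; rewrite /aimed (ins1_valid rs) (ins1_headb _ rs). Qed.

Lemma ins1_total r s : ins1 r s -> total s = total r.
Proof. by move=> rs; have := ins1_rnorm rs; case: r s rs => [|x r] [|x' s] // [-> _] /= ->. Qed.

Lemma between_aimed z v r : between y z v -> aimed (z :: r) -> aimed [:: v, z & r].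
Proof.
move=> h /andP[vr _]; rewrite /aimed valid_cons2 vr (between_gap h) /=.
by case/and4P: h.
Qed.

Lemma between_total z v r : between y z v -> total [:: v, z & r] = total (z :: r).
Proof. by move/between_ndist=> e; rewrite /total rnorm_cons2 -e; lia. Qed.

Lemma cone_diff_proj (Q Q' : pred (seq G)) f :
  (forall r s, ins1 r s -> Q' s = Q r) ->
  (forall z v r, between y z v -> Q' [:: v, z & r] = Q (z :: r)) ->
  cone_diff y (proj Q f) = proj Q' (cone_diff y f).
Proof.
move=> H1 H2; rewrite /cone_diff linearB /= (codiff_proj _ H1).
suff -> : Ins (between y) (proj Q f) = proj Q' (Ins (between y) f) by [].
elim/malg_ind: f => [|c r f IH]; first by rewrite !linear0.
rewrite InsL !linearP /= IH projU.
suff -> : Ins (between y) (if Q r then << r >> else 0 : E) = proj Q' (ins K (between y) r) by [].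
case: r => [|z r]; first by case: ifP; rewrite !(InsU, linear0).
rewrite [ins _ _ _]/= linear_sum /=; case: ifP => Qr.
  by rewrite InsU /=; apply: eq_bigr => v h; rewrite projU H2 // Qr.
by rewrite linear0 big1 // => v h; rewrite projU H2 // Qr.
Qed.

Definition cone_htpy_seq r : E :=
  if r is x :: (_ :: _) as r' then (if x == y then << r' >> else 0) else 0.
Definition cone_htpy : E -> E := linear_ext cone_htpy_seq.
HB.instance Definition _ := GRing.Linear.on cone_htpy.

Lemma cone_htpyU r : cone_htpy << r >> = cone_htpy_seq r.
Proof. exact: linear_extU. Qed.

Lemma cone_htpy_prepend f : supported (fun r => r != [::]) f -> cone_htpy (prepend y f) = f.
Proof.
move=> fP; elim/malg_ind_on: {f} fP => [|c r f Qr IH]; first by rewrite !linear0.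
rewrite prependL linearP /= IH cone_htpyU.
suff -> : cone_htpy_seq (y :: r) = << r >> by [].
by case: r Qr => // z r _; rewrite /cone_htpy_seq eqxx.
Qed.

Lemma cone_htpy_headN f : supported (fun r => ~~ headb (pred1 y) r) f -> cone_htpy f = 0.
Proof.
move=> fP; elim/malg_ind_on: {f} fP => [|c r f Qr IH]; first by rewrite !linear0.
rewrite linearP /= IH cone_htpyU.
suff -> : cone_htpy_seq r = 0 by rewrite scaler0 addr0.
by case: r Qr => [|x [|z r]] // /negbTE; rewrite /cone_htpy_seq /headb /= => ->.
Qed.

Lemma supp_nonempty (P : G -> G -> bool) r :
  supported (fun s => s != [::]) (ins K P r - codiff_seq K r).
Proof.
apply: supportedB.
  move=> s /supp_ins [v [-> _]]. by [].
by move=> s /supp_codiff_seq; case: r s => [|x r] [|x' s].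
Qed.

Lemma scale_add3 (V : lmodType K) (c : K) (a b d a' b' d' : V) :
  c *: a + a' + (c *: b + b') + (c *: d + d') =
  c *: (a + b + d) + (a' + b' + d').
Proof. by rewrite !scalerDr [X in X + _ = _]addrACA [LHS]addrACA. Qed.

Lemma betweenxx z v : between z z v = false.
Proof.
apply/negP => h; have := between_ndist h; case/and4P: h => vz rzv _ _.
by have := ndist_gt0 rzv; rewrite ndist_xx eq_sym vz; lia.
Qed.

Lemma between_end x : reach x y -> between y x y = (x != y).
Proof. by move=> rxy; rewrite /between eq_sym rxy reach_xx ndist_xx addn0 eqxx !andbT. Qed.

Lemma cone_htpy_insN x r : reach x y -> x != y ->
  cone_htpy (ins K (between y) (x :: r)) = << x :: r >>.
Proof.
move=> rxy xy; rewrite linear_sum (bigD1 y) /=; last by rewrite between_end.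
rewrite cone_htpyU /cone_htpy_seq eqxx big1 ?addr0 // => v /andP[_ /negbTE vy].
by rewrite cone_htpyU /cone_htpy_seq vy.
Qed.

Lemma cone_htpy_codiffN x r : x != y -> cone_htpy (codiff_seq K (x :: r)) = 0.
Proof.
move=> xy; apply: cone_htpy_headN => s /supp_codiff_seq rs.
by rewrite (ins1_headb (pred1 y) rs).
Qed.

Lemma cone_diff_apex r : cone_diff y << y :: r >> = - codiff_seq K (y :: r).
Proof. by rewrite /cone_diff InsU codiffU [ins _ _ _]big_pred0 ?sub0r // => v; apply: betweenxx. Qed.

(** On a tuple that does not end in y, the only insertion that the homotopy can
    undo is that of y at the end. On a tuple that ends in y, the two terms
    contain the same insertions before y with opposite signs, except for the
    insertion of y at the end. *)
Lemma contraction_basis r : aimed r ->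
  << r >> = cone_diff y (cone_htpy_seq r) + cone_htpy (cone_diff y << r >>) + (r == [:: y])%:R *: << [:: y] >>.
Proof.
case: r => [|x r] // /andP[vr rxy].
have [xy|xy] := eqVneq x y; last first.
  have -> : cone_htpy_seq (x :: r) = 0 by case: r {vr rxy} => //= z r; rewrite (negbTE xy).
  rewrite linear0 add0r eqseq_cons (negbTE xy) scale0r addr0.
  by rewrite /cone_diff linearB /= InsU codiffU cone_htpy_insN // (cone_htpy_codiffN _ xy) subr0.
rewrite xy in vr rxy *; rewrite cone_diff_apex linearN /=.
clear rxy; case: r vr => [_|z r].
  by rewrite /cone_htpy_seq /= subr0 !linear0 !add0r eqxx scale1r.
rewrite valid_cons2 => /andP[/andP[zy rzy] _].
rewrite eqseq_cons andbF scale0r addr0 eqxx.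
rewrite cone_htpy_prepend; last exact: supp_nonempty.
rewrite /cone_diff InsU codiffU opprB addrA subrK.
rewrite [ins K (between y) _]/= (bigD1 y) /=; last by rewrite between_end.
by rewrite (eq_bigl (sbetween y z)) ?addrK // => v; rewrite andbC.
Qed.

Lemma contraction f : supported aimed f ->
  f = cone_diff y (cone_htpy f) + cone_htpy (cone_diff y f) + f@_[:: y] *: << [:: y] >>.
Proof.
move=> fP; elim/malg_ind_on: {f} fP => [|c r f gr IH].
  by rewrite !linear0 mcoeff0 scale0r !addr0.
rewrite [cone_htpy (_ + _)]linearP [cone_diff y (c *: _ + _)]linearP mcoeffD mcoeffZ /=.
rewrite [cone_diff y (_ + _)]linearP [cone_htpy (_ + _)]linearP /= cone_htpyU.
rewrite scalerDl -scalerA scale_add3 mcoeffU.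
have step (a a' b b' : E) : a = a' -> b = b' -> c *: a + b = c *: a' + b'.
  by move=> -> ->.
by apply: step; [apply: contraction_basis|apply: IH].
Qed.

End Contraction.

(** * From tuples to the path algebra *)
Section Projection.
Variables (K : fieldType) (G : digraph).
Local Notation E := {malg K[seq G]}.
Local Notation KG := (path_alg K G).
Local Notation elt := (path_elt K).
Implicit Types (f g : E) (r s : seq G) (x y z u v : G) (a b : KG).

Lemma path_elt_eq0 x s : ~~ path (@arrow G) x s -> elt x s = 0.
Proof. by move=> nxs; rewrite /path_elt insubN. Qed.

Lemma path_eltU (p : qpath G) : elt (init p) (val p).2 = << p >>.
Proof.
rewrite /path_elt; case: insubP => [q _ qE|].
  by congr << _ >>; apply: val_inj; rewrite qE /init; case: (val p).
by rewrite (valP p).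
Qed.

Lemma path_eltM x s z t :
  elt x s * elt z t = if last x s == z then elt x (s ++ t) else 0.
Proof.
have [p1|p1] := boolP (path (@arrow G) x s); last first.
  rewrite path_elt_eq0 // mul0r path_elt_eq0 ?if_same //.
  by rewrite cat_path negb_and p1.
have [p2|p2] := boolP (path (@arrow G) z t); last first.
  rewrite [elt z t]path_elt_eq0 // mulr0; case: eqP => // e.
  by rewrite path_elt_eq0 // cat_path negb_and e p2 orbT.
pose p : qpath G := Sub (x, s) p1; pose q : qpath G := Sub (z, t) p2.
have -> : elt x s = << p >> by rewrite -path_eltU.
have -> : elt z t = << q >> by rewrite -path_eltU.
rewrite /GRing.mul /= path_mulE !lin_extU /pprod.
case e: (last x s == z); last by rewrite pconcat_None //= ?SubK; apply/eqP/negbT.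
have [|r rE] := @pconcat_ex _ p q; first exact/eqP.
rewrite rE -path_eltU (init_cat rE).
by have [_ ->] := (pconcat_val _ _ _).1 rE.
Qed.

Definition path_of r : KG := if rev r is x :: s then elt x s else 0.
Definition path_part : E -> KG := linear_ext path_of.
HB.instance Definition _ := GRing.Linear.on path_part.

Lemma path_partU r : path_part << r >> = path_of r.
Proof. exact: linear_extU. Qed.

Lemma path_partP c f g : path_part (c *: f + g) = c *: path_part f + path_part g.
Proof. exact: linearP. Qed.

Lemma path_partL c r f : path_part (c *: << r >> + f) = c *: path_of r + path_part f.
Proof. by rewrite linearP /= path_partU. Qed.

Lemma path_ofM z r x s :
  path_of (z :: r) * elt x s = if z == x then path_of (rev s ++ z :: r) else 0.
Proof.
rewrite /path_of rev_cat revK.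
case rE: (rev (z :: r)) => [|y t].
  by move/(congr1 size): rE; rewrite size_rev.
have <- : last y t = z by rewrite -[last y t]/(last y (y :: t)) -rE rev_cons last_rcons.
by rewrite path_eltM /=; case: eqP.
Qed.

Lemma mcoeff_path_of r (q : qpath G) : (path_of r)@_q = (r == rev (vseq q))%:R.
Proof.
rewrite /path_of -(inj_eq (can_inj revK)) revK.
case: (rev r) => [|x s]; first by rewrite mcoeff0.
by rewrite mcoeff_path_elt /vseq eqseq_cons; case: (val q).
Qed.

Lemma path_of_eq0 r : ~~ ispath r -> path_of r = 0.
Proof.
rewrite /ispath -rev_sorted /path_of -size_eq0 -size_rev size_eq0.
case: (rev r) => [|x s] //= np; exact: path_elt_eq0.
Qed.

Lemma path_part_nonpath f : supported (fun r => ~~ ispath r) f -> path_part f = 0.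
Proof.
move=> fP; elim/malg_ind_on: {f} fP => [|c r f Qr IH]; first exact: linear0.
by rewrite path_partL path_of_eq0 // IH scaler0 addr0.
Qed.

(** Distinct paths are linearly independent in the path algebra. *)
Lemma path_part_eq0 f : path_part f = 0 -> supported (fun r => ~~ ispath r) f.
Proof.
move=> f0 r; apply: contra => pr.
have : rev r != [::] by case/andP: pr; rewrite -!size_eq0 size_rev.
case rE: (rev r) => [|x s] // _.
have ps : path (@arrow G) x s.
  by case/andP: pr => _; rewrite -rev_sorted rE.
pose q : qpath G := Sub (x, s) ps.
have <- : (path_part f)@_q = f@_r; last by rewrite f0 mcoeff0.
have qE : r = rev (vseq q) by rewrite /vseq SubK -rE revK.
clear f0; elim/malg_ind: f => [|c t f IH]; first by rewrite linear0 !mcoeff0.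
by rewrite path_partL !mcoeffD !mcoeffZ IH mcoeff_path_of mcoeffU -qE.
Qed.

Definition path_lift : KG -> E := linear_ext (fun q : qpath G => << rev (vseq q) >>).
HB.instance Definition _ := GRing.Linear.on path_lift.

Lemma path_part_lift a : path_part (path_lift a) = a.
Proof.
elim/malg_ind: a => [|c q a IH]; first by rewrite !linear0.
rewrite [path_lift _]linearP /= [path_lift _]linear_extU [path_part _]linearP /= {}IH path_partU.
by rewrite /path_of revK /= path_eltU.
Qed.

Lemma supp_path_lift a : supported (@ispath G) (path_lift a).
Proof.
apply: (@supported_linear_ext _ _ _ (fun=> True)) => // q _; apply: supportedU.
rewrite /ispath -rev_sorted revK -size_eq0 size_rev /=; exact: (valP q).
Qed.

Definition arrow_sum (P : G -> G -> bool) : KG := \sum_z \sum_(v | P z v) elt z [:: v].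
Definition vertex_sum (H : pred G) : KG := \sum_(x | H x) elt x [::].

Lemma path_part_Ins P f : path_part (Ins P f) = path_part f * arrow_sum P.
Proof.
elim/malg_ind: f => [|c r f IH]; first by rewrite !linear0 mul0r.
rewrite InsL path_partL [LHS]linearP /= IH mulrDl -path_alg_scalerAl.
suff -> : path_part (ins K P r) = path_of r * arrow_sum P by [].
case: r => [|z r]; first by rewrite linear0 mul0r.
rewrite linear_sum mulr_sumr [RHS](bigD1 z) //= [X in _ + X]big1 ?addr0.
  by rewrite mulr_sumr; apply: eq_bigr => v _; rewrite path_partU path_ofM eqxx.
move=> x /negbTE xz; rewrite mulr_sumr; apply: big1 => v _.
by rewrite path_ofM (eq_sym z) xz.
Qed.

Lemma path_part_proj (H : pred G) f : path_part (proj (headb H) f) = path_part f * vertex_sum H.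
Proof.
elim/malg_ind: f => [|c r f IH]; first by rewrite !linear0 mul0r.
rewrite path_partL [proj _ _]linearP /= [LHS]linearP /= IH mulrDl -path_alg_scalerAl.
suff -> : path_part (proj (headb H) << r >>) = path_of r * vertex_sum H by [].
rewrite projU; case: r => [|z r]; first by rewrite linear0 mul0r.
rewrite /headb mulr_sumr; case: ifP => Hz.
  rewrite [RHS](bigD1 z Hz) /= path_ofM eqxx path_partU [X in _ + X]big1 ?addr0.
    by [].
  by move=> x /andP[_ /negbTE xz]; rewrite path_ofM (eq_sym z) xz.
rewrite linear0; apply/esym/big1 => x Hx; rewrite path_ofM.
by case: eqP => // zx; rewrite zx Hx in Hz.
Qed.

Lemma path_part_prepend z x f :
  supported (headb (pred1 z)) f -> path_part (prepend x f) = path_part f * elt z [:: x].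
Proof.
move=> fP; elim/malg_ind_on: {f} fP => [|c r f Qr IH].
  by rewrite !linear0 mul0r.
rewrite prependL !path_partL IH mulrDl -path_alg_scalerAl.
suff -> : path_of (x :: r) = path_of r * elt z [:: x] by [].
case: r Qr => [H|w r /eqP ->]; first discriminate H.
by rewrite path_ofM eqxx.
Qed.

Local Notation Tid := (ideal_gen (@T_gen K G)).

Lemma T_scale c a : a \in Tid -> c *: a \in Tid.
Proof. by move=> aT; rewrite -[a]mul1r path_alg_scalerAl; apply: ideal_genMl. Qed.

Lemma sbetween_T z x : \sum_(v | sbetween x z v) elt z [:: v; x] \in Tid.
Proof.
have [zx2|zx2] := pselect (dist z x = Some 2).
  apply/ideal_genP => I _; apply; exists z, x; split=> //.
  by apply: eq_bigl => v; rewrite /= andbT; apply: sbetween_dist2.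
rewrite big1 ?rpred0 // => v h; rewrite path_elt_eq0 //=; apply/negP.
by case/and3P=> zv vx _; apply: zx2; apply: sbetween_arrows h zv vx.
Qed.

(** An insertion produces a path only from a tuple with one gap of length 2 and
    all others of length 1, and all fillings of this gap occur. *)
Lemma path_part_codiff_T f : path_part (codiff f) \in Tid.
Proof.
suff H r : path_part (codiff_seq K r) \in Tid.
  elim/malg_ind: f => [|c r f IH]; first by rewrite !linear0 rpred0.
  by rewrite codiffL linearP; exact: rpredD (T_scale c (H r)) IH.
elim: r => [|x [|z r] IH].
- by rewrite linear0 rpred0.
- by rewrite /= subr0 !linear0 rpred0.
have -> : codiff_seq K [:: x, z & r] = prepend x (ins K (sbetween x) (z :: r) - codiff_seq K (z :: r)).
  by [].
set D := codiff_seq K (z :: r); rewrite 2!linearB; apply: rpredB; last first.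
  rewrite /= (@path_part_prepend z); first exact: ideal_genMr.
  by move=> s /supp_codiff_seq rs; rewrite (ins1_headb (pred1 z) rs) /= eqxx.
rewrite linear_sum linear_sum.
under eq_bigr => v h.
  rewrite /= prependU path_partU (_ : path_of _ = path_of (z :: r) * elt z [:: v; x]); last first.
    by rewrite path_ofM eqxx.
  over.
by rewrite -mulr_sumr; apply/ideal_genMl/sbetween_T.
Qed.

(** There is nothing to insert into a gap of length 1. *)
Lemma codiff_Ins_arrow (P : G -> G -> bool) f :
  (forall z v, P z v -> arrow z v) -> codiff (Ins P f) = - Ins P (codiff f).
Proof.
move=> Parr; elim/malg_ind: f => [|c r f IH]; first by rewrite !linear0.
rewrite InsL !codiffL [codiff (_ + _)]linearP [Ins P (_ + _)]linearP /= IH opprD -scalerN.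
suff -> : codiff (ins K P r) = - Ins P (codiff_seq K r) by [].
case: r => [|z r]; first by rewrite /= !linear0.
rewrite [codiff_seq _ _]/= Ins_prepend linear_sum -sumrN; apply: eq_bigr => v Pzv.
rewrite /= codiffU [codiff_seq _ _]/= big_pred0 ?sub0r ?linearN // => w.
by rewrite arrow_sbetween ?Parr.
Qed.

Let J a := exists g : E, a = path_part (codiff g).

Lemma arrow_sum1 z v : arrow_sum (fun z' v' => (z' == z) && (v' == v)) = elt z [:: v].
Proof.
rewrite /arrow_sum (bigD1 z) //= [X in _ + X]big1 ?addr0; last first.
  by move=> w /negbTE ->; rewrite big_pred0_eq.
by rewrite eqxx big_pred1_eq.
Qed.

Lemma vertex_sum1 x : vertex_sum (pred1 x) = elt x [::].
Proof. by rewrite /vertex_sum big_pred1_eq. Qed.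

(** Right multiplication by an arrow is an insertion at the head. *)
Lemma J_mulr a b : J a -> J (a * b).
Proof.
have J0 : J 0 by exists 0; rewrite !linear0.
have Jarr c z v : J c -> J (c * elt z [:: v]).
  case=> g ->; have [zv|zv] := boolP (arrow z v); last first.
    by rewrite path_elt_eq0 ?mulr0 //= andbT.
  (* the arrow z -> v acts on tuples ending in z only *)
  exists (- Ins (fun z' v' => (z' == z) && (v' == v)) g).
  rewrite linearN /= codiff_Ins_arrow ?opprK; last by move=> ? ? /andP[/eqP-> /eqP->].
  by rewrite path_part_Ins arrow_sum1.
have Je c x : J c -> J (c * elt x [::]).
  case=> g ->; exists (proj (headb (pred1 x)) g).
  rewrite (codiff_proj (Q' := headb (pred1 x))) ?path_part_proj ?vertex_sum1 //.
  by move=> r s; apply: ins1_headb.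
have Jelt c x s : J c -> J (c * elt x s).
  elim/last_ind: s c => [|s v IH] c Jc; first exact: Je.
  have -> : elt x (rcons s v) = elt x s * elt (last x s) [:: v].
    by rewrite path_eltM eqxx cats1.
  by rewrite mulrA; apply/Jarr/IH.
move=> Ja; elim/malg_ind: b => [|c q b [g IH]]; first by rewrite mulr0.
rewrite mulrDr -path_alg_scalerAr -path_eltU.
have [g' ->] := Jelt _ (init q) (val q).2 Ja.
by exists (c *: g' + g); rewrite IH 2!linearP.
Qed.

Lemma path_part_prepend_Ins x y f : path_part (prepend y (Ins (sbetween y) (proj (headb (pred1 x)) f)))
  = path_part f * \sum_(v | sbetween y x v) elt x [:: v; y].
Proof.
elim/malg_ind: f => [|c r f IH]; first by rewrite !linear0 mul0r.
rewrite path_partL mulrDl -IH -path_alg_scalerAl.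
rewrite projP InsP prependP path_partP projU.
have step (a b d : KG) : a = b -> c *: a + d = c *: b + d by move=> ->.
apply: step; clear; case: r => [|z r]; first by rewrite !linear0 mul0r.
rewrite /headb /=; have [->|zx] := eqVneq z x; last first.
  rewrite !linear0 mulr_sumr; apply/esym/big1 => v _.
  by rewrite path_ofM (negbTE zx).
rewrite InsU [ins _ _ _]/= 2!linear_sum mulr_sumr; apply: eq_bigr => v _.
by rewrite /= prependU path_partU path_ofM eqxx.
Qed.

(** For a path that ends in x, insert into the gap that is created by appending
    y; the other terms contain the pair (x, y), which is no arrow. *)
Lemma J_mul_t a x y : dist x y = Some 2 -> J (a * t_elt K x y).
Proof.
move=> xy2; set f := proj (headb (pred1 x)) (path_lift a); exists (prepend y f).
have -> : path_part (codiff (prepend y f)) = path_part (prepend y (Ins (sbetween y) f)) - path_part (prepend y (codiff f)).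
  by rewrite codiff_prepend [prepend _ (_ - _)]linearB [LHS]linearB.
rewrite [X in _ - X](@path_part_prepend x); last first.
  rewrite /f (codiff_proj (Q' := headb (pred1 x))) => [r|r s]; last exact: ins1_headb.
  by rewrite mcoeff_proj; case: ifP => //; rewrite eqxx.
have /negbTE nxy : ~~ arrow x y.
  by rewrite arrowE; case/distE: xy2 => _ ->; rewrite andbF.
rewrite [elt x [:: y]]path_elt_eq0 /= ?nxy // mulr0 subr0.
rewrite /f path_part_prepend_Ins path_part_lift.
set A := \sum_(_ | _) _; suff -> : t_elt K x y = A by [].
by apply: eq_bigl => v; rewrite /= andbT (sbetween_dist2 _ xy2).
Qed.

(** The elements all of whose left multiples are images of codifferentials form
    a two-sided ideal that contains the generators of T. Quantifying over left
    multiples spares the left analogue of [J_mulr]. *)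
Lemma path_part_kernel f : path_part f \in Tid -> exists g, path_part f = path_part (codiff g).
Proof.
move/ideal_genP/(_ (fun a => forall b, J (b * a))) => H.
have [||g] := H _ _ 1; last by rewrite mul1r => gE; exists g.
- split=> [b|a b Ja Jb c|a b Jb c|a b Ja c].
  + by exists 0; rewrite mulr0 !linear0.
  + have [g gE] := Ja c; have [h hE] := Jb c; exists (g - h).
    by rewrite mulrBr gE hE 2!linearB.
  + by rewrite mulrA; apply: Jb.
  + by rewrite mulrA; apply: J_mulr.
- by move=> _ [x [y [xy2 ->]]] b; apply: J_mul_t.
Qed.

End Projection.

(** * Magnitude cochains and right multiplication in Omega *)
Section Comparison.
Variables (K : fieldType) (G : digraph).
Local Notation E := {malg K[seq G]}.
Local Notation KG := (path_alg K G).
Local Notation Om := (Omega K G).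
Local Notation Opi := (Omega_pi K G).
Local Notation elt := (path_elt K).
Local Notation Tid := (ideal_gen (@T_gen K G)).
Implicit Types (f g : E) (r s : seq G) (x y z u v : G) (a b : KG) (w : Om).

Lemma Opi_eq0 a : Opi a = 0 <-> a \in Tid.
Proof. by rewrite -(rmorph0 Opi) [_ = _]quot_pi_eq subr0. Qed.

Lemma path_partD f g : path_part (f + g) = path_part f + path_part g.
Proof. exact: linearD. Qed.
Lemma path_partB f g : path_part (f - g) = path_part f - path_part g.
Proof. exact: linearB. Qed.
Lemma path_partZ c f : path_part (c *: f) = c *: path_part f.
Proof. exact: linearZ. Qed.
Definition in_kernel f := path_part f \in Tid.

Definition to_Omega f : Om := Opi (path_part f).

Lemma to_OmegaD f g : to_Omega (f + g) = to_Omega f + to_Omega g.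
Proof. by rewrite /to_Omega path_partD; exact: rmorphD. Qed.
Lemma to_OmegaB f g : to_Omega (f - g) = to_Omega f - to_Omega g.
Proof. by rewrite /to_Omega path_partB; exact: rmorphB. Qed.
Lemma to_Omega_eq0 f : to_Omega f = 0 <-> in_kernel f.
Proof. exact: Opi_eq0. Qed.
Lemma to_Omega_proj (H : pred G) f : to_Omega (proj (headb H) f) = to_Omega f * Opi (vertex_sum K H).
Proof. by rewrite /to_Omega path_part_proj; exact: rmorphM. Qed.
Lemma to_Omega_lift w : to_Omega (path_lift (repr w)) = w.
Proof. by rewrite /to_Omega path_part_lift; exact: Omega_piK. Qed.
Lemma to_Omega_vertex c x : to_Omega (c *: << [:: x] >>) = Opi (c *: elt x [::]).
Proof. by rewrite /to_Omega path_partZ path_partU. Qed.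

Lemma in_kernel_codiff f : in_kernel (codiff f).
Proof. exact: path_part_codiff_T. Qed.

Lemma in_kernelD f g : in_kernel f -> in_kernel g -> in_kernel (f + g).
Proof. by rewrite /in_kernel linearD; apply: rpredD. Qed.

Lemma in_kernelN f : in_kernel f -> in_kernel (- f).
Proof. by rewrite /in_kernel linearN rpredN. Qed.

Lemma in_kernelB f g : in_kernel f -> in_kernel g -> in_kernel (f - g).
Proof. by move=> fN /in_kernelN; apply: in_kernelD. Qed.

Lemma in_kernel_nonpath f : supported (fun r => ~~ ispath r) f -> in_kernel f.
Proof. by rewrite /in_kernel => /path_part_nonpath ->; apply: rpred0. Qed.

Lemma in_kernel_Ins P f : in_kernel f -> in_kernel (Ins P f).
Proof. by rewrite /in_kernel path_part_Ins; apply: ideal_genMr. Qed.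

Lemma in_kernel_cone_diff y f : in_kernel f -> in_kernel (cone_diff y f).
Proof. by move=> fN; apply: in_kernelB (in_kernel_Ins _ fN) (in_kernel_codiff f). Qed.

Lemma in_kernel_split f : in_kernel f ->
  exists g, supported (fun r => ~~ ispath r) (f - codiff g).
Proof.
move=> /path_part_kernel[g gE]; exists g; apply: path_part_eq0.
by rewrite linearB /= gE subrr.
Qed.

Lemma in_kernel_proj (Q Q' : pred (seq G)) f :
  (forall r s, ins1 r s -> Q' s = Q r) -> in_kernel f -> in_kernel (proj Q' f).
Proof.
move=> QQ' /in_kernel_split[g fg].
have -> : proj Q' f = proj Q' (f - codiff g) + codiff (proj Q g).
  by rewrite (codiff_proj _ QQ') -linearD subrK.
apply: in_kernelD (in_kernel_codiff _); apply: in_kernel_nonpath.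
by move=> r; rewrite mcoeff_proj; case: ifP => _; [apply: fg|rewrite eqxx].
Qed.

Lemma codiff_seq_path r : ispath r -> codiff_seq K r = 0.
Proof.
move=> pr; apply: (supported_eq0 (@supp_codiff_seq K G r)) => s /ins1_nonpath.
by rewrite pr.
Qed.

Lemma codiff_nonpath f : codiff (proj (predC (@ispath G)) f) = codiff f.
Proof.
elim/malg_ind: f => [|c r f IH]; first by rewrite !linear0.
rewrite projP codiffP codiffL IH projU /=.
case pr: (ispath r) => /=; last by rewrite codiffU.
by rewrite linear0 codiff_seq_path.
Qed.

(** As codifferentials respect gradings and kill paths, a preimage can be
    replaced by its part in the degrees of its image, without paths. *)
Lemma preimage (Q : pred (seq G)) g :
  (forall r s, ins1 r s -> Q s = Q r) -> supported Q (codiff g) ->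
  exists g', [/\ codiff g' = codiff g, in_kernel g' & supported Q g'].
Proof.
move=> QI sQ; exists (proj (predC (@ispath G)) (proj Q g)); split.
- by rewrite codiff_nonpath (codiff_proj _ QI) proj_id.
- apply: in_kernel_nonpath => r; rewrite mcoeff_proj /=.
  by case: ifP => //; rewrite eqxx.
- move=> r; rewrite !mcoeff_proj; case: ifP => // _; rewrite ?eqxx //.
  by case: ifP => //; rewrite eqxx.
Qed.

(** Exactness of the magnitude cochains of norm below m off the diagonal. Using
    the kernel of the projection to Omega in place of the tuples that are no
    paths adds only coboundaries on the diagonal. *)
Definition offdiag_exact m := forall f, in_kernel f ->
  supported (fun r => valid r && (rnorm r < m)%N) f -> codiff f = 0 ->
  exists g, f = codiff g.

Section Target.
Variable y : G.

Definition aimed_le m r := aimed y r && (total y r <= m)%N.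

Lemma ins1_aimed_le m r s : ins1 r s -> aimed_le m s = aimed_le m r.
Proof. by move=> rs; rewrite /aimed_le (ins1_aimed _ rs) (ins1_total _ rs). Qed.

Lemma between_aimed_le m z v r : between y z v -> aimed_le m (z :: r) -> aimed_le m [:: v, z & r].
Proof. by move=> h /andP[g t]; rewrite /aimed_le (between_aimed h g) between_total. Qed.

Lemma supp_cone_diff m f : supported (aimed_le m) f -> supported (aimed_le m) (cone_diff y f).
Proof.
move=> fG; apply: supportedB.
  by apply: supp_Ins fG => z r v; apply: between_aimed_le.
by apply: supp_codiff fG => r s rs; rewrite (ins1_aimed_le _ rs).
Qed.

Lemma headed_y_Ins f : supported (headb (pred1 y)) f -> Ins (between y) f = 0.
Proof.
move=> fy; elim/malg_ind_on: {f} fy => [|c r f Qr IH]; first exact: linear0.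
rewrite InsL IH addr0; suff -> : ins K (between y) r = 0 by rewrite scaler0.
case: r Qr => // z r /eqP->; apply: big_pred0 => v; exact: betweenxx.
Qed.

(** Components are removed by decreasing distance to y. The one of largest
    distance is a cocycle for [codiff], because every other term of [cone_diff]
    has smaller distance; so it is a coboundary, and subtracting [cone_diff] of
    a preimage removes it. *)
Lemma clear_components m J f : offdiag_exact m -> in_kernel f -> supported (aimed_le m) f ->
  supported (headb (pred1 y)) (cone_diff y f) ->
  supported (headb (fun z => ndist z y <= J)%N) f ->
  exists g, [/\ in_kernel g, supported (aimed_le m) g
    & supported (headb (pred1 y)) (f - cone_diff y g)].
Proof.
move=> acm; elim: J f => [|J IH] f fN fG fy fJ.
  exists 0; split.
  - by rewrite /in_kernel linear0 rpred0.
  - exact: supported0.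
  - rewrite linear0 subr0 => r rf; move: (fJ r rf) (fG r rf).
    case: r {rf} => // z r; rewrite /headb leqn0 => n0 /andP[/andP[_ rzy] _].
    by rewrite /= -ndist_eq0.
pose Q := headb (fun z => ndist z y == J.+1); pose fJ1 := proj Q f.
have QI r s : ins1 r s -> Q s = Q r by apply: ins1_headb.
have f0 : codiff fJ1 = 0.
  have : proj Q (cone_diff y f) = 0.
    apply: proj0; apply: supportedW fy => -[|z r] //= /eqP->.
    by rewrite /Q /= ndist_xx.
  rewrite (codiff_proj _ QI) /cone_diff linearB /= (@proj0 _ _ Q (Ins _ _)) ?sub0r.
    by move/eqP; rewrite oppr_eq0 => /eqP.
  apply: supp_Ins fJ => z r v h /=; rewrite /Q /=.
  have := between_ndist h; case/and4P: h => vz rzv _ _.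
  by have := ndist_gt0 rzv; rewrite eq_sym vz; lia.
have fJ1N : in_kernel fJ1 := in_kernel_proj QI fN.
have sfJ1 : supported (fun r => Q r && aimed_le m r) fJ1.
  by move=> r; rewrite mcoeff_proj; case: ifP => [_ /fG|_] //; rewrite eqxx.
have [|g gE] := acm fJ1 fJ1N _ f0.
  apply: supportedW sfJ1 => -[|z r] // /andP[/eqP d1] /andP[/andP[-> _]].
  by rewrite /total d1; lia.
have [||h [hE hN hs]] := @preimage (fun r => Q r && aimed_le m r) g.
- by move=> r s rs; rewrite (QI _ _ rs) (ins1_aimed_le _ rs).
- by rewrite -gE.
have hG : supported (aimed_le m) h by apply: supportedW hs => r /andP[].
have [||||k [kN kG ky]] := IH (f + cone_diff y h).
- by apply: in_kernelD fN _; apply: in_kernel_cone_diff.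
- by apply: supportedD => //; apply: supp_cone_diff.
- by rewrite linearD /= cone_diff_sq addr0.
- rewrite /cone_diff hE -gE addrCA -addrC; apply: supportedD; last first.
    apply: supp_Ins hs => z r v h' /andP[/eqP /= d1 _].
    have := between_ndist h'; case/and4P: h' => vz rzv _ _.
    by have := ndist_gt0 rzv; rewrite eq_sym vz; lia.
  rewrite {1}(projC Q f) addrAC subrr add0r => r; rewrite mcoeff_proj /=.
  case: ifP => [nQ /fJ|]; last by rewrite eqxx.
  by case: r nQ => // z r; rewrite /Q /=; lia.
exists (k - h); split; first exact: in_kernelB.
- exact: supportedB.
- by rewrite [cone_diff y (_ - _)]linearB /= opprB addrA.
Qed.

(** The Koszul element of y: right multiplication by it is the differential of
    K^G on the summands with target y. *)
Definition Omega_step : Om := Opi (arrow_sum K (between y)).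
Definition Omega_reach : Om := Opi (vertex_sum K (fun x => reach x y)).

(** Exactness of the part of K^G with target y. The multiples of e_y are the
    part that the augmentation detects. *)
Definition target_exact := forall w, w * Omega_reach = w -> w * Omega_step = 0 ->
  exists (u : Om) (c : K), w = u * Omega_step + Opi (c *: elt y [::]).

Lemma to_Omega_cone_diff f : to_Omega (cone_diff y f) = to_Omega f * Omega_step.
Proof.
rewrite /cone_diff to_OmegaB ((to_Omega_eq0 (codiff f)).2 (in_kernel_codiff f)) subr0 /to_Omega path_part_Ins.
exact: rmorphM.
Qed.

Lemma aimed_bound f : supported (aimed y) f -> exists m, supported (aimed_le m) f.
Proof.
move=> fg; exists (\max_(r <- msupp f) total y r) => r rf.
rewrite /aimed_le fg //=; apply: (@leq_bigmax_seq _ _ xpredT) => //.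
by rewrite -mcoeff_neq0.
Qed.

Lemma aimed_le_ndist m f : supported (aimed_le m) f ->
  supported (headb (fun z => ndist z y <= m)%N) f.
Proof.
by apply: supportedW => -[|z r] // /andP[_]; rewrite /total /headb; lia.
Qed.

Lemma cone_diff_headed f : supported (headb (pred1 y)) f -> cone_diff y f = - codiff f.
Proof. by move=> fy; rewrite /cone_diff headed_y_Ins // sub0r. Qed.

(** Lift the cycle to E. The [cone_diff] of the lift is in the kernel of the
    projection, where it can be bounded; the corrected lift is a cocycle of the
    cone, to which the contraction applies. *)
Lemma offdiag_exact_target_exact : (forall m, offdiag_exact m) -> target_exact.
Proof.
move=> ac w wf wa; pose z0 := proj (headb (fun x => reach x y)) (path_lift (repr w)).
have pz0 : to_Omega z0 = w by rewrite to_Omega_proj to_Omega_lift.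
have z0g : supported (aimed y) z0.
  move=> r; rewrite mcoeff_proj; case: ifP => [rr /supp_path_lift/ispath_valid[vr _]|].
    by rewrite /aimed vr.
  by rewrite eqxx.
(* From now on only the class and the support of the lift z0 matter. *)
clearbody z0; have [m z0m] := aimed_bound z0g.
have xiN : in_kernel (cone_diff y z0) by apply/to_Omega_eq0; rewrite to_Omega_cone_diff pz0.
have xiG := supp_cone_diff z0m.
have [|g [gN gG]] := clear_components (ac m) xiN xiG _ (aimed_le_ndist xiG).
  by rewrite cone_diff_sq; apply: supported0.
set xi := cone_diff y z0 - cone_diff y g => xiy.
(* On tuples ending in y, cone_diff is - codiff, so xi bounds once more. *)
have xi0 : codiff xi = 0.
  by apply: oppr_inj; rewrite oppr0 -(cone_diff_headed xiy) linearB /= !cone_diff_sq subrr.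
have xi1G : supported (aimed_le m) xi := supportedB xiG (supp_cone_diff gG).
have [||h hE] := ac m.+1 xi _ _ xi0; first exact: in_kernelB xiN (in_kernel_cone_diff y gN).
  by apply: supportedW xi1G => -[|z r] // /andP[/andP[-> _]]; rewrite /total; lia.
have [||k [kE kN ks]] := @preimage (fun r => aimed_le m r && headb (pred1 y) r) h.
- by move=> r s rs; rewrite (ins1_aimed_le _ rs) (ins1_headb _ rs).
- by rewrite -hE => r xr; rewrite xi1G //= xiy.
have kG : supported (aimed_le m) k by apply: supportedW ks => r /andP[].
have ky : supported (headb (pred1 y)) k by apply: supportedW ks => r /andP[].
pose t := z0 - g + k.
have t0 : cone_diff y t = 0.
  by rewrite linearD linearB /= (cone_diff_headed ky) kE -hE subrr.
have tg : supported (aimed y) t.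
  apply: (@supportedW _ _ (aimed_le m)) => [r /andP[]//|].
  by apply: supportedD kG; apply: supportedB gG.
exists (to_Omega (cone_htpy y t)), t@_[:: y].
have <- : to_Omega t = w.
  rewrite /t to_OmegaD to_OmegaB pz0.
  by rewrite ((to_Omega_eq0 _).2 gN) ((to_Omega_eq0 _).2 kN) subr0 addr0.
by rewrite {1}(contraction tg) t0 [cone_htpy y 0]linear0 addr0 to_OmegaD to_Omega_cone_diff to_Omega_vertex.
Qed.

Lemma deg0B a b : deg0 (a - b) = deg0 a - deg0 b.
Proof. exact: raddfB. Qed.
Lemma deg0D a b : deg0 (a + b) = deg0 a + deg0 b.
Proof. exact: raddfD. Qed.

Lemma deg0_cone_diff f : deg0 (path_part (cone_diff y f)) y = 0.
Proof.
have -> : deg0 (path_part (cone_diff y f)) = deg0 (path_part (Ins (between y) f)).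
  by rewrite /cone_diff path_partB deg0B (deg0_T (path_part_codiff_T f)) subr0.
rewrite path_part_Ins deg0M.
rewrite [X in _ * X](_ : _ = 0) ?mulr0 // /arrow_sum raddf_sum sum_ffunE big1 // => z _.
rewrite raddf_sum sum_ffunE big1 // => v _.
by rewrite ffunE mcoeff_path_elt xpair_eqE andbF.
Qed.

Lemma between_aimed_leE m z v r : between y z v -> aimed_le m [:: v, z & r] = aimed_le m (z :: r).
Proof.
move=> h; rewrite /aimed_le (between_total _ h); congr (_ && _).
rewrite /aimed valid_cons2 (between_gap h) /=; have := between_reach h => ->.
by case/and4P: h => _ _ ->.
Qed.

Lemma supp_cone_htpy m f : supported (fun r => valid r && (rnorm r <= m)%N) f ->
  supported (aimed_le m) (cone_htpy y f).
Proof.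
move=> fv; apply: (supported_linear_ext fv) => -[|x [|z r]] H; try exact: supported0.
rewrite /cone_htpy_seq; case: eqP H => [->|_] H; last exact: supported0.
apply: supportedU; case/andP: H; rewrite valid_cons2 rnorm_cons2 => /andP[/andP[_ rzy] vr].
by rewrite /aimed_le /aimed vr /headb rzy /total addnC.
Qed.

(** For tuples ending in y. The contraction gives an e with [cone_diff y e] = f,
    and e projects to a Koszul cycle. Subtracting the lift of a bounding element
    moves e into the kernel of the projection, and clearing leaves tuples ending
    in y, where [cone_diff y] is - [codiff]. *)
Lemma target_exact_headed m f : target_exact -> offdiag_exact m -> in_kernel f ->
  supported (fun r => valid r && (rnorm r <= m)%N) f ->
  supported (headb (pred1 y)) f -> codiff f = 0 -> exists g, f = codiff g.
Proof.
move=> ex ac fN fv fy f0.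
have fG : supported (aimed_le m) f.
  move=> r rf; move: (fv r rf) (fy r rf); case: r {rf} => // z r /andP[v n] /eqP zy.
  by rewrite zy in v n *; rewrite /aimed_le /aimed v /headb /total reach_xx ndist_xx addn0.
have fD : cone_diff y f = 0 by rewrite cone_diff_headed // f0 oppr0.
have fg : supported (aimed y) f by apply: supportedW fG => r /andP[].
have := contraction fg; rewrite fD linear0 addr0; set e := cone_htpy y f; set c := f@_ _.
(* The constant term is the coefficient of e_y, which vanishes on T. *)
move=> fE; have c0 : c = 0.
  have := deg0_T fN; rewrite fE path_partD path_partZ deg0D path_partU => /ffunP/(_ y).
  rewrite ffunE deg0_cone_diff add0r !ffunE mcoeffZ mcoeff_path_elt eqxx mulr1.
  by [].
rewrite c0 scale0r addr0 in fE.
have eG : supported (aimed_le m) e := supp_cone_htpy fv.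
have [||u [c' eE]] := ex (to_Omega e).
- rewrite -[_ * _]to_Omega_proj proj_id //.
  by apply: supportedW eG => -[|z r] // /andP[/andP[]].
- by rewrite -to_Omega_cone_diff -fE; apply/to_Omega_eq0.
pose k := path_lift (repr u).
have dyy : cone_diff y << [:: y] >> = 0 :> E by rewrite cone_diff_apex /= subr0 !linear0.
pose e1 := e - cone_diff y (proj (aimed_le m) k) - c' *: << [:: y] >>.
(* Projecting to total degree at most m fixes e and cuts the lift k down to
   that range. *)
have e1N : in_kernel e1.
  have -> : e1 = proj (aimed_le m) (e - cone_diff y k - c' *: << [:: y] >>).
    rewrite /e1 2!projB projZ projU (proj_id eG).
    rewrite (@cone_diff_proj _ _ _ (aimed_le m) (aimed_le m)); last 2 first.
    - by move=> r s; apply: ins1_aimed_le.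
    - by move=> z v r; apply: between_aimed_leE.
    by rewrite /aimed_le /aimed /total /= reach_xx ndist_xx.
  apply: (@in_kernel_proj (aimed_le m)); first by move=> r s; apply: ins1_aimed_le.
  apply/to_Omega_eq0; rewrite 2!to_OmegaB to_Omega_cone_diff to_Omega_vertex to_Omega_lift eE.
  by rewrite -addrA -opprD subrr.
have e1G : supported (aimed_le m) e1.
  apply: supportedB; first apply: supportedB => //.
    by apply: supp_cone_diff => r; rewrite mcoeff_proj; case: ifP => //; rewrite eqxx.
  apply: supportedZ; apply: supportedU; by rewrite /aimed_le /aimed /total /= reach_xx ndist_xx.
have e1D : cone_diff y e1 = f by rewrite 2!linearB linearZ /= dyy scaler0 subr0 cone_diff_sq subr0.
have [|g [gN gG gy]] := clear_components ac e1N e1G _ (aimed_le_ndist e1G); first by rewrite e1D.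
exists (- (e1 - cone_diff y g)).
by rewrite linearN /= -cone_diff_headed // linearB /= e1D cone_diff_sq subr0.
Qed.

End Target.

Lemma offdiag_exactS m : (forall y, target_exact y) -> offdiag_exact m -> offdiag_exact m.+1.
Proof.
move=> ex ac f fN fv f0.
have /fin_all_exists[g gE] : forall y, exists g : E, proj (headb (pred1 y)) f = codiff g.
  move=> y.
  have QI r s : ins1 r s -> headb (pred1 y) s = headb (pred1 y) r.
    exact: ins1_headb.
  apply: (@target_exact_headed y m) => //.
  - exact: (in_kernel_proj QI).
  - by move=> r; rewrite mcoeff_proj; case: ifP => _; [apply: fv|rewrite eqxx].
  - by move=> r; rewrite mcoeff_proj; case: ifP => //; rewrite eqxx.
  - by rewrite (codiff_proj _ QI) f0 linear0.
exists (\sum_y g y); rewrite linear_sum /=.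
under eq_bigr do rewrite -gE.
apply/malgP => r; rewrite raddf_sum /=.
under eq_bigr do rewrite mcoeff_proj.
have [rf|] := eqVneq f@_r 0.
  by rewrite rf big1 // => y _; rewrite if_same.
move/fv; case: r => // z r _.
by rewrite (bigD1 z) //= eqxx big1 ?addr0 // => y /negbTE; rewrite eq_sym => ->.
Qed.

Lemma offdiag_exact0 : offdiag_exact 0.
Proof.
move=> f _ fv _; exists 0; rewrite linear0; apply: (supported_eq0 fv) => r.
by rewrite ltn0 andbF.
Qed.

Theorem target_exactP : (forall y, target_exact y) <-> (forall m, offdiag_exact m).
Proof.
split=> [ex m|ac y]; last exact: offdiag_exact_target_exact.
by elim: m => [|m IH]; [apply: offdiag_exact0|apply: offdiag_exactS].
Qed.

End Comparison.

(** * Vertex idempotents and the Koszul element *)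
Section ArrowRing.
Variables (G : digraph) (R : pzRingType) (e : G -> R) (ar : G -> G -> R).
Implicit Types (x y z u v : G) (w : R).
Hypothesis eM : forall x y, e x * e y = if x == y then e x else 0.
Hypothesis ar_e : forall x v y, ar x v * e y = if v == y then ar x v else 0.
Hypothesis e_ar : forall x y v, e x * ar y v = if x == y then ar y v else 0.
Hypothesis ar0 : forall x v, ~~ arrow x v -> ar x v = 0.
Hypothesis sum_e : \sum_x e x = 1.

Definition koszul_step y : R := \sum_z \sum_(v | between y z v) ar z v.
(** The unit of homological degree n, for the target y. *)
Definition level n y : R := \sum_(x | dist x y == Some n) e x.

Lemma e_koszul_step_e x y v : e x * koszul_step y * e v = if between y x v then ar x v else 0.
Proof.
rewrite /koszul_step mulr_sumr (bigD1 x) //= [X in _ + X]big1 ?addr0; last first.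
  move=> z /negbTE zx; rewrite mulr_sumr big1 // => v' _.
  by rewrite e_ar eq_sym zx.
rewrite mulr_sumr mulr_suml.
under eq_bigr do rewrite e_ar eqxx ar_e.
rewrite -big_mkcondr /=; case: ifP => h.
  rewrite (bigD1 v) ?h ?eqxx //= big1 ?addr0 // => v' /andP[/andP[_ /eqP->]].
  by rewrite eqxx.
rewrite big_pred0 // => v'; apply/negP => /andP[h' /eqP vv'].
by rewrite vv' h in h'.
Qed.

Lemma sum_eM (P : pred G) x : (\sum_(z | P z) e z) * e x = if P x then e x else 0.
Proof.
rewrite mulr_suml; case: ifP => Px.
  rewrite (bigD1 x) ?Px //= eM eqxx big1 ?addr0 // => z /andP[_ /negbTE zx].
  by rewrite eM zx.
rewrite big1 // => z Pz; rewrite eM; case: eqP => // zx.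
by rewrite zx Px in Pz.
Qed.

Lemma level_e n x y : level n y * e x = if dist x y == Some n then e x else 0.
Proof. exact: sum_eM. Qed.

Lemma ring_eqP w w' : (forall x, w * e x = w' * e x) -> w = w'.
Proof.
move=> ww'; rewrite -[w]mulr1 -[w']mulr1 -sum_e !mulr_sumr.
exact: eq_bigr.
Qed.

Lemma ring_eqPl w w' : (forall x, e x * w = e x * w') -> w = w'.
Proof.
move=> ww'; rewrite -[w]mul1r -[w']mul1r -sum_e !mulr_suml.
exact: eq_bigr.
Qed.

Lemma e_level n x y : e x * level n y = if dist x y == Some n then e x else 0.
Proof.
apply: ring_eqP => z; rewrite -mulrA level_e.
have [->|zx] := eqVneq x z; first by case: ifP => _; rewrite ?mulr0 ?mul0r ?eM ?eqxx.
by case: ifP; case: ifP => _ _; rewrite ?mulr0 ?mul0r ?eM ?(negbTE zx).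
Qed.

(** An arrow of the Koszul element leads one step closer to y. *)
Lemma level_koszul_step n y : level n.+1 y * koszul_step y = koszul_step y * level n y.
Proof.
apply: ring_eqP => v; apply: ring_eqPl => x.
rewrite -[koszul_step y * _ * _]mulrA level_e.
have -> : e x * (level n.+1 y * koszul_step y * e v) =
   if dist x y == Some n.+1 then e x * koszul_step y * e v else 0.
  by rewrite !mulrA e_level; case: ifP; rewrite ?mul0r.
have -> : e x * (koszul_step y * (if dist v y == Some n then e v else 0)) =
   if dist v y == Some n then e x * koszul_step y * e v else 0.
  by case: ifP; rewrite ?mulrA ?mulr0.
rewrite e_koszul_step_e; have [h|] := boolP (between y x v); last by rewrite !if_same.
have [xv|/ar0->] := boolP (arrow x v); last by rewrite !if_same.
suff -> : (dist x y == Some n.+1) = (dist v y == Some n) by [].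
have xvE := between_ndist h; move: xv; rewrite arrowE => /andP[_ /eqP xv1].
have rxy := between_reach h; case/and4P: h => _ _ rvy _.
by apply/eqP/eqP => /distE[_ H]; apply/distE; split=> //; lia.
Qed.

Lemma e_koszul_step y : e y * koszul_step y = 0.
Proof. by apply: ring_eqP => v; rewrite mul0r e_koszul_step_e betweenxx. Qed.

Lemma level0 y : level 0 y = e y.
Proof.
rewrite /level (eq_bigl (pred1 y)) ?big_pred1_eq // => x.
apply/eqP/eqP=> [/distE[rxy rd]|->]; last exact: dist_xx.
by apply/eqP; rewrite -ndist_eq0 ?rd.
Qed.

Lemma level_reach n y : level n y * (\sum_(x | reach x y) e x) = level n y.
Proof.
apply: ring_eqP => x; rewrite -mulrA sum_eM level_e.
case: ifP => [_|rxy]; first exact: level_e.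
by rewrite mulr0; case: eqP => // /distE[]; rewrite rxy.
Qed.

Lemma sum_level y : exists m, \sum_(x | reach x y) e x = \sum_(n < m) level n y.
Proof.
pose m := (\max_x ndist x y).+1; exists m; apply: ring_eqP => x.
rewrite sum_eM mulr_suml.
under eq_bigr do rewrite level_e.
case rxy: (reach x y).
  have xm : (ndist x y < m)%N by rewrite ltnS; apply: (leq_bigmax x).
  have xE : dist x y = Some (ndist x y) by apply/distE.
  rewrite (bigD1 (Ordinal xm)) //= xE eqxx big1 ?addr0 // => i ix.
  case: eqP => // -[iE]; case/eqP: ix; exact/val_inj.
rewrite big1 // => i _; case: eqP => // /distE[]; by rewrite rxy.
Qed.

(** Only finitely many levels are nonzero, so that bounding an element level by
    level is enough. *)
Lemma sum_koszul_step (C : R -> Prop) w y : C 0 ->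
  w * (\sum_(x | reach x y) e x) = w ->
  (exists (a c : R), C c /\ w * level 0 y = a * koszul_step y + c) ->
  (forall n, exists a : R, w * level n.+1 y = a * koszul_step y) ->
  exists (a c : R), C c /\ w = a * koszul_step y + c.
Proof.
move=> C0 wf w0 wS; rewrite -wf; have [m ->] := sum_level y.
elim: m => [|[|n] IH].
- by exists 0, 0; rewrite big_ord0 mulr0 mul0r addr0.
- by rewrite big_ord_recl big_ord0 addr0.
have [a [c [Cc E]]] := IH; have [a' E'] := wS n.
exists (a + a'), c; split=> //.
by rewrite big_ord_recr /= mulrDr E E' mulrDl addrAC.
Qed.

End ArrowRing.

Lemma mul_swap (R : pzRingType) (w t l a l' : R) :
  t = w * l -> l * a = a * l' -> t * a = w * a * l'.
Proof. by move=> -> E; rewrite -mulrA E mulrA. Qed.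

Lemma mul_absorb (R : pzRingType) (w l f : R) : w * l = w -> l * f = l -> w * f = w.
Proof. by move=> wl lf; rewrite -wl -mulrA lf. Qed.

Lemma mul_vanish (R : pzRingType) (w l a : R) : w * l = w -> l * a = 0 -> w * a = 0.
Proof. by move=> wl la; rewrite -wl -mulrA la mulr0. Qed.

Lemma level_vanish (R : pzRingType) (w l a l' : R) :
  w * l = w -> l * a = a * l' -> w * a * l' = 0 -> w * a = 0.
Proof. by move=> wl la w0; rewrite -wl -mulrA la mulrA. Qed.

Lemma level_shift (R : pzRingType) (u l a l' w : R) :
  l * a = a * l' -> u * a * l' = w * l' -> w * l' = u * l * a.
Proof. by move=> E <-; rewrite -(mulrA u l) E mulrA. Qed.

Lemma level_shift_sub (R : pzRingType) (u l a l' w t : R) :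
  l * a = a * l' -> u * a * l' = (w - t) * l' -> t * l' = t ->
  w * l' = u * l * a + t.
Proof.
move=> E uE te; rewrite -(level_shift (w := w - t) E uE) mulrBl te.
by rewrite subrK.
Qed.

(** * The Koszul complex in terms of right multiplication *)
Section Resolution.
Variables (K : fieldType) (G : digraph).
Local Notation Om := (Omega K G).
Local Notation Opi := (Omega_pi K G).
Local Notation elt := (path_elt K).
Local Notation e := (@Omega_e K G).
Local Notation ar := (@Omega_arrow K G).
Implicit Types (x y z u v : G) (w : Om).

Lemma Oe_Oe x y : e x * e y = if x == y then e x else 0 :> Om.
Proof.
rewrite -rmorphM path_eltM /=; case: eqP => // _; exact: rmorph0.
Qed.

Lemma Oar_Oe x v y : ar x v * e y = if v == y then ar x v else 0.
Proof.
rewrite -rmorphM path_eltM /=; case: eqP => // _; exact: rmorph0.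
Qed.

Lemma Oe_Oar x y v : e x * ar y v = if x == y then ar y v else 0.
Proof.
rewrite -rmorphM path_eltM /=; case: eqP => [->|_] //; exact: rmorph0.
Qed.

Lemma Oar_eq0 x v : ~~ arrow x v -> ar x v = 0.
Proof.
move=> nxv; rewrite /Omega_arrow path_elt_eq0 ?rmorph0 //=.
by rewrite (negbTE nxv).
Qed.

Lemma sum_Oe : \sum_x e x = 1 :> Om.
Proof. by rewrite -rmorph_sum; apply: rmorph1. Qed.

Local Notation lev := (level e).
Local Notation stepO := (koszul_step ar).

Lemma Omega_reachE y : Omega_reach K y = \sum_(x | reach x y) e x.
Proof. exact: rmorph_sum. Qed.

Lemma Omega_stepE y : Omega_step K y = stepO y.
Proof.
by rewrite /Omega_step rmorph_sum; apply: eq_bigr => z _; apply: rmorph_sum.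
Qed.

Section Graded.
Variable n : nat.
Implicit Types (c : Kmod K G n) (i : dist_pair G n).

Lemma Kmod_of_subproof (w : G -> Om) :
  ([ffun i => w (val i).2 * e (val i).1] : Kfree K G n) \in @in_summands K G n.
Proof. by apply/in_summandsP => i; rewrite ffunE; exists (w (val i).2). Qed.

(** The coordinates used from here on: one element of Omega for each target,
    which collects the components of all summands with this target. *)
Definition Kmod_of (w : G -> Om) : Kmod K G n := KMod (Kmod_of_subproof w).

Lemma Kmod_ofE (w : G -> Om) i : K_val (Kmod_of w) i = w (val i).2 * e (val i).1.
Proof. by rewrite ffunE. Qed.

Definition Ktotal c y : Om := \sum_(i | (val i).2 == y) K_val c i.

Lemma K_val_e c i x : K_val c i * e x = if (val i).1 == x then K_val c i else 0 :> Om.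
Proof.
have /in_summandsP/(_ i)[w ->] := valP c.
by rewrite -mulrA Oe_Oe; case: eqP; rewrite ?mulr0.
Qed.

Lemma Kmod_eqP c c' : (forall i, K_val c i = K_val c' i) -> c = c'.
Proof. by move=> cc'; apply/val_inj/ffunP. Qed.

Lemma Kmod_of_total c : Kmod_of (Ktotal c) = c.
Proof.
apply: Kmod_eqP => i; rewrite Kmod_ofE /Ktotal mulr_suml (bigD1 i) //= K_val_e eqxx.
rewrite big1 ?addr0 // => j /andP[/eqP j2 ji]; rewrite K_val_e.
case: eqP => // j1; case/eqP: ji; apply: val_inj.
by rewrite [val j]surjective_pairing [val i]surjective_pairing j1 j2.
Qed.

Lemma Kmod_of_eq (w w' : G -> Om) :
  (forall x y, dist x y = Some n -> w y * e x = w' y * e x) -> Kmod_of w = Kmod_of w'.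
Proof.
move=> ww'; apply: Kmod_eqP => i; apply: etrans (Kmod_ofE w i) _.
apply: etrans (esym (Kmod_ofE w' i)); apply: ww'.
exact: eqP (valP i).
Qed.

Lemma Kmod_of_inj (w w' : G -> Om) x y : Kmod_of w = Kmod_of w' ->
  dist x y = Some n -> w y * e x = w' y * e x.
Proof.
move=> ww' /eqP xy; pose i : dist_pair G n := Sub (x, y) xy.
have := congr1 (fun c => K_val c i) ww'.
by move=> E; apply: etrans (esym (Kmod_ofE w i)) (etrans E (Kmod_ofE w' i)).
Qed.

Lemma Ktotal_level c y : Ktotal c y * lev n y = Ktotal c y.
Proof.
rewrite /Ktotal mulr_suml; apply: eq_bigr => i /eqP iy.
have /in_summandsP/(_ i)[w cE] := valP c; rewrite /= in cE; rewrite cE.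
rewrite -mulrA; apply: (congr1 (fun t => w * t)).
apply: etrans (e_level Oe_Oe sum_Oe n _ y) _.
by rewrite -iy ifT //; apply: (valP i).
Qed.

Lemma Ktotal_of (w : G -> Om) y : Ktotal (Kmod_of w) y = w y * lev n y.
Proof.
apply: etrans (esym (Ktotal_level _ _)) _; rewrite /level !mulr_sumr.
apply: eq_bigr => x /eqP xy; exact: Kmod_of_inj (Kmod_of_total (Kmod_of w)) xy.
Qed.

Lemma Kmod_of_level (w : G -> Om) : Kmod_of (fun y => w y * lev n y) = Kmod_of w.
Proof.
apply: Kmod_of_eq => x y xy; rewrite -mulrA; apply: (congr1 (fun t => w y * t)).
by apply: etrans (level_e Oe_Oe n x y) _; rewrite xy eqxx.
Qed.

End Graded.

Lemma K_valZ n w (c : Kmod K G n) i : K_val (w *: c) i = w * K_val c i.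
Proof. by rewrite linearZ ffunE. Qed.

Lemma K_val_sum n (I : Type) (r : seq I) (P : pred I) (F : I -> Kmod K G n) i :
  K_val (\sum_(j <- r | P j) F j) i = \sum_(j <- r | P j) K_val (F j) i.
Proof. by rewrite linear_sum sum_ffunE. Qed.

Lemma diff_kappaE n x y (j : dist_pair G n) :
  K_val (diff_kappa K n x y) j =
  if ((val j).2 == y) && (dist x (val j).1 == Some 1%N) then ar x (val j).1 else 0.
Proof.
rewrite /diff_kappa; apply: etrans (K_val_sum _ _ _ _) _.
set v := (val j).1; have jE : dist v (val j).2 = Some n by exact: eqP (valP j).
under eq_bigr do rewrite K_valZ ffunE.
have [yj|yj] /= := eqVneq (val j).2 y; last first.
  apply: big1 => u _; rewrite ifF ?mulr0 //; apply/eqP => jE'.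
  by case/eqP: yj; apply: (congr1 snd jE').
have [xv|xv] := eqVneq (dist x v) (Some 1%N); last first.
  apply: big1 => u /andP[xu _]; rewrite ifF ?mulr0 //; apply/eqP => jE'.
  by case/eqP: xv; rewrite /v (congr1 fst jE'); apply/eqP.
rewrite (bigD1 v) /=; last by rewrite xv -yj jE !eqxx.
rewrite big1 ?addr0 => [|u /andP[_ uv]]; last first.
  rewrite ifF ?mulr0 //; apply/eqP => jE'; by case/eqP: uv; apply: esym (congr1 fst jE').
rewrite ifT; last by rewrite -yj -surjective_pairing.
by apply: etrans (Oar_Oe _ _ _) _; rewrite eqxx.
Qed.

Lemma Kdiff_total n (c : Kmod K G n.+1) :
  Kdiff c = Kmod_of n (fun y => Ktotal c y * stepO y).
Proof.
apply: Kmod_eqP => j; apply: etrans (esym (Kmod_ofE _ _)).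
rewrite /Kdiff; apply: etrans (K_val_sum _ _ _ _) _.
have vy : dist (val j).1 (val j).2 = Some n by exact: eqP (valP j).
have dE x y := diff_kappaE x y j.
move: (val j).1 (val j).2 vy dE => v y vy dE.
rewrite /Ktotal !mulr_suml [RHS]big_mkcond; apply: eq_bigr => i _.
rewrite K_valZ dE eq_sym; have iE := eqP (valP i).
case: (eqVneq _ y) => [iy|_] /=; last by rewrite mulr0.
have ci : K_val c i = K_val c i * e (val i).1.
  by apply/esym; apply: etrans (K_val_e _ _ _) _; rewrite eqxx.
rewrite {2}ci -!mulrA; apply: (congr1 (fun t => K_val c i * t)); rewrite mulrA.
apply/esym; apply: etrans (e_koszul_step_e Oar_Oe Oe_Oar _ _ _) _.
rewrite iy in iE; set x := (val i).1 in iE *.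
have [/Oar_eq0->|xv] := boolP (~~ arrow x v); first by rewrite !if_same.
move: xv; rewrite negbK arrowE => /andP[rxv /eqP xv1].
have [[rxy dxy] [rvy dvy]] := ((distE x y n.+1).1 iE, (distE v y n).1 vy).
have -> : dist x v = Some 1%N by apply/distE.
rewrite eqxx ifT // /between rxv rvy xv1 dvy dxy add1n eqxx !andbT.
by rewrite eq_sym -ndist_gt0 // xv1.
Qed.

Lemma Kdiff_of n (w : G -> Om) :
  Kdiff (Kmod_of n.+1 w) = Kmod_of n (fun y => w y * stepO y).
Proof.
rewrite Kdiff_total -[RHS]Kmod_of_level; apply: Kmod_of_eq => v y _.
have E : lev n.+1 y * stepO y = stepO y * lev n y.
  exact: level_koszul_step Oe_Oe Oar_Oe Oe_Oar Oar_eq0 sum_Oe n y.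
have W : Ktotal (Kmod_of n.+1 w) y = w y * lev n.+1 y := Ktotal_of n.+1 w y.
exact: (congr1 (fun t => t * e v) (mul_swap W E)).
Qed.

Lemma Omega_deg0M w w' x :
  Omega_deg0 (w * w') x = Omega_deg0 w x * Omega_deg0 w' x.
Proof.
have E : w * w' = Opi (repr w * repr w').
  by rewrite [RHS](rmorphM Opi); apply: esym (congr2 _ (Omega_piK w) (Omega_piK w')).
by rewrite E Omega_deg0_pi deg0M.
Qed.

Lemma Omega_deg0_e c x : Omega_deg0 (Opi (c *: elt x [::])) x = c.
Proof. by rewrite Omega_deg0_pi ffunE mcoeffZ mcoeff_path_elt eqxx mulr1. Qed.

Lemma Omega_deg0D w w' x :
  Omega_deg0 (w + w') x = Omega_deg0 w x + Omega_deg0 w' x.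
Proof.
have E : w + w' = Opi (repr w + repr w').
  by rewrite [RHS](rmorphD Opi); apply: esym (congr2 _ (Omega_piK w) (Omega_piK w')).
by rewrite E Omega_deg0_pi deg0D ffunE.
Qed.

Lemma Omega_deg0_0 x : Omega_deg0 (0 : Om) x = 0.
Proof.
by rewrite (esym (rmorph0 Opi) : 0 = Opi 0) Omega_deg0_pi raddf0 ffunE.
Qed.

Lemma Omega_deg0_step y x : Omega_deg0 (stepO y) x = 0.
Proof.
rewrite -Omega_stepE Omega_deg0_pi /arrow_sum raddf_sum sum_ffunE; apply: big1 => z _.
rewrite raddf_sum sum_ffunE; apply: big1 => v _.
by rewrite ffunE mcoeff_path_elt xpair_eqE andbF.
Qed.

Lemma KaugE (w : G -> Om) y : Kaug (Kmod_of 0 w) y = Omega_deg0 (w y) y.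
Proof.
have /eqP yy := dist_xx y; pose i0 : dist_pair G 0 := Sub (y, y) yy.
rewrite /Kaug sum_ffunE (bigD1 i0) //= big1 ?addr0.
  rewrite ffunE [S_e _ _ _]ffunE eqxx mulr1.
  have E : K_val (Kmod_of 0 w) i0 = w y * e y := Kmod_ofE w i0.
  rewrite E Omega_deg0M -[X in _ * X = _](_ : 1 = _) ?mulr1 //.
  by rewrite /Omega_e -(scale1r (elt y [::])) Omega_deg0_e.
move=> i ii0; rewrite ffunE [S_e _ _ _]ffunE; case: eqP => [yi|]; last by rewrite mulr0.
have /distE[r d] := eqP (valP i); have := ndist_eq0 r; rewrite d eqxx => /esym/eqP E.
case/eqP: ii0; apply: val_inj; apply: etrans (surjective_pairing _) _.
by rewrite /= yi; apply: (congr1 (pair _)); apply: esym E.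
Qed.

Lemma Kaug_surj s : exists c : Kmod K G 0, Kaug c = s.
Proof.
exists (Kmod_of 0 (fun x => Opi (s x *: elt x [::]))).
by apply/ffunP => x; apply: etrans (KaugE _ _) (Omega_deg0_e _ _).
Qed.

Lemma target_exactE y : target_exact K y <-> forall w,
  w * (\sum_(x | reach x y) e x) = w -> w * stepO y = 0 ->
  exists (u : Om) (c : K), w = u * stepO y + Opi (c *: elt y [::]).
Proof. by rewrite /target_exact Omega_reachE Omega_stepE. Qed.

(** The image in Omega of [cone_diff_sq], at a lift of 1. *)
Lemma stepO_sq y : stepO y * stepO y = 0.
Proof.
have E : to_Omega (path_lift (1 : path_alg K G)) = 1 by rewrite /to_Omega path_part_lift; apply: rmorph1.
have := congr1 (@to_Omega K G) (cone_diff_sq y (path_lift 1)); rewrite !to_Omega_cone_diff E mul1r.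
have -> : to_Omega (0 : {malg K[seq G]}) = 0.
  by apply/to_Omega_eq0; rewrite /in_kernel linear0 rpred0.
by rewrite Omega_stepE.
Qed.

Definition at_target y w : G -> Om := fun y' => if y' == y then w else 0.

Lemma Kmod_of_eq_level n (w w' : G -> Om) : Kmod_of n w = Kmod_of n w' ->
  forall y, w y * lev n y = w' y * lev n y.
Proof.
move=> E y; rewrite /level !mulr_sumr; apply: eq_bigr => x /eqP xy.
exact: Kmod_of_inj E xy.
Qed.

Lemma Kmod_of0 n : Kmod_of n (fun=> 0) = 0.
Proof. by apply: Kmod_eqP => i; apply: etrans (Kmod_ofE _ _) _; rewrite mul0r linear0 ffunE. Qed.

(** Each level of a cycle is a cycle of the complex; at level 0 a multiple of
    e_y is subtracted first, to be in the kernel of the augmentation. *)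
Lemma resolution_target_exact y : is_resolution K G -> target_exact K y.
Proof.
case=> _ ex0 exS; apply/target_exactE => w wf wa.
pose C (t : Om) := exists k : K, t = Opi (k *: elt y [::]).
have C0 : C 0 by exists 0; rewrite scale0r; apply: esym (rmorph0 Opi).
have w0 : exists (a c : Om), C c /\ w * lev 0 y = a * stepO y + c.
  pose k := Omega_deg0 w y; pose t := Opi (k *: elt y [::]).
  have aug0 : Kaug (Kmod_of 0 (at_target y (w - t))) = 0.
    apply/ffunP => y'; apply: etrans (KaugE _ _) _; rewrite [RHS]ffunE /at_target.
    case: eqP => [->|_]; last exact: Omega_deg0_0.
    apply: (addIr (Omega_deg0 t y)); rewrite -Omega_deg0D subrK add0r.
    by rewrite Omega_deg0_e.
  have [c cE] := (ex0 _).1 aug0.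
  rewrite -[c]Kmod_of_total Kdiff_of in cE; have := Kmod_of_eq_level cE y.
  rewrite /at_target eqxx; set u := Ktotal c y => uE.
  exists (u * lev 1 y), t; split; first by exists k.
  have te : t * lev 0 y = t.
    rewrite level0 /t -rmorphM -path_alg_scalerAl path_eltM /= eqxx.
    by [].
  have E : lev 1 y * stepO y = stepO y * lev 0 y.
    exact: level_koszul_step Oe_Oe Oar_Oe Oe_Oar Oar_eq0 sum_Oe 0 y.
  exact: level_shift_sub E uE te.
have wS n : exists a : Om, w * lev n.+1 y = a * stepO y.
  have Kw0 : Kdiff (Kmod_of n.+1 (at_target y w)) = 0.
    rewrite Kdiff_of -(Kmod_of0 n); apply: Kmod_of_eq => x y' _; rewrite /at_target.
    case: eqP => [->|_]; first exact: (congr1 (fun t => t * e x) wa).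
    exact: (congr1 (fun t => t * e x) (mul0r (stepO y'))).
  have [c cE] := (exS _ _).1 Kw0.
  rewrite -[c]Kmod_of_total Kdiff_of in cE; have := Kmod_of_eq_level cE y.
  rewrite /at_target eqxx; set u := Ktotal c y => uE.
  exists (u * lev n.+2 y).
  have E : lev n.+2 y * stepO y = stepO y * lev n.+1 y.
    exact: level_koszul_step Oe_Oe Oar_Oe Oe_Oar Oar_eq0 sum_Oe n.+1 y.
  exact: level_shift E uE.
have [a [c [[k ->] wE]]] := sum_koszul_step Oe_Oe sum_Oe C0 wf w0 wS.
by exists a, k.
Qed.

Lemma Kdiff_Kdiff n (c : Kmod K G n.+2) : Kdiff (Kdiff c) = 0.
Proof.
rewrite -[c]Kmod_of_total 2!Kdiff_of -(Kmod_of0 n); apply: Kmod_of_eq => x y _.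
apply: (congr1 (fun t => t * e x)); apply: etrans (esym (mulrA _ _ _)) _.
exact: etrans (congr1 (fun t => _ * t) (stepO_sq y)) (mulr0 _).
Qed.

Lemma Kaug_Kdiff (c : Kmod K G 1) : Kaug (Kdiff c) = 0.
Proof.
rewrite -[c]Kmod_of_total Kdiff_of; apply/ffunP => y; apply: etrans (KaugE _ _) _.
by rewrite [RHS]ffunE Omega_deg0M Omega_deg0_step mulr0.
Qed.

Lemma target_exact_level n y w : target_exact K y -> w * lev n y = w -> w * stepO y = 0 ->
  exists (u : Om) (c : K), w = u * stepO y + Opi (c *: elt y [::]).
Proof.
move=> /target_exactE ex wl wa; apply: (ex w _ wa).
exact: mul_absorb wl (level_reach Oe_Oe sum_Oe n y).
Qed.

Lemma vertex_e c y x : x != y -> Opi (c *: elt y [::]) * e x = 0.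
Proof.
move=> /negbTE xy; rewrite -rmorphM -path_alg_scalerAl path_eltM /= eq_sym xy.
by rewrite scaler0; apply: rmorph0.
Qed.

Lemma target_exact_resolution : (forall y, target_exact K y) -> is_resolution K G.
Proof.
move=> ex; split; first exact: Kaug_surj.
  move=> b; split=> [b0|[c <-]]; last exact: Kaug_Kdiff.
  have bw y : exists u : Om, Ktotal b y = u * stepO y.
    have wl : Ktotal b y * lev 0 y = Ktotal b y := Ktotal_level b y.
    have wa : Ktotal b y * stepO y = 0.
      apply: mul_vanish wl _; apply: etrans (e_koszul_step Oar_Oe Oe_Oar sum_Oe y).
      exact: (congr1 (fun t => t * stepO y) (level0 e y)).
    have [u [c E]] := target_exact_level (ex y) wl wa; exists u; rewrite E.
    have : Kaug (Kmod_of 0 (Ktotal b)) y = 0 by rewrite Kmod_of_total b0 ffunE.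
    rewrite KaugE E Omega_deg0D Omega_deg0M Omega_deg0_step mulr0 add0r.
    rewrite Omega_deg0_e => ->; rewrite scale0r.
    exact: etrans (congr1 (fun t => _ + t) (rmorph0 Opi)) (addr0 _).
  have [u uE] := fin_all_exists bw.
  exists (Kmod_of 1 u); rewrite Kdiff_of -[RHS]Kmod_of_total; apply: Kmod_of_eq => x y _.
  exact: (congr1 (fun t => t * e x) (esym (uE y))).
move=> n b; split=> [b0|[c <-]]; last exact: Kdiff_Kdiff.
have bw y : exists (u : Om) (c : K), Ktotal b y = u * stepO y + Opi (c *: elt y [::]).
  have wl : Ktotal b y * lev n.+1 y = Ktotal b y := Ktotal_level b y.
  apply: (target_exact_level (ex y) wl).
  have E : lev n.+1 y * stepO y = stepO y * lev n y.
    exact: level_koszul_step Oe_Oe Oar_Oe Oe_Oar Oar_eq0 sum_Oe n y.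
  have b0' : Kmod_of n (fun y => Ktotal b y * stepO y) = Kmod_of n (fun=> 0).
    by rewrite -Kdiff_total b0 Kmod_of0.
  apply: level_vanish wl E _.
  exact: etrans (Kmod_of_eq_level b0' y) (mul0r _).
have [u uE] := fin_all_exists bw; exists (Kmod_of n.+2 u).
rewrite Kdiff_of -[RHS]Kmod_of_total; apply: Kmod_of_eq => x y xy.
have [c E] := uE y.
apply: etrans (esym (congr1 (fun t => t * e x) E)); rewrite mulrDl.
rewrite vertex_e ?addr0 //; apply/eqP => xyE.
by rewrite xyE dist_xx in xy.
Qed.

Theorem resolutionP : is_resolution K G <-> (forall m, @offdiag_exact K G m).
Proof.
by rewrite -target_exactP; split=> [res y|]; [apply: resolution_target_exact|apply: target_exact_resolution].
Qed.

End Resolution.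

(** * Exactness over the integers and over fields *)
Section Coefficients.

(** Exactness at the middle term, for chains over the integers (columns) and for
    cochains over a field (rows). *)
Definition col_exact (a b c : nat) (A : 'M[int]_(a, b)) (B : 'M[int]_(b, c)) :=
  forall v : 'cV_b, A *m v = 0 -> exists w : 'cV_c, v = B *m w.

Definition row_exact (K : fieldType) (a b c : nat) (A : 'M[int]_(a, b)) (B : 'M[int]_(b, c)) :=
  forall v : 'rV[K]_b, v *m map_mx intr B = 0 ->
    exists w : 'rV_a, v = w *m map_mx intr A.

Lemma col_exact_mx a b c (A : 'M[int]_(a, b)) (B : 'M_(b, c)) k (V : 'M_(b, k)) :
  col_exact A B -> A *m V = 0 -> exists W : 'M_(c, k), V = B *m W.
Proof.
move=> ex AV0.
have cV j : exists w : 'cV_c, col j V = B *m w.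
  by apply: ex; rewrite colE mulmxA AV0 mul0mx.
have [w wE] := fin_all_exists cV.
exists (\matrix_(i, j) w j i 0); apply/matrixP => i j.
have /matrixP/(_ i 0) := wE j; rewrite !mxE => ->.
by apply: eq_bigr => k' _; rewrite mxE.
Qed.

Section Homotopy.
Variables (d : nat -> nat) (A : forall n, 'M[int]_(d n, d n.+1)) (l : nat).
Hypothesis AA : forall n, A n *m A n.+1 = 0.
Hypothesis d0 : d 0 = 0%N.
Hypothesis ex : forall n, (n.+1 < l)%N -> col_exact (A n) (A n.+1).

(** From 1 = X A_n + A_(n+1) Y, the columns of 1 - Y A_(n+1) are cycles in the
    next degree; bounding them one by one gives the next homotopy. *)
Lemma contracting_homotopy n : (n.+1 < l)%N ->
  exists X Y, 1%:M = X *m A n + A n.+1 *m Y.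
Proof.
elim: n => [|n IH] nl.
  have [|Y YE] := @col_exact_mx _ _ _ _ _ _ 1%:M (ex nl).
    by apply/matrixP => i; have := ltn_ord i; rewrite {2}d0.
  by exists 0, Y; rewrite mul0mx add0r.
have [X [Y E]] := IH (ltnW nl).
have [|Z ZE] := @col_exact_mx _ _ _ _ _ _ (1%:M - Y *m A n.+1) (ex nl).
  have YE : A n.+1 *m Y = 1%:M - X *m A n by rewrite E addrC addKr.
  by rewrite mulmxBr mulmxA YE mulmxBl mulmx1 mul1mx -mulmxA AA mulmx0 subr0 subrr.
by exists Y, Z; rewrite -ZE addrC subrK.
Qed.

(** Homotopies, unlike exactness, pass to transposes and to other coefficients. *)
Lemma homotopy_row_exact (K : fieldType) n : (n.+1 < l)%N ->
  row_exact K (A n) (A n.+1).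
Proof.
move=> nl v vB; have [X [Y /(congr1 (map_mx (intr : int -> K)))]] := contracting_homotopy nl.
rewrite map_mx1 map_mxD !map_mxM => E.
exists (v *m map_mx intr X); rewrite -[LHS]mulmx1 E mulmxDr !mulmxA vB mul0mx.
by rewrite addr0.
Qed.

End Homotopy.

Section FieldsToIntegers.
Variables (a b c : nat) (A : 'M[int]_(a, b)) (B : 'M[int]_(b, c)).

Lemma row_exact_split (K : fieldType) : row_exact K A B ->
  exists X Y, 1%:M = X *m map_mx intr A + map_mx intr B *m Y :> 'M[K]_b.
Proof.
move=> ex; set Bk := map_mx intr B; set Ak := map_mx intr A.
exists ((1%:M - Bk *m pinvmx Bk) *m pinvmx Ak), (pinvmx Bk).
rewrite mulmxKpV ?subrK //; apply/row_subP => i.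
have [|w ->] := ex (row i (1%:M - Bk *m pinvmx Bk)); last exact: submxMl.
by rewrite -row_mul mulmxBl mul1mx mulmxKpV // subrr row0.
Qed.

Hypothesis AB : A *m B = 0.
Hypothesis ex : forall K : fieldType, row_exact K A B.

(** The cycle bounds modulo p, and p times a vector is a cycle only if the
    vector is. *)
Lemma prime_step p (v : 'cV[int]_b) : prime p -> A *m v = 0 ->
  exists w v', [/\ v = B *m w + p%:Z *: v' & A *m v' = 0].
Proof.
move=> pr_p Av0.
have [X [Y E]] := row_exact_split (@ex 'F_p).
have toF n : exists m : int, m%:~R = n :> 'F_p.
  by exists (n : nat)%:Z; rewrite -[LHS]/((n : nat)%:R) natr_Zp.
have Av0p : map_mx intr A *m map_mx intr v = 0 :> 'cV['F_p]_a.
  by rewrite -map_mxM Av0 map_mx0.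
pose y := Y *m map_mx intr v.
have vE : map_mx intr v = map_mx intr B *m y :> 'cV['F_p]_b.
  by rewrite -[LHS]mul1mx E mulmxDl -!mulmxA Av0p mulmx0 add0r.
have [w wE] := fin_all_exists (fun i => toF (y i 0)).
pose W : 'cV[int]_c := \col_i w i.
have WE : map_mx intr W = y.
  by apply/matrixP => i j; rewrite mxE [W i j]mxE wE ord1.
have dvd i : (p %| (v - B *m W) i ord0)%Z.
  rewrite (dvdz_pcharf (pchar_Fp pr_p)).
  have /matrixP/(_ i 0) : map_mx intr (v - B *m W) = 0 :> 'cV['F_p]_b.
    by rewrite map_mxB map_mxM WE vE subrr.
  by rewrite !mxE => ->.
pose v' : 'cV[int]_b := \col_i ((v - B *m W) i ord0 %/ p)%Z.
have v'E : v = B *m W + p%:Z *: v'.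
  apply/matrixP => i j; rewrite ord1 mxE [(p%:Z *: v') i 0]mxE [v' i 0]mxE mulrC.
  by rewrite divzK // !mxE addrC subrK.
exists W, v'; split=> //.
have : p%:Z *: (A *m v') = 0.
  have pv' : p%:Z *: v' = v - B *m W by rewrite {1}v'E addrC addKr.
  by rewrite scalemxAr pv' mulmxBr Av0 mulmxA AB mul0mx subrr.
move/matrixP=> pAv'; apply/matrixP => i j; have /eqP := pAv' i j.
rewrite !mxE mulf_eq0 => /orP[|/eqP//].
by rewrite eqz_nat => /eqP p0; rewrite p0 in pr_p.
Qed.

Lemma nat_step n (v : 'cV[int]_b) : (0 < n)%N -> A *m v = 0 ->
  exists w v', v = B *m w + n%:Z *: v' /\ A *m v' = 0.
Proof.
elim/ltn_ind: n v => n IH v n0 Av0; have [n1|n1] := leqP n 1.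
  have -> : n = 1%N by apply/eqP; rewrite eqn_leq n1.
  by exists 0, v; rewrite mulmx0 add0r scale1r.
have pr_p := pdiv_prime n1; set p := pdiv n in pr_p.
have nE : (n = n %/ p * p)%N by rewrite divnK // pdiv_dvd.
have np : (0 < n %/ p < n)%N.
  by rewrite divn_gt0 ?prime_gt0 // pdiv_leq //= ltn_Pdiv ?prime_gt1.
have [w [v' [vE Av'0]]] := prime_step pr_p Av0.
case/andP: np => np0 npn; have [w' [v'' [v'E Av''0]]] := IH _ npn v' np0 Av'0.
exists (w + p%:Z *: w'), v''; split=> //.
by rewrite vE v'E scalerDr scalemxAr scalerA -PoszM mulnC -nE mulmxDr addrA.
Qed.

Lemma clear_denominators m n (Y : 'M[rat]_(m, n)) :
  exists (N : nat) (Z : 'M[int]_(m, n)), (0 < N)%N /\ map_mx intr Z = N%:R *: Y.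
Proof.
pose N := \prod_i \prod_j `|denq (Y i j)|%N.
have N0 : (0 < N)%N.
  by apply: prodn_gt0 => i; apply: prodn_gt0 => j; rewrite absz_gt0 denq_neq0.
have dN i j : (`|denq (Y i j)| %| N)%N.
  rewrite /N (bigD1 i) //=; apply: dvdn_mulr.
  by rewrite (bigD1 j) //=; apply: dvdn_mulr.
have Nij i j : exists z : int, z%:~R = N%:R * Y i j.
  have /dvdnP[k ->] := dN i j; exists (k%:Z * numq (Y i j)).
  rewrite rmorphM /= numqE natrM -mulrA [_ * Y i j]mulrC; congr (_ * (_ * _)).
  by rewrite -[RHS]/((Posz `|denq (Y i j)|%N)%:~R) absz_denq.
have [f fE] := fin_all_exists (fun i => fin_all_exists (Nij i)).
exists N, (\matrix_(i, j) f i j); split=> //.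
by apply/matrixP => i j; rewrite !mxE fE.
Qed.

(** Over the rationals there is one N > 0 such that N u bounds for each cycle u.
    Every cycle is, up to a boundary, N times a cycle: by [prime_step] for the
    prime factors of N. *)
Theorem row_exact_col_exact : col_exact A B.
Proof.
move=> v Av0.
have [X [Y E]] := row_exact_split (@ex rat).
have [N [Z [N0 ZE]]] := clear_denominators Y.
have key (u : 'cV[int]_b) : A *m u = 0 -> N%:Z *: u = B *m (Z *m u).
  move=> Au0; have inj : injective (map_mx (intr : int -> rat) : 'cV_b -> 'cV_b).
    by move=> s t /matrixP st; apply/matrixP => i j; have := st i j; rewrite !mxE => /intr_inj.
  apply: inj; rewrite map_mxZ !map_mxM /= ZE -scalemxAl -scalemxAr.
  congr (_ *: _); rewrite -[LHS]mul1mx E mulmxDl -!mulmxA -map_mxM Au0.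
  by rewrite map_mx0 mulmx0 add0r.
have [w [v' [-> Av'0]]] := nat_step N0 Av0.
by exists (w + Z *m v'); rewrite mulmxDr key.
Qed.

End FieldsToIntegers.
End Coefficients.

(** * The matrix of the codifferential *)
Section Deletion.
Variable G : digraph.
Implicit Types (r s t : seq G) (x y z u v : G).

Definition delete_nth i t := take i t ++ drop i.+1 t.

(** The coefficient of s in the differential of t, up to the overall sign. The
    head is never deleted, as this would lower the norm. *)
Definition deletion_coef t s : int :=
  \sum_(j < (size t).-1) (-1) ^+ j *+ (delete_nth j.+1 t == s).

Lemma deletion_coef_cons x' v t x r : deletion_coef [:: x', v & t] (x :: r) =
  if x' == x then (t == r)%:R - deletion_coef (v :: t) r else 0.
Proof.
rewrite /deletion_coef /=; case: (eqVneq x' x) => [<-|xx]; last first.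
  by rewrite big1 // => j _; rewrite eqseq_cons (negbTE xx).
rewrite big_ord_recl /= eqseq_cons eqxx /= drop0 expr0; congr (_ + _).
rewrite -sumrN; apply: eq_bigr => j _.
by rewrite eqseq_cons eqxx /= /bump /= add1n exprS mulN1r mulNrn.
Qed.

Lemma deletion_coef_head0 v t r : ~~ headb (pred1 v) r -> deletion_coef (v :: t) r = 0.
Proof.
move=> hr; apply: big1 => j _; case: eqP => // E; case/negP: hr.
by rewrite -E /=.
Qed.

Variable K : fieldType.

Lemma mcoeff_prepend x' x r (f : {malg K[seq G]}) :
  (prepend x' f)@_(x :: r) = if x' == x then f@_r else 0.
Proof.
elim/malg_ind: f => [|c s f IH]; first by rewrite linear0 !mcoeff0 if_same.
rewrite prependL !mcoeffD !mcoeffZ IH !mcoeffU eqseq_cons.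
by case: eqP; rewrite ?addr0 ?mulr0.
Qed.

Lemma mcoeff_ins (P : G -> G -> bool) z r v t :
  (ins K P (z :: r))@_(v :: t) = (P z v && (t == z :: r))%:R.
Proof.
rewrite /ins raddf_sum /=; under eq_bigr do rewrite mcoeffU eqseq_cons.
rewrite [t == _]eq_sym; have [Pzv|Pzv] /= := boolP (P z v).
  rewrite (bigD1 v) //= eqxx big1 ?addr0 // => u /andP[_ /negbTE ->].
  by rewrite mulr0n.
rewrite big1 // => u Pzu; case: eqP => // uv; by rewrite uv (negbTE Pzv) in Pzu.
Qed.

Lemma codiff_seq_head0 v t r : ~~ headb (pred1 v) r -> (codiff_seq K r)@_(v :: t) = 0.
Proof.
move=> hr; apply/eqP/negPn/negP => /supp_codiff_seq rs.
by rewrite -(ins1_headb (pred1 v) rs) /= eqxx in hr.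
Qed.

Lemma natrz_K (b : bool) : (b%:R : int)%:~R = b%:R :> K.
Proof. by case: b. Qed.

(** Equality of norms makes the deleted entry lie between its neighbours, so
    that the deletion is undone by an insertion. *)
Lemma mcoeff_codiff_seq s t : valid s -> valid t -> rnorm t = rnorm s ->
  (codiff_seq K s)@_t = (deletion_coef t s)%:~R.
Proof.
elim: s t => [|x r IH] // [|x' [|v t]] // vs vt nE.
  rewrite /deletion_coef big_ord0; apply/eqP/negPn/negP => /supp_codiff_seq/ins1_size.
  by [].
have -> : codiff_seq K (x :: r) = prepend x (ins K (sbetween x) r - codiff_seq K r) by [].
rewrite deletion_coef_cons mcoeff_prepend eq_sym.
have [xx|_] := eqVneq x' x; last by [].
rewrite {x'}xx in vt nE *; case: r vs nE IH => [|z r] vs nE IH.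
  move: vt nE; rewrite valid_cons2 rnorm_cons2 gap_ndist => /andP[/andP[_ g] _].
  by move=> E; move: g; rewrite -[rnorm [:: x]]/0%N in E; lia.
move: vt vs nE; rewrite !valid_cons2 !rnorm_cons2.
case/andP=> gxv vt /andP[gxz vs] nE; rewrite mcoeffB mcoeff_ins intrB natrz_K.
have [vz|vz] := eqVneq v z; last first.
  rewrite codiff_seq_head0 ?deletion_coef_head0 ?subr0 /=; try by rewrite eq_sym.
  have [tE|] := eqVneq t (z :: r); last by rewrite andbF.
  rewrite andbT; suff -> : sbetween x z v by [].
  move: vt nE; rewrite tE valid_cons2 rnorm_cons2 => /andP[/andP[_ rzv] _] nE.
  case/andP: gxv => vx rvx; rewrite /sbetween /between vx vz rzv rvx /=.
  by apply/eqP; lia.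
rewrite {v}vz in vt nE gxv *.
have -> : sbetween x z z = false by rewrite /sbetween /between eqxx andbF.
have -> : (t == z :: r) = false.
  by apply/eqP => tE; move: vt; rewrite tE valid_cons2 /gap eqxx.
rewrite !sub0r IH // ?rmorphN //.
by lia.
Qed.

End Deletion.

Section Cells.
Variable G : digraph.
Implicit Types (r s t : seq G) (x y z u v : G).

Lemma norm_rcons s z x :
  norm (rcons (rcons s z) x) = oaddn (norm (rcons s z)) (dist z x).
Proof.
have oaddnA : associative oaddn.
  by case=> [m|] [n|] [p|] //; rewrite /oaddn addnA.
have foldrE a (ns : seq (option nat)) :
    foldr oaddn a ns = oaddn (foldr oaddn (Some 0%N) ns) a.
  by elim: ns => [|n ns IH] /=; [case: a|rewrite IH oaddnA].
case: s => [|y s] /=; first by case: (dist z x) => // n; rewrite /oaddn addn0.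
rewrite -!cats1 pairmap_cat foldr_cat foldrE /= last_cat /=; congr oaddn.
by case: (dist z x) => // n; rewrite /oaddn addn0.
Qed.

Lemma norm_rev r : norm (rev r) =
  if sorted (fun x z => reach z x) r then Some (rnorm r) else None.
Proof.
elim: r => // x [|z r] IH //.
rewrite rev_cons [rev (z :: r)]rev_cons norm_rcons -rev_cons IH rnorm_cons2.
rewrite [sorted _ [:: x, z & r]]/= -/(sorted (fun x z => reach z x) (z :: r)).
case: ifP => //= _; rewrite ?andbF // andbT /reach /ndist.
  by case: (dist z x) => // n; rewrite /oaddn addnC.
Qed.

Lemma valid_rev r l : r != [::] ->
  sorted [rel x y | x != y] (rev r) && (norm (rev r) == Some l) =
  valid r && (rnorm r == l).
Proof.
move=> r0; rewrite norm_rev rev_sorted /valid r0 /=.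
have -> : sorted (@gap G) r =
  sorted (fun x z => z != x) r && sorted (fun x z => reach z x) r.
  case: r {r0} => //= x r; elim: r x => //= z r IH x; rewrite IH /gap.
  by rewrite !andbA; congr (_ && _); rewrite andbAC.
case: (sorted (fun x z => reach z x) r) => //=; last by rewrite !andbF.
by rewrite andbT.
Qed.

Variables (n l : nat).
Definition rev_gen (t : mag_gen G n l) : seq G := rev (val (val t)).

Lemma rev_gen_spec (t : mag_gen G n l) : [/\ valid (rev_gen t), rnorm (rev_gen t) = l & size (rev_gen t) = n.+1].
Proof.
have r0 : rev_gen t != [::] by rewrite -size_eq0 size_rev size_tuple.
have := valP t; rewrite -[val (val t)]revK valid_rev // => /andP[-> /eqP->].
by rewrite size_rev size_tuple.
Qed.

Lemma rev_gen_inj : injective rev_gen.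
Proof. by move=> t t' /(can_inj revK) tt'; apply/val_inj/val_inj. Qed.

Definition cell (m k : nat) s := [&& valid s, rnorm s == k & size s == m.+1].

Lemma rev_gen_cell (t : mag_gen G n l) : cell n l (rev_gen t).
Proof. by rewrite /cell; have [-> -> ->] := rev_gen_spec t; rewrite !eqxx. Qed.

Lemma cell_rev_gen s : cell n l s -> exists t : mag_gen G n l, rev_gen t = s.
Proof.
case/and3P=> vs ns /eqP ss; have sz : size (rev s) == n.+1 by rewrite size_rev ss.
have ok : sorted [rel x y | x != y] (Tuple sz) && (norm (Tuple sz) == Some l).
  by rewrite valid_rev ?vs //; case/andP: vs.
by exists (Sub (Tuple sz) ok); rewrite /rev_gen SubK /= revK.
Qed.

Variable K : fieldType.

Lemma cell_expand (f : {malg K[seq G]}) : supported (cell n l) f ->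
  f = \sum_(t : mag_gen G n l) f@_(rev_gen t) *: << rev_gen t >>.
Proof.
move=> fc; apply/malgP => s; rewrite raddf_sum /=.
under eq_bigr do rewrite mcoeffZ mcoeffU.
have [fs|/fc/cell_rev_gen[t <-]] := eqVneq f@_s 0.
  rewrite fs big1 // => t _; case: eqP => [->|_]; last by rewrite mulr0.
  by rewrite fs mul0r.
rewrite (bigD1 t) //= eqxx mulr1 big1 ?addr0 // => t' /negbTE tt'.
by rewrite (inj_eq rev_gen_inj) tt' mulr0.
Qed.

End Cells.

(** * Magnitude chains and matrices *)
Section Chains.
Variable G : digraph.

Lemma delete_nthE n (i : 'I_n.+2) (t : n.+2.-tuple G) :
  delete i t = delete_nth i t :> seq G.
Proof.
have x0 := tnth t i; apply: (@eq_from_nth _ x0).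
  rewrite size_tuple /delete_nth size_cat size_takel ?size_drop size_tuple; last first.
    by rewrite ltnW.
  by have := ltn_ord i; lia.
rewrite size_tuple => j jn; rewrite -[j]/(val (Ordinal jn)) -tnth_nth tnth_mktuple.
rewrite (tnth_nth x0) /= /delete_nth nth_cat size_takel ?size_tuple; last by rewrite ltnW.
rewrite /bump; case: ltnP => ij.
  by rewrite nth_take.
by rewrite nth_drop; congr nth; lia.
Qed.

Lemma rev_delete_nth i (t : seq G) : (i < size t)%N ->
  rev (delete_nth i t) = delete_nth ((size t).-1 - i) (rev t).
Proof.
move=> it; rewrite /delete_nth rev_cat take_rev drop_rev; congr (rev _ ++ rev _).
  by congr drop; lia.
by congr take; lia.
Qed.

Lemma mag_face_val n l (i : 'I_n.+2) (t : mag_gen G n.+1 l) (s : mag_gen G n l) :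
  (mag_face i t : {ffun _ -> int}) s = (delete_nth i (val (val t)) == val (val s))%:R.
Proof.
rewrite /mag_face; case: insubP => [s' _ s'E|nv].
  by rewrite ffunE -val_eqE s'E -val_eqE /= delete_nthE eq_sym.
rewrite ffunE; case: eqP => // E; case/negP: nv.
by rewrite (_ : delete i (val t) = val s) ?(valP s) //; apply/val_inj; rewrite /= delete_nthE.
Qed.

(** The overall sign comes from reversing the tuples. *)
Lemma mag_diff_coef n l (c : MC G n.+1 l) (s : mag_gen G n l) :
  (mag_diffS c : {ffun _ -> int}) s =
  (-1) ^+ n * \sum_t deletion_coef (rev_gen t) (rev_gen s) * c t.
Proof.
have ffunMz (f : {ffun mag_gen G n l -> int}) k u : (f *~ k) u = f u * k.
  case: k => m; rewrite ?NegzE ?mulrNz -pmulrn ?ffunE ffunMnE -mulr_natr natz //.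
  by rewrite mulrN.
rewrite /mag_diffS sum_ffunE mulr_sumr; apply: eq_bigr => t _.
rewrite ffunMz mulrA; congr (_ * _); rewrite sum_ffunE.
under eq_bigr do rewrite ffunMz mag_face_val -(inj_eq (can_inj revK)).
have st : size (val (val t)) = n.+2 by rewrite size_tuple.
have st' : size (rev_gen t) = n.+2 by rewrite size_rev.
rewrite (reindex_inj rev_ord_inj) /= big_ord_recl /= /deletion_coef st'.
rewrite rev_delete_nth ?st ?subSS ?subn0 ?ltnS // subnn.
have -> : (delete_nth 0 (rev (val (val t))) == rev (val (val s))) = false.
  apply/eqP => E; have [vt nt _] := rev_gen_spec t; have [_ ns _] := rev_gen_spec s.
  move: st' vt nt ns; rewrite /rev_gen -E; case: (rev (val (val t))) => // x [|z r] // _.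
  rewrite valid_cons2 gap_ndist => /andP[/andP[_ g] _] nt.
  rewrite -[delete_nth 0 _]/(drop 0 (z :: r)) drop0 -nt rnorm_cons2; lia.
rewrite mul0r add0r mulr_sumr; apply: eq_bigr => j _.
have jn := ltn_ord j.
rewrite rev_delete_nth st /bump /= add1n ?subSS; last by lia.
rewrite (_ : (n.+1 - (n - j))%N = j.+1); last by lia.
rewrite /rev_gen; case: eqP => _; rewrite ?mulr0n ?mul0r ?mulr0 // mul1r mulr1n -exprD.
have -> : (n + j = (n - j) + j.*2)%N by rewrite -addnn; lia.
by rewrite exprD -mul2n exprM sqrrN expr1n mulr1.
Qed.

Lemma homology_eq0 (A B C : zmodType) (f : {additive A -> B}) (g : {additive B -> C}) :
  (forall h : homology f g, h = 0) <->
  (forall b, g b = 0 -> exists a, f a = b).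
Proof.
have pi0 (z : Defs.cycle g) : \pi_(homology f g) z = 0 <-> z \in is_boundary f (g := g).
  split=> [E|zb].
    have : \pi_(homology f g) z = \pi_(homology f g) 0.
      by rewrite E; apply: esym (raddf0 _).
    by move/eqP; rewrite -Quotient.idealrBE subr0.
  apply: (etrans (y := \pi_(homology f g) 0)); last exact: raddf0.
  by apply/eqP; rewrite -Quotient.idealrBE subr0.
split=> [H b gb|H h].
  have bc : b \in is_cycle g by rewrite unfold_in gb.
  by have /pi0/asboolP[a aE] := H (\pi_(homology f g) (Cycle bc)); exists a.
rewrite -[h]reprK; apply/pi0/asboolP; case: (repr h) => b bc /=.
by apply: H; move: bc; rewrite unfold_in => /eqP.
Qed.

Section Translation.
Variable l : nat.
Local Notation N n := #|{: mag_gen G n l}|.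

Definition codiff_mx n : 'M[int]_(N n, N n.+1) :=
  \matrix_(i, j) deletion_coef (rev_gen (enum_val j)) (rev_gen (enum_val i)).

Definition chain_col n (c : MC G n l) : 'cV[int]_(N n) :=
  \col_i (c : {ffun mag_gen G n l -> int}) (enum_val i).

Lemma mag_diff_mx n (c : MC G n.+1 l) :
  chain_col (mag_diffS c) =
  (-1) ^+ n *: (codiff_mx n *m chain_col c).
Proof.
apply/matrixP => i j; rewrite !mxE mag_diff_coef; congr (_ * _).
rewrite (reindex (fun k : 'I_(N n.+1) => enum_val k)) /=.
  by apply: eq_bigr => k _; rewrite !mxE.
exact: onW_bij (enum_val_bij _).
Qed.

Lemma chain_col_surj n (v : 'cV[int]_(N n)) :
  exists c : MC G n l, v = chain_col c.
Proof.
exists [ffun t => v (enum_rank t) 0]; apply/matrixP => i j.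
by rewrite ord1 !mxE ffunE enum_valK.
Qed.

Lemma chain_col_inj n (c c' : MC G n l) :
  chain_col c =
  chain_col c' -> c = c'.
Proof.
move=> /matrixP cc'; apply/ffunP => t.
by have := cc' (enum_rank t) 0; rewrite !mxE enum_rankK.
Qed.

Lemma chain_col_eq0 n (c : MC G n l) :
  c = 0 <-> chain_col c = 0.
Proof.
split=> [->|E]; first by apply/matrixP => i j; rewrite !mxE ffunE.
by apply: chain_col_inj; rewrite E; apply/matrixP => i j; rewrite !mxE ffunE.
Qed.

Lemma sign_eq0 a b n (v : 'M[int]_(a, b)) : (-1) ^+ n *: v = 0 <-> v = 0.
Proof.
split=> [E|->]; last by rewrite scaler0.
by rewrite -[v]scale1r -(sqrr_sign int n) expr2 -scalerA E scaler0.
Qed.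

Lemma MH_col_exact n :
  (forall h : MH G n.+1 l, h = 0) <-> col_exact (codiff_mx n) (codiff_mx n.+1).
Proof.
rewrite homology_eq0 /=; split=> H.
  move=> v; have [c ->] := chain_col_surj v => bc0.
  have [|c' c'E] := H c; first by apply/chain_col_eq0; rewrite mag_diff_mx bc0 scaler0.
  exists ((-1) ^+ n.+1 *: chain_col c').
  by rewrite -scalemxAr -mag_diff_mx c'E.
move=> c /chain_col_eq0; rewrite mag_diff_mx => /sign_eq0/H[w wE].
have [c' c'E] := chain_col_surj ((-1) ^+ n.+1 *: w).
exists c'; apply: chain_col_inj; rewrite mag_diff_mx -c'E wE scalemxAr scalerA -expr2.
by rewrite sqrr_sign scale1r.
Qed.

Variable K : fieldType.
Local Notation E := {malg K[seq G]}.

Lemma ins1_cell n k (r s : seq G) : ins1 r s -> cell n.+1 k s = cell n k r.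
Proof.
by move=> rs; rewrite /cell (ins1_valid rs) (ins1_rnorm rs) (ins1_size rs).
Qed.

Definition cochain_row n (f : E) : 'rV[K]_(N n) := \row_i f@_(rev_gen (enum_val i)).

Lemma cell_sum n (f : E) : supported (cell n l) f ->
  f = \sum_i cochain_row n f 0 i *: << rev_gen (enum_val i) >>.
Proof.
move=> fc; rewrite {1}(cell_expand fc) (reindex (fun k : 'I_(N n) => enum_val k)) /=.
  by apply: eq_bigr => k _; rewrite !mxE.
exact: onW_bij (enum_val_bij _).
Qed.

Lemma cochain_row_codiff n (f : E) : supported (cell n l) f ->
  cochain_row n.+1 (codiff f) = cochain_row n f *m map_mx intr (codiff_mx n).
Proof.
move=> fc; apply/rowP => j; rewrite mxE {1}(cell_sum fc) linear_sum raddf_sum mxE /=.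
apply: eq_bigr => i _; rewrite linearZ mcoeffZ /= codiffU mcoeff_codiff_seq.
- by rewrite !mxE.
- by have [] := rev_gen_spec (enum_val i).
- by have [] := rev_gen_spec (enum_val j).
- by have [_ -> _] := rev_gen_spec (enum_val i); have [_ -> _] := rev_gen_spec (enum_val j).
Qed.

Lemma cochain_row_inj n (f g : E) : supported (cell n l) f -> supported (cell n l) g ->
  cochain_row n f = cochain_row n g -> f = g.
Proof. by move=> fc gc fg; rewrite (cell_sum fc) fg -cell_sum. Qed.

Lemma cochain_row_surj n (v : 'rV[K]_(N n)) :
  exists f : E, supported (cell n l) f /\ cochain_row n f = v.
Proof.
exists (\sum_i v 0 i *: << rev_gen (enum_val i) >>); split.
  by apply: supported_sum => i _; apply: supportedZ; apply: supportedU; apply: rev_gen_cell.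
apply/rowP => j; rewrite mxE raddf_sum (bigD1 j) //= mcoeffZ mcoeffUU mulr1.
rewrite big1 ?addr0 // => i ij; rewrite mcoeffZ mcoeffU.
by rewrite (inj_eq (@rev_gen_inj _ _ _)) (inj_eq enum_val_inj) (negbTE ij) mulr0.
Qed.

Lemma supp_codiff_cell n (f : E) : supported (cell n l) f -> supported (cell n.+1 l) (codiff f).
Proof. by apply: supp_codiff => r s rs; rewrite (ins1_cell _ _ rs). Qed.

Lemma row_exact_iff n : row_exact K (codiff_mx n) (codiff_mx n.+1) <->
  forall f : E, supported (cell n.+1 l) f -> codiff f = 0 ->
  exists2 g : E, supported (cell n l) g & f = codiff g.
Proof.
split=> H.
  move=> f fc f0; have [|w wE] := H (cochain_row n.+1 f).
    rewrite -cochain_row_codiff // f0; apply/rowP => j; by rewrite !mxE mcoeff0.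
  have [g [gc gE]] := cochain_row_surj w; exists g => //.
  apply: cochain_row_inj fc (supp_codiff_cell gc) _.
  by rewrite cochain_row_codiff // gE.
move=> v; have [f [fc <-]] := cochain_row_surj v; rewrite -cochain_row_codiff // => E0.
have f0 : codiff f = 0.
  apply: cochain_row_inj (supp_codiff_cell fc) (@supported0 _ _ _) _; rewrite E0.
  by apply/rowP => j; rewrite !mxE mcoeff0.
have [g gc ->] := H f fc f0; exists (cochain_row n g); exact: cochain_row_codiff.
Qed.

End Translation.

(** Over the rationals the matrices act on cochains as [codiff]. *)
Lemma codiff_mx_sq l n : codiff_mx l n *m codiff_mx l n.+1 = 0.
Proof.
have inj : injective (map_mx (intr : int -> rat)
    : 'M_(#|{: mag_gen G n l}|, #|{: mag_gen G n.+2 l}|) -> _).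
  by move=> s t /matrixP st; apply/matrixP => i j; have := st i j; rewrite !mxE => /intr_inj.
apply: inj; rewrite map_mxM map_mx0; apply/row_matrixP => i; rewrite row0 row_mul.
have [f [fc fE]] := cochain_row_surj (delta_mx 0 i : 'rV[rat]_(#|{: mag_gen G n l}|)).
rewrite rowE -fE -cochain_row_codiff // -cochain_row_codiff; last exact: supp_codiff_cell.
by rewrite codiff_codiff; apply/rowP => j; rewrite !mxE mcoeff0.
Qed.

End Chains.

(** * Diagonality and exactness over all fields *)
Section DiagonalExact.
Variable G : digraph.
Implicit Types (r s t : seq G).

Lemma cell_valid n l s : cell n l s -> [/\ valid s, rnorm s = l & size s = n.+1].
Proof. by case/and3P=> -> /eqP-> /eqP->. Qed.

Lemma cell_le n l s : cell n l s -> (n <= l)%N.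
Proof. by case/cell_valid=> /valid_size + nl ss; rewrite nl ss. Qed.

Lemma cell_path l s : cell l l s -> ispath s.
Proof. by case/cell_valid=> v nl ss; apply: valid_ispath v _; rewrite nl ss. Qed.

Lemma cell_nonpath n l s : (n < l)%N -> cell n l s -> ~~ ispath s.
Proof.
move=> nl /cell_valid[_ ns ss]; apply/negP => /ispath_valid[_].
by rewrite ns ss => -[E]; rewrite E ltnn in nl.
Qed.

Lemma cell0_gt0 l s : (0 < l)%N -> ~~ cell 0 l s.
Proof.
move=> l0; apply/negP => /cell_valid[_ + ss]; case: s ss => [|x []] //= _ E.
by rewrite -E in l0.
Qed.

Lemma MC_empty n l (c : MC G n l) : (forall s : seq G, ~~ cell n l s) -> c = 0.
Proof. by move=> nc; apply/ffunP => t; have := nc (rev_gen t); rewrite rev_gen_cell. Qed.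

Lemma card_gen0 l : (0 < l)%N -> #|{: mag_gen G 0 l}| = 0%N.
Proof.
move=> l0; apply: eq_card0 => t; have := cell0_gt0 (rev_gen t) l0.
by rewrite rev_gen_cell.
Qed.

Lemma cell_pre n l : exists Q : pred (seq G),
  forall r s, ins1 r s -> cell n l s = Q r.
Proof.
case: n => [|n]; last by exists (cell n l) => r s; apply: ins1_cell.
exists (fun=> false) => r s rs; apply/negP => /cell_valid[_ _].
by rewrite (ins1_size rs); case: r rs.
Qed.

Section OverField.
Variable K : fieldType.
Local Notation E := {malg K[seq G]}.

Lemma supp_projQ (Q : pred (seq G)) (f : E) : supported Q (proj Q f).
Proof. by move=> r; rewrite mcoeff_proj; case: ifP => //; rewrite eqxx. Qed.

Lemma proj_empty (Q : pred (seq G)) (f : E) :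
  (forall s, ~~ Q s) -> proj Q f = 0.
Proof.
by move=> nQ; apply/malgP => s; rewrite mcoeff_proj (negbTE (nQ s)) mcoeff0.
Qed.

(** For n < l this is the vanishing of homology, transposed and moved to K. For
    n = l the kernel of the projection contains only coboundaries, and for n > l
    there are no tuples. *)
Lemma diagonal_piece n l (f : E) : diagonal G -> in_kernel f -> codiff f = 0 ->
  exists g : E, proj (cell n l) f = codiff g.
Proof.
move=> diag fN f0; have [Q QE] := cell_pre n l.
have pf0 : codiff (proj (cell n l) f) = 0.
  rewrite (codiff_proj (Q' := cell n.+1 l)) ?f0 ?linear0 // => r s; exact: ins1_cell.
have [ln|nl|nl] := ltngtP l n.
- exists 0; rewrite linear0; apply: proj_empty => s; apply/negP => /cell_le.
  by rewrite leqNgt ln.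
- case: n QE pf0 nl => [|n] QE pf0 nl.
    exists 0; rewrite linear0; apply: proj_empty => s.
    exact: cell0_gt0.
  have ex m : (m.+1 < l)%N -> col_exact (codiff_mx G l m) (codiff_mx G l m.+1).
    by move=> ml; apply/MH_col_exact/diag => lm; rewrite lm ltnn in ml.
  have l0 : (0 < l)%N by apply: leq_trans nl.
  have /row_exact_iff H :=
    @homotopy_row_exact _ _ l (@codiff_mx_sq G l) (card_gen0 l0) ex K n nl.
  have [g _ gE] := H _ (@supp_projQ (cell n.+1 l) f) pf0.
  by exists g.
- subst l; have [g fg] := in_kernel_split fN; exists (proj Q g).
  rewrite (codiff_proj _ QE); apply/eqP; rewrite -subr_eq0 -projB; apply/eqP.
  apply: (supported_eq0 (P := fun s => cell n n s /\ ~~ ispath s)).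
    move=> s; rewrite mcoeff_proj; case: ifP => [cs /fg //|_]; by rewrite eqxx.
  by move=> s [/cell_path ->].
Qed.

Lemma diagonal_offdiag_exact m : diagonal G -> offdiag_exact K G m.
Proof.
move=> diag f fN fv f0.
have fE : f = \sum_(l < m) \sum_(n < m) proj (cell n l) f.
  apply/malgP => s; rewrite raddf_sum /=.
  under eq_bigr => l _.
    rewrite raddf_sum /=; under eq_bigr do rewrite mcoeff_proj.
    over.
  have [fs|/fv/andP[vs ns]] := eqVneq f@_s 0.
    by rewrite fs big1 // => l _; rewrite big1 // => n _; rewrite if_same.
  have ss := valid_size vs; have s0 : (0 < size s)%N by case: s vs {ns ss fv}.
  have sm : ((size s).-1 < m)%N by rewrite prednK //; apply: leq_trans ss ns.
  rewrite (bigD1 (Ordinal ns)) //= (bigD1 (Ordinal sm)) //=.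
  rewrite /cell vs eqxx prednK // eqxx /= !big1 ?addr0 // => [l /negbTE lE|n /negbTE nE].
    rewrite big1 // => n _; rewrite ifF //; apply/negP => /andP[/eqP nl _].
    by rewrite -(inj_eq val_inj) /= nl eqxx in lE.
  rewrite ifF //; apply/eqP => E'.
  by rewrite -(inj_eq val_inj) /= E' eqxx in nE.
have ex (l n : 'I_m) : exists g : E, proj (cell n l) f = codiff g.
  exact: diagonal_piece.
have [g gE] := fin_all_exists (fun l => fin_all_exists (ex l)).
exists (\sum_l \sum_n g l n); rewrite linear_sum {1}fE /=.
apply: eq_bigr => l _; rewrite linear_sum; apply: eq_bigr => n _; exact: gE.
Qed.

Lemma offdiag_row_exact n l : (n.+1 < l)%N -> (forall m, offdiag_exact K G m) ->
  row_exact K (codiff_mx G l n) (codiff_mx G l n.+1).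
Proof.
move=> nl ac; apply/row_exact_iff => f fc f0.
have fN : in_kernel f by apply: in_kernel_nonpath => s /fc; apply: cell_nonpath.
have [|g gE] := ac l.+1 f fN _ f0.
  by move=> s /fc/cell_valid[-> -> _] /=.
exists (proj (cell n l) g); first exact: supp_projQ.
rewrite (codiff_proj (Q' := cell n.+1 l)); last by move=> r s; apply: ins1_cell.
by rewrite -gE proj_id.
Qed.

End OverField.

Lemma offdiag_exact_diagonal :
  (forall (K : fieldType) m, offdiag_exact K G m) -> diagonal G.
Proof.
move=> ac n l ln; rewrite /MH.
have triv : (forall s : seq G, ~~ cell n l s) -> forall h : MH G n l, h = 0.
  move=> nc; apply/homology_eq0 => b _; exists 0.
  by rewrite raddf0; apply: esym (MC_empty b nc).
have [{}ln|nl|//] := ltngtP l n.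
  by apply: triv => s; apply/negP => /cell_le; rewrite leqNgt ln.
case: n nl {ln} triv => [|n] nl triv; first by apply: triv => s; apply: cell0_gt0.
apply/MH_col_exact; apply: row_exact_col_exact => [|K]; first exact: codiff_mx_sq.
exact: offdiag_row_exact.
Qed.

End DiagonalExact.

(** * The 2-short congruence on vertex sequences *)
Section Congruence.
Variable G : digraph.
Implicit Types (s t m : seq G) (x y z u v : G) (p q : qpath G).
Local Notation path x s := (path (@arrow G) x s).

Lemma tsc_refl p : two_short_congr p p.
Proof. by move=> R [[rfl _ _] _ _] _; apply: rfl. Qed.

Lemma tsc_trans p p' p'' :
  two_short_congr p p' -> two_short_congr p' p'' -> two_short_congr p p''.
Proof.
move=> pp pp' R cR gR; case: (cR) => -[_ _ tr] _ _.
exact: tr (pp R cR gR) (pp' R cR gR).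
Qed.

Lemma tsc_gen p p' : shortest p -> shortest p' -> connect_same p p' ->
  (plen p <= 2)%N -> two_short_congr p p'.
Proof. by move=> sp sp' cpp p2 R _ gR; apply: gR. Qed.

Lemma tsc_concat3 p p' q q' r r' : two_short_congr p p' ->
  pconcat3 q p q' = Some r -> pconcat3 q p' q' = Some r' ->
  two_short_congr r r'.
Proof.
move=> pp qr qr' R cR gR; case: (cR) => _ _ cc.
exact: cc (pp R cR gR) qr qr'.
Qed.

Lemma pconcat3_val p q r (t : qpath G) : pconcat3 p q r = Some t <->
  [/\ term p = init q, term q = init r &
      val t = (init p, (val p).2 ++ (val q).2 ++ (val r).2)].
Proof.
rewrite /pconcat3; split.
  case E: (pconcat p q) => [pq|] //= E'.
  have [e1 v1] := (pconcat_val _ _ _).1 E; have [e2 v2] := (pconcat_val _ _ _).1 E'.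
  split=> //; first by rewrite -(term_cat E).
  by rewrite v2 (init_cat E) v1 catA.
case=> pq qr tE; have [w wE] := pconcat_ex pq; rewrite wE /=.
have [_ wv] := (pconcat_val _ _ _).1 wE.
apply/pconcat_val; split; first by rewrite (term_cat wE).
by rewrite tE (init_cat wE) wv catA.
Qed.

(** Having the same ends and the same length is a congruence that relates
    geodesics with the same ends. *)
Lemma tsc_same p p' : two_short_congr p p' -> connect_same p p' /\ plen p = plen p'.
Proof.
move/(_ (fun p p' => connect_same p p' /\ plen p = plen p')); apply; last first.
  move=> q q' + + cs _; case: (cs) => e1 e2; rewrite /shortest e1 e2.
  by move=> -> [->].
rewrite /connect_same; split.
- split=> [//|q q' [[-> ->] ->] //|q q' q'' [[-> ->] ->] //].
- by move=> q q' [].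
move=> q q' r r' t t' [[e1 e2] e3] /pconcat3_val[a1 a2 tE] /pconcat3_val[b1 b2 tE'].
rewrite /connect_same /init /term /plen tE tE' /= !last_cat !size_cat.
have -> : size (val q).2 = size (val q').2 := e3.
by move: a1 a2 b1 b2; rewrite /term /init => -> -> -> ->.
Qed.

(** The congruence, for paths given by a first vertex and the list of the
    others; concatenation of paths is then concatenation of lists. *)
Definition congr_seq x s s' := exists p p', [/\ val p = (x, s), val p' = (x, s')
  & two_short_congr p p'].

Lemma qpath_ex x s : path x s -> exists p : qpath G, val p = (x, s).
Proof. by move=> ps; exists (Sub (x, s) ps); rewrite SubK. Qed.

Lemma congr_seq_refl x s : path x s -> congr_seq x s s.
Proof. by case/qpath_ex=> p pE; exists p, p; split=> //; apply: tsc_refl. Qed.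

Lemma congr_seq_trans x s s' s'' : congr_seq x s s' -> congr_seq x s' s'' -> congr_seq x s s''.
Proof.
case=> p [p' [pE p'E pp]] [q [q' [qE q'E qq]]]; exists p, q'; split=> //.
by apply: tsc_trans qq; rewrite (val_inj (etrans qE (esym p'E))).
Qed.

Lemma congr_seq_same x s s' : congr_seq x s s' ->
  [/\ path x s, path x s', last x s = last x s' & size s = size s'].
Proof.
case=> p [p' [pE p'E /tsc_same[[_ tpp] spp]]].
have := valP p; have := valP p'; rewrite /= pE p'E => -> ->.
by move: tpp spp; rewrite /term /plen pE p'E.
Qed.

Lemma congr_seq_cat x a s s' b : path x a -> congr_seq (last x a) s s' ->
  path (last (last x a) s) b -> congr_seq x (a ++ s ++ b) (a ++ s' ++ b).
Proof.
move=> xa ss ab; have [xs xs' ls _] := congr_seq_same ss.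
have [w wE] : exists w : qpath G, val w = (x, a ++ s ++ b).
  by apply: qpath_ex; rewrite !cat_path xa xs ab.
have [w' w'E] : exists w' : qpath G, val w' = (x, a ++ s' ++ b).
  by apply: qpath_ex; rewrite !cat_path xa xs' -ls ab.
have [q qE] := qpath_ex xa; have [r rE] := qpath_ex ab.
case: ss => p [p' [pE p'E pp]]; exists w, w'; split=> //.
apply: (tsc_concat3 (q := q) (q' := r) pp); apply/pconcat3_val;
  by rewrite /term /init qE rE ?pE ?p'E ?wE ?w'E; split.
Qed.

Definition geodesic_seq x s := path x s /\ ndist x (last x s) = size s.

Lemma shortestP p : shortest p <-> geodesic_seq (init p) (val p).2.
Proof.
rewrite /geodesic_seq /shortest; have := valP p; rewrite -/(init p) => pp.
have [r _] := path_ndist pp; rewrite distE pp; by split=> -[_ E]; split.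
Qed.

Lemma congr_seq_gen x s s' : geodesic_seq x s -> geodesic_seq x s' -> last x s = last x s' ->
  (size s <= 2)%N -> congr_seq x s s'.
Proof.
move=> ss ss' ls s2; have [p pE] := qpath_ex ss.1; have [p' p'E] := qpath_ex ss'.1.
exists p, p'; split=> //; apply: tsc_gen.
- by apply/shortestP; rewrite /init pE.
- by apply/shortestP; rewrite /init p'E.
- by rewrite /connect_same /init /term pE p'E.
- by rewrite /plen pE.
Qed.

Lemma geodesic_seq_cat x s t : geodesic_seq x (s ++ t) -> geodesic_seq x s /\ geodesic_seq (last x s) t.
Proof.
rewrite /geodesic_seq cat_path last_cat size_cat => -[/andP[xs xt] d].
have [r1 d1] := path_ndist xs; have [r2 d2] := path_ndist xt.
have := ndist_triangle r1 r2; rewrite xs xt d => tri; split; split=> //; lia.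
Qed.

Lemma cat_geodesic_seq x s t : geodesic_seq x s -> geodesic_seq (last x s) t ->
  ndist x (last (last x s) t) = (ndist x (last x s) + ndist (last x s) (last (last x s) t))%N ->
  geodesic_seq x (s ++ t).
Proof.
by move=> [xs ds] [xt dt]; rewrite /geodesic_seq cat_path last_cat size_cat xs xt ds dt.
Qed.

Definition reducible_seq x s := exists a z m b, [/\ x :: s = a ++ z :: m ++ b,
  (ndist z (last z m) < size m)%N & (size m <= 2)%N].
Definition qreducible x s := exists2 s', congr_seq x s s' & reducible_seq x s'.

Lemma reducible_seq_cat x a s b : reducible_seq (last x a) s -> reducible_seq x (a ++ s ++ b).
Proof.
case=> a' [z [m [b' [E d m2]]]]; exists (belast x a ++ a'), z, m, (b' ++ b).
split=> //; rewrite -cat_cons lastI -cats1 -!catA /= -cat_cons E.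
by rewrite -!catA /= -catA.
Qed.

Lemma qreducible_cat x a s b : path x a -> qreducible (last x a) s ->
  path (last (last x a) s) b -> qreducible x (a ++ s ++ b).
Proof.
move=> xa [s' ss rs] xb; exists (a ++ s' ++ b); first exact: congr_seq_cat.
exact: reducible_seq_cat.
Qed.

Lemma qreducible_congr x s s' : congr_seq x s s' -> qreducible x s' -> qreducible x s.
Proof. by move=> ss [s'' ss' r]; exists s'' => //; apply: congr_seq_trans ss ss'. Qed.

Lemma geodesic_nonreducible x s : geodesic_seq x s -> ~ reducible_seq x s.
Proof.
move=> sx [[|x' a] [z [m [b [/= [xE E] d _]]]]].
  by move: sx; rewrite E xE => /geodesic_seq_cat[[_ e] _]; rewrite e ltnn in d.
move: sx; rewrite E -cat_rcons => /geodesic_seq_cat[_]; rewrite last_rcons.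
by move=> /geodesic_seq_cat[[_ e] _]; rewrite e ltnn in d.
Qed.

Lemma geodesic_nonqreducible x s : geodesic_seq x s -> ~ qreducible x s.
Proof.
move=> [xs ds] [s' /congr_seq_same[_ xs' ls ss]]; apply: geodesic_nonreducible.
by split=> //; rewrite -ls -ss.
Qed.

End Congruence.

(** * Second magnitude homology and property V2 *)
Section Quadratic.
Variable G : digraph.
Implicit Types (s t m : seq G) (x y z u v : G) (p q : qpath G).
Local Notation path x s := (path (@arrow G) x s).

Definition V2_upto l := forall x s, path x s -> (size s < l)%N ->
  (forall s', geodesic_seq x s -> geodesic_seq x s' -> last x s = last x s' -> congr_seq x s s') /\
  ((ndist x (last x s) < size s)%N -> qreducible x s).

Lemma geodesic_seq_ex x y : reach x y -> exists s, geodesic_seq x s /\ last x s = y.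
Proof.
case/geodesic=> s [ps ls ss]; exists s; split=> //; by split; rewrite ?ls.
Qed.

Section Functional.
Variables (l : nat) (x0 : G) (s0 : seq G).
Hypothesis IH : V2_upto l.
Hypothesis nqred : ~ qreducible x0 s0.

(** Composing geodesics from a to b and from b to c gives a path in the class of
    (x0, s0). By induction the choice of geodesics is irrelevant. *)
Definition Phi a b c := exists s1 s2, [/\ a = x0, geodesic_seq a s1 /\ last a s1 = b,
  geodesic_seq b s2 /\ last b s2 = c & congr_seq x0 s0 (s1 ++ s2)].

Definition Psi a b c d := exists s1 s2 s3, [/\ a = x0, geodesic_seq a s1 /\ last a s1 = b,
  geodesic_seq b s2 /\ last b s2 = c, geodesic_seq c s3 /\ last c s3 = d
  & congr_seq x0 s0 (s1 ++ s2 ++ s3)].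

Lemma qreducible_part a s t : a = x0 -> path a s -> qreducible (last a s) t ->
  forall b, path (last (last a s) t) b -> ~ congr_seq x0 s0 (s ++ t ++ b).
Proof.
move=> -> xs bt b tb ss; apply: nqred; apply: qreducible_congr ss _; exact: qreducible_cat.
Qed.

(** The composite of geodesics from b to c and from c to d is either a geodesic,
    and congruent to any other one, or long, and then quasi-reducible; the
    latter cannot occur in the class of a path that is not quasi-reducible. *)
Lemma Phi_right a b c d : reach a b -> reach b c -> reach c d ->
  (0 < ndist a b)%N -> (ndist a b + ndist b c + ndist c d)%N = l ->
  ((ndist b c + ndist c d)%N = ndist b d /\ Phi a b d) <-> Psi a b c d.
Proof.
move=> rab rbc rcd ab abcd; split.
  case=> e [s1 [s [ax [sh1 l1] [sh ls] ss]]].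
  have [s2 [sh2 l2]] := geodesic_seq_ex rbc; have [s3 [sh3 l3]] := geodesic_seq_ex rcd.
  exists s1, s2, s3; split=> //.
  have sh23 : geodesic_seq b (s2 ++ s3) by apply: cat_geodesic_seq; rewrite ?l2 ?l3.
  have lt : (size s < l)%N by rewrite -(sh.2) ls -e -abcd; lia.
  have [+ _] := IH sh.1 lt; move=> /(_ _ sh sh23).
  rewrite ls last_cat l2 l3 => /(_ erefl) ss23; apply: congr_seq_trans ss _.
  rewrite -ax -[s]cats0 -[s2 ++ s3]cats0; apply: congr_seq_cat; rewrite ?l1 //.
  exact: sh1.1.
case=> s1 [s2 [s3 [ax [sh1 l1] [sh2 l2] [sh3 l3] ss]]].
have p23 : path b (s2 ++ s3) by rewrite cat_path l2 sh2.1 sh3.1.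
have z23 : size (s2 ++ s3) = (ndist b c + ndist c d)%N.
  by rewrite size_cat -(sh2.2) -(sh3.2) l2 l3.
have ll : last b (s2 ++ s3) = d by rewrite last_cat l2 l3.
have [e|ne] := eqVneq (ndist b c + ndist c d)%N (ndist b d).
  by split=> //; exists s1, (s2 ++ s3); split=> //; split=> //; split; rewrite ?ll ?z23.
have tri := ndist_triangle rbc rcd.
have lt : (size (s2 ++ s3) < l)%N by rewrite z23 -abcd; lia.
have [_ B] := IH p23 lt.
have bd : qreducible (last a s1) (s2 ++ s3).
  by rewrite l1; apply: B; rewrite ?ll ?z23; lia.
by case: (@qreducible_part a s1 (s2 ++ s3) ax sh1.1 bd [::] isT); rewrite cats0.
Qed.

Lemma Phi_left a b c d : reach a b -> reach b c -> reach c d ->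
  (0 < ndist c d)%N -> (ndist a b + ndist b c + ndist c d)%N = l ->
  ((ndist a b + ndist b c)%N = ndist a c /\ Phi a c d) <-> Psi a b c d.
Proof.
move=> rab rbc rcd cd abcd; split.
  case=> e [s [s3 [ax [sh ls] [sh3 l3] ss]]].
  have [s1 [sh1 l1]] := geodesic_seq_ex rab; have [s2 [sh2 l2]] := geodesic_seq_ex rbc.
  exists s1, s2, s3; split=> //.
  have sh12 : geodesic_seq a (s1 ++ s2) by apply: cat_geodesic_seq; rewrite ?l1 ?l2.
  have lt : (size s < l)%N by rewrite -(sh.2) ls -e -abcd; lia.
  have [+ _] := IH sh.1 lt; move=> /(_ _ sh sh12).
  rewrite ls last_cat l1 l2 => /(_ erefl) ss12; apply: congr_seq_trans ss _.
  rewrite -ax catA -[s ++ s3]/([::] ++ s ++ s3) -[(s1 ++ s2) ++ s3]/([::] ++ (s1 ++ s2) ++ s3).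
  by apply: congr_seq_cat => //=; rewrite ls; apply: sh3.1.
case=> s1 [s2 [s3 [ax [sh1 l1] [sh2 l2] [sh3 l3] ss]]].
have p12 : path a (s1 ++ s2) by rewrite cat_path l1 sh1.1 sh2.1.
have z12 : size (s1 ++ s2) = (ndist a b + ndist b c)%N.
  by rewrite size_cat -(sh1.2) -(sh2.2) l1 l2.
have ll : last a (s1 ++ s2) = c by rewrite last_cat l1 l2.
have [e|ne] := eqVneq (ndist a b + ndist b c)%N (ndist a c).
  split=> //; exists (s1 ++ s2), s3; split=> //; last by rewrite -catA.
  by split=> //; split; rewrite ?ll ?z12.
have tri := ndist_triangle rab rbc.
have lt : (size (s1 ++ s2) < l)%N by rewrite z12 -abcd; lia.
have [_ B] := IH p12 lt.
have bd : qreducible a (s1 ++ s2) by apply: B; rewrite ll z12; lia.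
case: (@qreducible_part a [::] (s1 ++ s2) ax isT bd s3).
  by rewrite /= ll; apply: sh3.1.
by rewrite /= -catA.
Qed.

Definition phis (u : seq G) : bool :=
  if u is [:: a; b; c] then `[< Phi a b c >] else false.

Definition Phi_sum (c : MC G 2 l) : int :=
  \sum_t (phis (val (val t)))%:R * (c : {ffun mag_gen G 2 l -> int}) t.

Lemma sum_gen_coef (w : seq G) :
  \sum_(t : mag_gen G 2 l) (phis (val (val t)))%:R * ((w == rev_gen t)%:R : int) =
  (cell 2 l w && phis (rev w))%:R.
Proof.
have [cw|ncw] /= := boolP (cell 2 l w); last first.
  apply: big1 => t _; case: eqP => [wE|_]; last by rewrite mulr0.
  by rewrite wE rev_gen_cell in ncw.
have [t <-] := cell_rev_gen cw; rewrite (bigD1 t) //= eqxx mulr1 big1 ?addr0.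
  by rewrite /rev_gen revK.
by move=> t' /negbTE tt'; rewrite (inj_eq (@rev_gen_inj _ _ _)) eq_sym tt' mulr0.
Qed.

(** The two inner faces of (a, b, c, d) have opposite signs, and on both of them
    the functional is the indicator of [Psi]; the outer faces lower the norm. *)
Lemma Phi_sum_boundary (c : MC G 3 l) : Phi_sum (mag_diffS c) = 0.
Proof.
rewrite /Phi_sum; under eq_bigr do rewrite mag_diff_coef mulrCA mulr_sumr.
rewrite -mulr_sumr exchange_big /= big1 ?mulr0 // => t _.
under eq_bigr do rewrite mulrA.
rewrite -mulr_suml (_ : \sum_s _ = 0) ?mul0r //.
have [vt nt st] := rev_gen_spec t; move: vt nt st.
case: (rev_gen t) => [|d [|c' [|b [|a []]]]] // + nt _.
rewrite !valid_cons2 => /and4P[gdc gcb gba _].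
rewrite /deletion_coef; under eq_bigr do rewrite mulr_sumr.
rewrite exchange_big /= !big_ord_recr big_ord0 /= add0r.
rewrite !expr0 !expr1 expr2.
rewrite /delete_nth /=.
have S w (e : int) : \sum_(s : mag_gen G 2 l) (phis (val (val s)))%:R * (e *+ (w == rev_gen s)) =
   e * (cell 2 l w && phis (rev w))%:R.
  rewrite -sum_gen_coef mulr_sumr; apply: eq_bigr => s _.
  case: (w == rev_gen s); rewrite /= ?mulr1n ?mulr0n ?mulr1 ?mulr0 //; exact: mulrC.
rewrite !S /rev /= mul1r mulN1r.
move: gdc gcb gba nt; rewrite !gap_ndist !rnorm_cons2 /=.
move=> /andP[rcd cd] /andP[rbc bc] /andP[rab ab] nt; rewrite !addn0 in nt.
have lE : (ndist a b + ndist b c' + ndist c' d)%N = l by rewrite -nt; lia.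
have R := Phi_right rab rbc rcd ab lE; have L := Phi_left rab rbc rcd cd lE.
have -> : cell 2 l [:: d; c'; b] = false.
  by apply/negP => /cell_valid[_ + _]; rewrite !rnorm_cons2 /= addn0; lia.
suff -> : cell 2 l [:: d; b; a] && `[< Phi a b d >] =
  cell 2 l [:: d; c'; a] && `[< Phi a c' d >] by rewrite mulr0 addr0; case: (_ && _).
have rbd := reach_trans rbc rcd; have rac := reach_trans rab rbc.
have c1 : cell 2 l [:: d; b; a] = ((ndist b c' + ndist c' d)%N == ndist b d).
  rewrite /cell !valid_cons2 !gap_ndist !rnorm_cons2 /= addn0 rbd rab ab !andbT /=.
  have := ndist_triangle rbc rcd; lia.
have c2 : cell 2 l [:: d; c'; a] = ((ndist a b + ndist b c')%N == ndist a c').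
  rewrite /cell !valid_cons2 !gap_ndist !rnorm_cons2 /= addn0 rcd rac cd !andbT /=.
  have := ndist_triangle rab rbc; lia.
rewrite c1 c2; apply/idP/idP.
  case/andP=> /eqP e /asboolP ph; have /L[-> ph'] := R.1 (conj e ph).
  by rewrite eqxx; apply/asboolP.
case/andP=> /eqP e /asboolP ph; have /R[-> ph'] := L.1 (conj e ph).
by rewrite eqxx; apply/asboolP.
Qed.

Lemma Phi_sum_cycle (c : MC G 2 l) : diagonal G -> l <> 2 -> mag_diffS c = 0 -> Phi_sum c = 0.
Proof.
move=> diag l2 c0; have /homology_eq0/(_ c c0)[c' <-] := diag 2 l l2.
exact: Phi_sum_boundary.
Qed.

Lemma Phi_sum_gen (t : mag_gen G 2 l) : Phi_sum (MC_gen t) = (phis (val (val t)))%:R.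
Proof.
rewrite /Phi_sum (bigD1 t) //= ffunE eqxx mulr1 big1 ?addr0 // => t' /negbTE tt'.
by rewrite ffunE tt' mulr0.
Qed.

End Functional.
End Quadratic.

Section QuadraticV2.
Variable G : digraph.
Implicit Types (s : seq G) (x y z u v : G) (p q : qpath G).
Local Notation path x s := (path (@arrow G) x s).

Lemma triple_ex l x v y : gap v x -> gap y v -> (ndist v y + ndist x v)%N = l ->
  exists2 t : mag_gen G 2 l, rev_gen t = [:: y; v; x] & val (val t) = [:: x; v; y] :> seq G.
Proof.
move=> vx yv e; have [|t tE] := @cell_rev_gen G 2 l [:: y; v; x].
  by rewrite /cell !valid_cons2 vx yv !rnorm_cons2 /= !addn0 e eqxx.
exists t => //; apply: (can_inj revK); exact: tE.
Qed.

Lemma diff_triple l x v y (t : mag_gen G 2 l) (s : mag_gen G 1 l) :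
  rev_gen t = [:: y; v; x] ->
  (mag_diffS (MC_gen t) : {ffun _ -> int}) s = - ([:: y; x] == rev_gen s)%:R.
Proof.
move=> tE; rewrite mag_diff_coef expr1 mulN1r; congr (- _).
rewrite (bigD1 t) //= ffunE eqxx mulr1 big1 ?addr0; last first.
  by move=> t' /negbTE tt'; rewrite ffunE tt' mulr0.
rewrite /deletion_coef tE !big_ord_recr big_ord0 /= add0r.
have -> : ([:: y; v] == rev_gen s) = false.
  apply/eqP => E; have [_ ns _] := rev_gen_spec s; have [vt nt _] := rev_gen_spec t.
  move: ns vt nt; rewrite -E tE !valid_cons2 !rnorm_cons2 !gap_ndist /= !addn0.
  by move=> ns /and3P[_ /andP[_ h] _]; lia.
by rewrite mulr0n addr0 expr0.
Qed.

(** Let v and v' be the first steps of s and s'. The tuples (x, v, y) and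
    (x, v', y) have the same boundary, so the functional of the class of s takes
    the same value 1 on both. The class thus contains a path through v', whose
    two parts are congruent to those of s' by induction. *)
Lemma V2_geodesic_step l x s s' : diagonal G -> V2_upto G l -> (2 < l)%N ->
  size s = l -> geodesic_seq x s -> geodesic_seq x s' -> last x s = last x s' -> congr_seq x s s'.
Proof.
move=> diag IH l2 sl sh sh' ls.
have nqred := geodesic_nonqreducible sh; have sl' : size s' = l by rewrite -sh'.2 -ls sh.2.
case: s sl sh ls nqred => [|v s] sl sh ls nqred; first by rewrite -sl in l2.
case: s' sl' sh' ls => [|v' s'] sl' sh' ls; first by rewrite -sl' in l2.
have [sv sv2] := @geodesic_seq_cat _ x [:: v] s sh.
have [sv' sv2'] := @geodesic_seq_cat _ x [:: v'] s' sh'.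
rewrite /= in sl sl' sv sv2 sv' sv2' ls.
have [gv dv] : gap v x /\ ndist x v = 1%N.
  by apply: arrow_gap; case: sv => /=; rewrite andbT.
have [gv' dv'] : gap v' x /\ ndist x v' = 1%N.
  by apply: arrow_gap; case: sv' => /=; rewrite andbT.
set y := last v s in ls sv2.
have gy (w : G) t : geodesic_seq w t -> (size t).+1 = l -> last w t = y ->
    gap y w /\ (ndist w y).+1 = l.
  move=> [pw dw] tl wy; have [rw _] := path_ndist pw; rewrite wy in dw rw.
  by rewrite gap_ndist rw dw /=; split=> //; lia.
have [gvy dvy] := gy v s sv2 sl erefl.
have [gvy' dvy'] := gy v' s' sv2' sl' (esym ls).
have [t tE tv] := @triple_ex l x v y gv gvy ltac:(by rewrite dv addn1).
have [t' tE' tv'] := @triple_ex l x v' y gv' gvy' ltac:(by rewrite dv' addn1).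
have c0 : mag_diffS (MC_gen t - MC_gen t' : MC G 2 l) = 0.
  have -> : mag_diffS (MC_gen t - MC_gen t') = mag_diffS (MC_gen t) - mag_diffS (MC_gen t').
    exact: (@mag_diff_additive G 2 l).
  apply/ffunP => s1; rewrite !ffunE.
  by rewrite (diff_triple _ tE) (diff_triple _ tE') subrr.
have := Phi_sum_cycle IH nqred diag _ c0.
have -> : Phi_sum x (v :: s) (MC_gen t - MC_gen t') =
   Phi_sum x (v :: s) (MC_gen t) - Phi_sum x (v :: s) (MC_gen t').
  rewrite /Phi_sum -sumrB; apply: eq_bigr => u _.
  by rewrite -mulrBr; congr (_ * _); rewrite !ffunE.
rewrite !Phi_sum_gen tv tv' => /(_ _)/eqP; rewrite subr_eq0 => H.
have {}H := H ltac:(by move=> E; rewrite E in l2).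
have ph : Phi x (v :: s) x v y.
  by exists [:: v], s; split=> //; apply: congr_seq_refl; case: sh.
move: H; rewrite /phis (asboolT ph); case: asboolP => // -[s1 [s2 [_ [h1 e1] [h2 e2] ss]]] _.
apply: congr_seq_trans ss _; rewrite -[v' :: s']/([:: v'] ++ s').
have small (w : G) r : geodesic_seq w r -> (size r < l)%N -> forall r', geodesic_seq w r' ->
    last w r = last w r' -> congr_seq w r r'.
  by move=> hr rl r' hr' e; case: (IH w r hr.1 rl) => + _; apply.
have m1 : congr_seq x s1 [:: v'].
  apply: small => //; rewrite ?e1 // -(h1.2) e1 dv'; lia.
have m2 : congr_seq v' s2 s'.
  apply: small => //; rewrite ?e2 // -(h2.2) e2; lia.
apply: (@congr_seq_trans _ _ _ ([:: v'] ++ s2)).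
  by apply: (@congr_seq_cat _ x [::] s1 [:: v'] s2) => //; rewrite /= e1; apply: h2.1.
rewrite -[s2]cats0 -[s']cats0; apply: congr_seq_cat => //; by case: sv'.
Qed.

(** A path with a long tail is settled by induction. Otherwise (x, v, y), with v
    the first step, is a cycle on which the functional of the class is 1, which
    is impossible as the cycle bounds. *)
Lemma V2_long_step l x s : diagonal G -> V2_upto G l -> (2 < l)%N ->
  size s = l -> path x s -> (ndist x (last x s) < l)%N -> qreducible x s.
Proof.
move=> diag IH l2 sl ps dl; apply: contrapT => nqred.
case: s sl ps dl nqred => [|v s] sl ps dl nqred; first by rewrite -sl in l2.
rewrite /= in sl ps dl; case/andP: ps => xv ps.
have [rv dv] := path_ndist ps; set y := last v s in dl rv dv.
have [lt|ge] := ltnP (ndist v y) (size s).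
  apply: nqred; rewrite -[v :: s]/([:: v] ++ s) -[s]cats0; apply: qreducible_cat => //=.
    by rewrite xv.
  by case: (IH v s ps _) => [|_]; [rewrite -sl|apply].
have dvy : ndist v y = size s by apply/eqP; rewrite eqn_leq dv.
have [gv dxv] := arrow_gap xv.
have gy : gap y v by rewrite gap_ndist rv dvy /=; lia.
have [|t tE tv] := @triple_ex l x v y gv gy; first by rewrite dvy dxv addn1.
have c0 : mag_diffS (MC_gen t) = 0 :> MC G 1 l.
  apply/ffunP => s1; rewrite (diff_triple _ tE) ffunE; case: eqP => [E|]; last by rewrite oppr0.
  by have [_ + _] := rev_gen_spec s1; rewrite -E !rnorm_cons2 /= !addn0 => e; rewrite e ltnn in dl.
have := Phi_sum_cycle IH nqred diag _ c0; rewrite Phi_sum_gen tv /phis asboolT.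
  by move=> /(_ ltac:(by move=> E; rewrite E in l2)).
exists [:: v], s; split=> //; last by apply: congr_seq_refl; rewrite /= xv.
by split=> //; split; rewrite /= ?xv ?dxv.
Qed.

Lemma V2_upto_all l : diagonal G -> V2_upto G l.
Proof.
move=> diag; elim: l => [x s _ //|l IH x s ps].
rewrite ltnS leq_eqVlt => /orP[/eqP sl|]; last exact: IH.
have [l2|l2] := ltnP 2 l.
  split=> [s' sh sh' ls|dl]; first exact: V2_geodesic_step diag IH l2 sl sh sh' ls.
  rewrite sl in dl; exact: V2_long_step diag IH l2 sl ps dl.
split=> [s' sh sh' ls|dl]; first by apply: congr_seq_gen => //; rewrite sl.
exists s; first exact: congr_seq_refl.
by exists [::], x, s, [::]; rewrite cats0 sl; split=> //; rewrite -sl.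
Qed.

Theorem diagonal_V2 : diagonal G -> property_V2 G.
Proof.
move=> diag; split=> [p p' sp sp' [e1 e2]|p lp].
  have /shortestP h := sp; have /shortestP h' := sp'.
  have [+ _] := V2_upto_all diag h.1 (ltnSn _); rewrite -e1 in h'.
  move=> /(_ _ h h'); case.
    by move: e2; rewrite /term -/(init p) -/(init p') -e1.
  move=> q [q' [qE q'E qq]].
  have -> : p = q by apply: val_inj; rewrite qE /init; case: (val p).
  have -> : p' = q' by apply: val_inj; rewrite q'E e1 /init; case: (val p').
  exact: qq.
have pp := valP p; have [r d] := path_ndist pp.
have [_ B] := V2_upto_all diag pp (ltnSn _).
have [|s' [q [q' [qE q'E qq]]] [a [z [m [b [E dz m2]]]]]] := B.
  rewrite ltn_neqAle d andbT; apply/eqP => dE; apply: lp.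
  by apply/distE.
have pq : p = q by apply: val_inj; rewrite qE; case: (val p).
split=> //; exists q'; rewrite pq; split=> //.
have [[i1 i2] i3] := tsc_same qq.
split; first by rewrite /long /shortest -i1 -i2 -i3 -pq.
have pm : path z m.
  have xs' : path (val p).1 s' by have := valP q'; rewrite /= q'E.
  move: (val p).1 E xs' => x; case: a => [|w a] [-> ->].
    by rewrite cat_path => /andP[].
  by rewrite cat_path /= cat_path => /and3P[_ _ /andP[]].
have [w wE] := qpath_ex pm; exists w; split.
- rewrite /subpath /vseq wE q'E; apply/infixP; exists a, b.
  by rewrite cat_cons; apply: E.
- by rewrite /long /shortest /init /term /plen wE /= => /distE[_ e]; rewrite e ltnn in dz.
- by rewrite /plen wE.
Qed.

End QuadraticV2.

Theorem corollary6p7 (G : digraph) :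
  diagonal G <->
  (property_V2 G /\ forall K : fieldType, is_resolution K G).
Proof.
split=> [diag|[_ res]].
  split; first exact: diagonal_V2.
  by move=> K; apply/resolutionP => m; apply: diagonal_offdiag_exact.
by apply: offdiag_exact_diagonal => K; apply/resolutionP/res.
Qed.
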